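(* Consider the problem of minimizing $\varphi(x):=\frac12\langle Ax,x\rangle+\langle b,x\rangle+\alpha+g(x)$ over $x\in\mathbb{R}^n$, where $A\in\mathbb{R}^{n\times n}$ is a symmetric positive-semidefinite matrix, $b\in\mathbb{R}^n$, $\alpha\in\mathbb{R}$, and $g:\mathbb{R}^n\to(-\infty,\infty]$ is a proper, lower semicontinuous, convex function. Let $x^0\in\mathbb{R}^n$, let $\gamma>0$ be such that $B:=I-\gamma A$ is positive-definite, and let $\lambda>0$, $\sigma\in(0,\frac12)$, $\beta\in(0,1)$. Then for the generalized regularized Newton algorithm for composite optimization (described in the context) we have: (i) The algorithm either stops after finitely many iterations, or produces a sequence $\{x^k\}$ all of whose accumulation points are optimal solutions to the problem. (ii) If in addition the subgradient mapping $\partial\varphi$ is metrically regular around $(\bar x,0)$ with modulus $\kappa>0$, where $\bar x$ is an accumulation point of $\{x^k\}$, then the (whole) sequence $\{x^k\}$ R-linearly converges to $\bar x$, and $\bar x$ is a tilt-stable local minimizer of $\varphi$ with modulus $\kappa$. (iii) Under the assumptions of (ii), the rate of convergence of $\{x^k\}$ is at least Q-superlinear if the subgradient mapping $\partial g$ is semismooth$^*$ at $(\bar x,\bar v)$, where $\bar v:=-A\bar x-b$, and if one of the following two conditions holds: (a) $\sigma\in(0,1/(2LK))$, where $L:=2(1-\gamma\lambda_{\min}(A))/\gamma$ and $K:=\kappa+\gamma\|B^{-1}\|$. (b) $g$ is twice epi-differentiable at $\bar x$ for $\bar v$.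
   Context: $\|\cdot\|$ is the Euclidean norm (operator norm for matrices); $\mathbb{B}_r(\bar x)$ is the closed ball; $\lambda_{\min}(A)$ is the smallest eigenvalue of $A$. Proximal objects. $\mathrm{Prox}_{\gamma g}(x):=\mathrm{argmin}_y\{g(y)+\frac1{2\gamma}\|y-x\|^2\}$. With $f(x):=\frac12\langle Ax,x\rangle+\langle b,x\rangle+\alpha$, the forward-backward envelope of $\varphi=f+g$ is $\varphi_\gamma(x):=\inf_{y}\{f(x)+\langle\nabla f(x),y-x\rangle+g(y)+\frac1{2\gamma}\|y-x\|^2\}$; it is $\mathcal{C}^1$ with $\nabla\varphi_\gamma(x)=\gamma^{-1}(I-\gamma A)\big(x-\mathrm{Prox}_{\gamma g}(x-\gamma(Ax+b))\big)$. Generalized differentiation. For $\emptyset\ne\Theta\subset\mathbb{R}^s$ and $\bar z\in\Theta$, $\widehat N_\Theta(\bar z):=\{v\mid\limsup_{z\to\bar z,\,z\in\Theta}\langle v,z-\bar z\rangle/\|z-\bar z\|\le0\}$ (with $\widehat N_\Theta(z):=\emptyset$ for $z\notin\Theta$), and $N_\Theta(\bar z):=\{v\mid\exists z_k\to\bar z,\ z_k\in\Theta,\ v_k\to v,\ v_k\in\widehat N_\Theta(z_k)\}$. For $F:\mathbb{R}^n\rightrightarrows\mathbb{R}^m$ and $(\bar x,\bar y)\in\mathrm{gph}\,F$, $D^*F(\bar x,\bar y)(v):=\{u\mid(u,-v)\in N_{\mathrm{gph}\,F}(\bar x,\bar y)\}$. For convex $g$, $\partial g$ is the convex subdifferential,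 and for $(x,y)\in\mathrm{gph}\,\partial g$ the generalized Hessian is $\partial^2g(x,y)(u):=(D^*\partial g)(x,y)(u)$. Metric regularity. $F$ is metrically regular around $(\bar x,\bar y)\in\mathrm{gph}\,F$ with modulus $\mu>0$ if there are neighborhoods $U$ of $\bar x$, $V$ of $\bar y$ with $\mathrm{dist}(x;F^{-1}(y))\le\mu\,\mathrm{dist}(y;F(x))$ for all $(x,y)\in U\times V$. Semismooth$^*$ property. $N_\Theta(\bar z;d):=\{v\mid\exists t_k\downarrow0,\ d_k\to d,\ v_k\to v,\ v_k\in\widehat N_\Theta(\bar z+t_kd_k)\}$ and $D^*F((\bar x,\bar y);(u,v))(v^* ):=\{u^*\mid(u^*,-v^* )\in N_{\mathrm{gph}\,F}((\bar x,\bar y);(u,v))\}$. $F$ is semismooth$^*$ at $(\bar x,\bar y)\in\mathrm{gph}\,F$ if for all $(u,v)$ one has $\langle u^*,u\rangle=\langle v^*,v\rangle$ for all $(v^*,u^* )\in\mathrm{gph}\,D^*F((\bar x,\bar y);(u,v))$. Twice epi-differentiability. Let $\Delta^2_\tau g(\bar x,v)(u):=\big(g(\bar x+\tau u)-g(\bar x)-\tau\langle v,u\rangle\big)/(\frac12\tau^2)$ and $d^2g(\bar x,v)(w):=\liminf_{\tau\downarrow0,\,u\to w}\Delta^2_\tau g(\bar x,v)(u)$. $g$ is twice epi-differentiable at $\bar x$ for $v$ if for every $w\in\mathbb{R}^n$ and every $\tau_k\downarrow0$ there is $w^k\to w$ with $\Delta^2_{\tau_k}g(\bar x,v)(w^k)\to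 d^2g(\bar x,v)(w)$. Tilt stability. $\bar x\in\mathrm{dom}\,\varphi$ is a tilt-stable local minimizer of $\varphi$ if there is $r>0$ such that $M_r: v\mapsto\mathrm{argmin}\{\varphi(x)-\langle v,x\rangle\mid x\in\mathbb{B}_r(\bar x)\}$ is single-valued and Lipschitz continuous on some neighborhood of $0$ with $M_r(0)=\{\bar x\}$; a modulus is a Lipschitz constant of $M_r$ around the origin. Rates. $x^k\to\bar x$ (at least) R-linearly: $\exists\mu\in(0,1),c>0,k_0$ with $\|x^k-\bar x\|\le c\mu^k$ for $k\ge k_0$; at least Q-superlinearly: $\|x^{k+1}-\bar x\|/\|x^k-\bar x\|\to0$. Generalized regularized Newton algorithm for composite optimization. For $k=0,1,\ldots$: if $\nabla\varphi_\gamma(x^k)=0$, stop; otherwise set $u^k:=x^k-\gamma(Ax^k+b)$, $v^k:=\mathrm{Prox}_{\gamma g}(u^k)$, $\mu_k:=\lambda\|\nabla\varphi_\gamma(x^k)\|$; find any $z^k\in\mathbb{R}^n$ such that $-\frac1\gamma(x^k-v^k)-(\mu_kI+AB)z^k\in\partial^2g\big(v^k,\frac1\gamma(u^k-v^k)\big)\big(x^k-v^k+(B+\gamma\mu_kI)z^k\big)$; set $d^k:=Bz^k$; set $\tau_k=1$ and while $\varphi_\gamma(x^k+\tau_kd^k)>\varphi_\gamma(x^k)+\sigma\tau_k\langle\nabla\varphi_\gamma(x^k),d^k\rangle$ replace $\tau_k$ by $\beta\tau_k$; then set $x^{k+1}:=x^k+\tau_kd^k$. *)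

(* Defs.v *)
From HB Require Import structures.
From mathcomp Require Import all_boot all_order all_algebra.
From mathcomp Require Import all_classical all_reals all_analysis.
Set Implicit Arguments.
Unset Strict Implicit.
Unset Printing Implicit Defensive.
Import Order.TTheory GRing.Theory Num.Theory.
Import numFieldNormedType.Exports.
Local Open Scope classical_set_scope.
Local Open Scope ring_scope.

(* R^n is 'cV[R]_n, whose
   library norm `|x| is the sup norm: its topology is the Euclidean one, so the
   library's convergence is used as is, but every quantitative estimate goes
   through enorm. Extended-real-valued functions take values in \bar R, and
   F : R^n => R^m is a function 'cV[R]_n -> set 'cV[R]_m. *)

Definition dot (R : realType) (n : nat) (x y : 'cV[R]_n) : R :=
  \sum_i x i 0 * y i 0.

Definition enorm (R : realType) (n : nat) (x : 'cV[R]_n) : R :=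
  Num.sqrt (dot x x).

Definition opnorm (R : realType) (n : nat) (M : 'M[R]_n) : R :=
  sup [set enorm (M *m x) | x in [set x : 'cV[R]_n | enorm x <= 1]].

Definition sym_mx (R : realType) (n : nat) (M : 'M[R]_n) : Prop := M^T = M.

Definition psd_mx (R : realType) (n : nat) (M : 'M[R]_n) : Prop :=
  sym_mx M /\ forall x : 'cV[R]_n, 0 <= dot (M *m x) x.

Definition pd_mx (R : realType) (n : nat) (M : 'M[R]_n) : Prop :=
  sym_mx M /\ forall x : 'cV[R]_n, x != 0 -> 0 < dot (M *m x) x.

(* A symmetric real matrix of positive size has a finite nonempty set of
   eigenvalues, so this infimum is attained. *)
Definition lambda_min (R : realType) (n : nat) (M : 'M[R]_n) : R :=
  inf [set a : R | eigenvalue M a].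

(* dist(x; S), equal to +oo when S is empty *)
Definition edist_set (R : realType) (n : nat) (x : 'cV[R]_n)
    (S : set 'cV[R]_n) : \bar R :=
  ereal_inf [set (enorm (x - y))%:E | y in S].

Definition eball (R : realType) (n : nat) (r : R) (x : 'cV[R]_n) :
    set 'cV[R]_n :=
  [set y | enorm (y - x) <= r].

Definition grad (R : realType) (n : nat) (f : 'cV[R]_n -> R) (x : 'cV[R]_n) :
    'cV[R]_n :=
  \col_i 'D_(delta_mx i 0) f x.

Definition quad (R : realType) (n : nat) (A : 'M[R]_n) (b : 'cV[R]_n)
    (alpha : R) (x : 'cV[R]_n) : R :=
  2^-1 * dot (A *m x) x + dot b x + alpha.

Definition eproper (R : realType) (n : nat) (g : 'cV[R]_n -> \bar R) : Prop :=
  (forall x, g x != -oo%E) /\ exists x, g x \is a fin_num.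

Definition econvex (R : realType) (n : nat) (g : 'cV[R]_n -> \bar R) : Prop :=
  forall (x y : 'cV[R]_n) (t : R), 0 < t < 1 ->
    (g (t *: x + (1 - t) *: y)%R <= t%:E * g x + (1 - t)%:E * g y)%E.

Definition argmin (R : realType) (n : nat) (S : set 'cV[R]_n)
    (h : 'cV[R]_n -> \bar R) : set 'cV[R]_n :=
  [set x | S x /\ forall y, S y -> (h x <= h y)%E].

Definition prox (R : realType) (n : nat) (gamma : R)
    (g : 'cV[R]_n -> \bar R) (x : 'cV[R]_n) : set 'cV[R]_n :=
  argmin setT
    (fun y => (g y + ((2 * gamma)^-1 * enorm (y - x) ^+ 2)%:E)%E).

(* forward-backward envelope of f + g *)
Definition fbe (R : realType) (n : nat) (gamma : R) (f : 'cV[R]_n -> R)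
    (g : 'cV[R]_n -> \bar R) (x : 'cV[R]_n) : \bar R :=
  ereal_inf [set ((f x + dot (grad f x) (y - x))%:E + g y +
                  ((2 * gamma)^-1 * enorm (y - x) ^+ 2)%:E)%E
            | y in setT].

(* Where z is an isolated point of Theta the filter is improper, the limsup is
   -oo and every v is a regular normal, as usual. *)
Definition regular_normal (R : realType) (s : nat) (Theta : set 'cV[R]_s)
    (z : 'cV[R]_s) : set 'cV[R]_s :=
  [set v | Theta z /\
    (limf_esup (fun y : 'cV[R]_s => (dot v (y - z) / enorm (y - z))%:E)
       (within Theta z^') <= 0)%E].

Definition limiting_normal (R : realType) (s : nat) (Theta : set 'cV[R]_s)
    (z : 'cV[R]_s) : set 'cV[R]_s :=
  [set v | Theta z /\
    exists z_ v_ : nat -> 'cV[R]_s,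
      [/\ z_ @ \oo --> z, v_ @ \oo --> v &
          forall k, regular_normal Theta (z_ k) (v_ k)]].

Definition dir_limiting_normal (R : realType) (s : nat)
    (Theta : set 'cV[R]_s) (z d : 'cV[R]_s) : set 'cV[R]_s :=
  [set v | Theta z /\
    exists (t_ : nat -> R) (d_ v_ : nat -> 'cV[R]_s),
      [/\ (forall k, 0 < t_ k), t_ @ \oo --> 0,
          d_ @ \oo --> d, v_ @ \oo --> v &
          forall k, regular_normal Theta (z + t_ k *: d_ k) (v_ k)]].

Definition gph (R : realType) (n m : nat) (F : 'cV[R]_n -> set 'cV[R]_m) :
    set 'cV[R]_(n + m) :=
  [set z | F (usubmx z) (dsubmx z)].

(* coderivative F x y v u stands for u \in D*F(x, y)(v) *)
Definition coderivative (R : realType) (n m : nat)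
    (F : 'cV[R]_n -> set 'cV[R]_m) (x : 'cV[R]_n) (y : 'cV[R]_m)
    (v : 'cV[R]_m) : set 'cV[R]_n :=
  [set u | limiting_normal (gph F) (col_mx x y) (col_mx u (- v))].

(* dir_coderivative F x y u v vs us stands for us \in D*F((x, y); (u, v))(vs) *)
Definition dir_coderivative (R : realType) (n m : nat)
    (F : 'cV[R]_n -> set 'cV[R]_m) (x : 'cV[R]_n) (y : 'cV[R]_m)
    (u : 'cV[R]_n) (v : 'cV[R]_m) (vs : 'cV[R]_m) : set 'cV[R]_n :=
  [set us | dir_limiting_normal (gph F) (col_mx x y) (col_mx u v)
              (col_mx us (- vs))].

Definition semismooth_star (R : realType) (n m : nat)
    (F : 'cV[R]_n -> set 'cV[R]_m) (x : 'cV[R]_n) (y : 'cV[R]_m) : Prop :=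
  F x y /\
  forall (u : 'cV[R]_n) (v vs : 'cV[R]_m) (us : 'cV[R]_n),
    dir_coderivative F x y u v vs us -> dot us u = dot vs v.

Definition metrically_regular (R : realType) (n m : nat)
    (F : 'cV[R]_n -> set 'cV[R]_m) (x0 : 'cV[R]_n) (y0 : 'cV[R]_m) (mu : R) :
    Prop :=
  F x0 y0 /\
  exists (U : set 'cV[R]_n) (V : set 'cV[R]_m),
    [/\ nbhs x0 U, nbhs y0 V &
        forall x y, U x -> V y ->
          (edist_set x [set x' | F x' y] <= mu%:E * edist_set y (F x))%E].

Definition subdiff (R : realType) (n : nat) (g : 'cV[R]_n -> \bar R)
    (x : 'cV[R]_n) : set 'cV[R]_n :=
  [set v | g x \is a fin_num /\
           forall y, (g x + (dot v (y - x))%:E <= g y)%E].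

Definition gen_hessian (R : realType) (n : nat) (g : 'cV[R]_n -> \bar R)
    (x y u : 'cV[R]_n) : set 'cV[R]_n :=
  coderivative (subdiff g) x y u.

Definition second_quotient (R : realType) (n : nat) (g : 'cV[R]_n -> \bar R)
    (x v : 'cV[R]_n) (tau : R) (u : 'cV[R]_n) : \bar R :=
  ((g (x + tau *: u)%R - g x - (tau * dot v u)%:E) *
     ((2^-1 * tau ^+ 2)^-1)%:E)%E.

Definition second_subderivative (R : realType) (n : nat)
    (g : 'cV[R]_n -> \bar R) (x v w : 'cV[R]_n) : \bar R :=
  limf_einf (fun p : R * 'cV[R]_n => second_quotient g x v p.1 p.2)
    (filter_prod 0^'+ (nbhs w)).

Definition twice_epi_differentiable (R : realType) (n : nat)
    (g : 'cV[R]_n -> \bar R) (x v : 'cV[R]_n) : Prop :=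
  forall (w : 'cV[R]_n) (tau : nat -> R),
    (forall k, 0 < tau k) -> tau @ \oo --> 0 ->
    exists w_ : nat -> 'cV[R]_n,
      w_ @ \oo --> w /\
      second_quotient g x v (tau k) (w_ k) @[k --> \oo]
        --> second_subderivative g x v w.

Definition tilt_stable (R : realType) (n : nat) (phi : 'cV[R]_n -> \bar R)
    (x : 'cV[R]_n) (kappa : R) : Prop :=
  phi x \is a fin_num /\
  exists (r : R) (m : 'cV[R]_n -> 'cV[R]_n) (U : set 'cV[R]_n),
    [/\ 0 < r, nbhs (0 : 'cV[R]_n) U, m 0 = x,
        forall v, U v ->
          argmin (eball r x) (fun y => (phi y - (dot v y)%:E)%E) = [set m v] &
        forall v w, U v -> U w -> enorm (m v - m w) <= kappa * enorm (v - w)].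

Definition R_linear_cvg (R : realType) (n : nat) (x : nat -> 'cV[R]_n)
    (xbar : 'cV[R]_n) : Prop :=
  exists (mu c : R) (k0 : nat),
    [/\ 0 < mu < 1, 0 < c &
        forall k, (k0 <= k)%N -> enorm (x k - xbar) <= c * mu ^+ k].

Definition Q_superlinear_cvg (R : realType) (n : nat) (x : nat -> 'cV[R]_n)
    (xbar : 'cV[R]_n) : Prop :=
  x @ \oo --> xbar /\
  (enorm (x k.+1 - xbar) / enorm (x k - xbar)) @[k --> \oo] --> 0.

(* f + g with f = quad A b alpha; comp_fbe is its envelope and comp_fbe_grad
   the gradient of the envelope, which is real-valued for convex g. *)
Definition comp_obj (R : realType) (n : nat) (A : 'M[R]_n) (b : 'cV[R]_n)
    (alpha : R) (g : 'cV[R]_n -> \bar R) (x : 'cV[R]_n) : \bar R :=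
  ((quad A b alpha x)%:E + g x)%E.

Definition comp_fbe (R : realType) (n : nat) (A : 'M[R]_n) (b : 'cV[R]_n)
    (alpha : R) (g : 'cV[R]_n -> \bar R) (gamma : R) (x : 'cV[R]_n) : \bar R :=
  fbe gamma (quad A b alpha) g x.

Definition comp_fbe_grad (R : realType) (n : nat) (A : 'M[R]_n)
    (b : 'cV[R]_n) (alpha : R) (g : 'cV[R]_n -> \bar R) (gamma : R)
    (x : 'cV[R]_n) : 'cV[R]_n :=
  grad (fun y => fine (comp_fbe A b alpha g gamma y)) x.

(* z is an admissible z^k at the iterate x. The quantifier on v binds
   v^k = Prox_{gamma g}(u^k). *)
Definition newton_system (R : realType) (n : nat) (A : 'M[R]_n)
    (b : 'cV[R]_n) (alpha : R) (g : 'cV[R]_n -> \bar R) (gamma lambda : R)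
    (x z : 'cV[R]_n) : Prop :=
  let B := 1%:M - gamma *: A in
  let u := x - gamma *: (A *m x + b) in
  let mu := lambda * enorm (comp_fbe_grad A b alpha g gamma x) in
  exists2 v : 'cV[R]_n, prox gamma g u = [set v] &
    gen_hessian g v (gamma^-1 *: (u - v))
      (x - v + (B + (gamma * mu)%:M) *m z)
      (- (gamma^-1 *: (x - v)) - (mu%:M + A *m B) *m z).

Definition armijo (R : realType) (n : nat) (A : 'M[R]_n) (b : 'cV[R]_n)
    (alpha : R) (g : 'cV[R]_n -> \bar R) (gamma sigma : R)
    (x d : 'cV[R]_n) (tau : R) : Prop :=
  (comp_fbe A b alpha g gamma (x + tau *: d)%R <=
   comp_fbe A b alpha g gamma x +
     (sigma * tau * dot (comp_fbe_grad A b alpha g gamma x) d)%:E)%E.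

(* The backtracking loop terminates and returns tau. *)
Definition line_search (R : realType) (n : nat) (A : 'M[R]_n)
    (b : 'cV[R]_n) (alpha : R) (g : 'cV[R]_n -> \bar R)
    (gamma sigma beta : R) (x d : 'cV[R]_n) (tau : R) : Prop :=
  exists m : nat,
    [/\ tau = beta ^+ m, armijo A b alpha g gamma sigma x d (beta ^+ m) &
        forall j, (j < m)%N ->
          ~ armijo A b alpha g gamma sigma x d (beta ^+ j)].

Definition grn_step (R : realType) (n : nat) (A : 'M[R]_n) (b : 'cV[R]_n)
    (alpha : R) (g : 'cV[R]_n -> \bar R) (gamma lambda sigma beta : R)
    (x x' : 'cV[R]_n) : Prop :=
  exists (z : 'cV[R]_n) (tau : R),
    let d := (1%:M - gamma *: A) *m z in
    [/\ newton_system A b alpha g gamma lambda x z,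
        line_search A b alpha g gamma sigma beta x d tau &
        x' = x + tau *: d].

(* x 0, ..., x N are the first N + 1 iterates of some run from x0: none of the
   first N of them triggers the stopping test. *)
Definition grn_run (R : realType) (n : nat) (A : 'M[R]_n) (b : 'cV[R]_n)
    (alpha : R) (g : 'cV[R]_n -> \bar R) (gamma lambda sigma beta : R)
    (x0 : 'cV[R]_n) (x : nat -> 'cV[R]_n) (N : nat) : Prop :=
  x 0 = x0 /\
  forall k, (k < N)%N ->
    comp_fbe_grad A b alpha g gamma (x k) <> 0 /\
    grn_step A b alpha g gamma lambda sigma beta (x k) (x k.+1).

(* x follows the algorithm for as long as the stopping test fails; its values
   past a stationary iterate are irrelevant. *)
Definition grn_sequence (R : realType) (n : nat) (A : 'M[R]_n) (b : 'cV[R]_n)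
    (alpha : R) (g : 'cV[R]_n -> \bar R) (gamma lambda sigma beta : R)
    (x0 : 'cV[R]_n) (x : nat -> 'cV[R]_n) : Prop :=
  forall N : nat,
    (forall k, (k < N)%N -> comp_fbe_grad A b alpha g gamma (x k) <> 0) ->
    grn_run A b alpha g gamma lambda sigma beta x0 x N.

(* Main.v *)
Require Import Defs.
From HB Require Import structures.
From mathcomp Require Import all_boot all_order all_algebra.
From mathcomp Require Import all_classical all_reals all_analysis.
From mathcomp Require Import ring lra.
Set Implicit Arguments.
Unset Strict Implicit.
Unset Printing Implicit Defensive.
Import Order.TTheory GRing.Theory Num.Theory.
Import numFieldNormedType.Exports.
Local Open Scope classical_set_scope.
Local Open Scope ring_scope.

(** Write B = I - gamma A and let v(x) be the proximal point of x - gamma (A x + b).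
    The forward-backward envelope psi of phi is convex and has the gradient
    G x = gamma^-1 B (x - v(x)), which is gamma^-1-Lipschitz (fbe_smooth_convex).
    The graph of the subdifferential of g is the set of the points (v(x), s(x))
    with B x = v + gamma s + gamma b, and G x = A v + s + b. These linear
    relations transport normal vectors (limiting_normal_coderiv): z solves the
    Newton system at x exactly when - G x - mu B z lies in the coderivative of G
    at x, applied to B z (newton_systemE). The algorithm thus is a regularized
    Newton method for the smooth convex function psi, and is analysed as such,
    for any convex psi with an l-Lipschitz gradient G.

    Cocoercivity of G carries over to its coderivative: |u|^2 <= l <u, h> if u
    belongs to D*G(x)(h). Hence the Newton direction d satisfies
    <G x, d> <= - mu |d|^2, backtracking stops, and near a point where G does not
    vanish an iteration decreases psi by a fixed amount, which cannot happen
    infinitely often (newton_cluster_stationary). Zeros of G are the minimizers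
    of phi. Directions exist since the regularized map G + mu id is strongly
    monotone (limiting_coderiv_exists).

    Monotonicity turns metric regularity of the subdifferential of phi into a
    single-valued kappa-Lipschitz local inverse m (metrically_regular_inverse);
    as subgradients of a convex function characterize the minimizers of its
    tilts, this is tilt stability. Since G x is a subgradient of phi at v(x), the
    map y |-> m y + gamma B^-1 y is a local inverse of G, with some Lipschitz
    constant K. Then |h| <= K |u| for u in D*G(x)(h) with x near xb, so that
    psi has uniform curvature along the Newton directions, the step sizes are
    bounded below, and psi - psi xb, comparable to |G|^2 and to |x - xb|^2, decreases
    linearly (newton_gap_linear).

    The semismooth* property only gives the scalar relation
    <u, x - xb> = <h, G x> + o(|x - xb|) |h| for u in D*G(x)(h). A mean value argument
    deduces that G is nearly homogeneous along rays from xb (radial_growth).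
    As G is a gradient, it follows that the function
    E x = <G x, x - xb> - 2 (psi x - psi xb) has Lipschitz constant o(|x - xb|) near xb
    (euler_defect_lipschitz). Near x the function <x - xb, G> equals E plus a
    function with derivative G x at x, so if - G x - mu d is in D*G(x)(d) then
    - mu d is, up to o(|x - xb|), in D*G(x)(x + d - xb), and regularity yields
    |x + d - xb| = o(|x - xb|). Moreover |E x| = o(|x - xb|^2) says that
    psi x - psi xb = <G x, x - xb> / 2 + o(|x - xb|^2); as sigma < 1/2, the unit step is
    eventually accepted, and the convergence is superlinear. *)

(** * Euclidean space *)

Section Euclid.
Variables (R : realType) (n : nat).
Implicit Types (x y z u v w : 'cV[R]_n) (a e : R).

Lemma dotC x y : dot x y = dot y x.
Proof. by apply: eq_bigr => i _; rewrite mulrC. Qed.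

Lemma dotDl x y z : dot (x + y) z = dot x z + dot y z.
Proof. by rewrite /dot -big_split; apply: eq_bigr => i _; rewrite mxE mulrDl. Qed.

Lemma dotDr x y z : dot z (x + y) = dot z x + dot z y.
Proof. by rewrite !(dotC z) dotDl. Qed.

Lemma dotZl a x y : dot (a *: x) y = a * dot x y.
Proof. by rewrite /dot mulr_sumr; apply: eq_bigr => i _; rewrite mxE mulrA. Qed.

Lemma dotZr a x y : dot x (a *: y) = a * dot x y.
Proof. by rewrite dotC dotZl dotC. Qed.

Lemma dotNl x y : dot (- x) y = - dot x y.
Proof. by rewrite -scaleN1r dotZl mulN1r. Qed.

Lemma dotNr x y : dot x (- y) = - dot x y.
Proof. by rewrite dotC dotNl dotC. Qed.

Lemma dot0l x : dot 0 x = 0.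
Proof. by rewrite -(scale0r 0) dotZl mul0r. Qed.

Lemma dot0r x : dot x 0 = 0.
Proof. by rewrite dotC dot0l. Qed.

Definition dotE := (dotDl, dotDr, dotNl, dotNr, dotZl, dotZr, dot0l, dot0r).

Lemma dot_ge0 x : 0 <= dot x x.
Proof. by apply: sumr_ge0 => i _; rewrite -expr2 sqr_ge0. Qed.

Lemma dot_eq0 x : dot x x = 0 -> x = 0.
Proof.
move=> /eqP; rewrite psumr_eq0 => [/allP xx0|i _]; last by rewrite -expr2 sqr_ge0.
apply/matrixP => i j; rewrite !ord1 mxE.
have /implyP/(_ isT) := xx0 i (mem_index_enum _).
by rewrite mulf_eq0 orbb => /eqP.
Qed.

Lemma enorm_ge0 x : 0 <= enorm x.
Proof. exact: sqrtr_ge0. Qed.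

Lemma sqr_enorm x : enorm x ^+ 2 = dot x x.
Proof. by rewrite sqr_sqrtr // dot_ge0. Qed.

Lemma enorm0 : enorm (0 : 'cV[R]_n) = 0.
Proof. by rewrite /enorm dot0l sqrtr0. Qed.

Lemma enorm_eq0 x : enorm x = 0 -> x = 0.
Proof. by move=> x0; apply: dot_eq0; rewrite -sqr_enorm x0 expr0n. Qed.

Lemma enorm_gt0 x : x != 0 -> 0 < enorm x.
Proof.
by move=> x0; rewrite lt_neqAle enorm_ge0 andbT eq_sym; apply: contraNneq x0 => /enorm_eq0 ->.
Qed.

Lemma enormZ a x : enorm (a *: x) = `|a| * enorm x.
Proof. by rewrite /enorm dotZl dotZr mulrA -expr2 sqrtrM ?sqr_ge0 // sqrtr_sqr. Qed.

Lemma enormN x : enorm (- x) = enorm x.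
Proof. by rewrite /enorm dotNl dotNr opprK. Qed.

Lemma enormBC x y : enorm (x - y) = enorm (y - x).
Proof. by rewrite -opprB enormN. Qed.

Lemma dot_le_enorm x y : dot x y <= enorm x * enorm y.
Proof.
have [->|/enorm_gt0 x0] := eqVneq x 0; first by rewrite dot0l enorm0 mul0r.
have [->|/enorm_gt0 y0] := eqVneq y 0; first by rewrite dot0r enorm0 mulr0.
have := dot_ge0 (enorm y *: x - enorm x *: y).
rewrite !dotE -!sqr_enorm (dotC y x) => h.
have xy0 : 0 < enorm x * enorm y by rewrite mulr_gt0.
by rewrite -(ler_pM2l xy0); nra.
Qed.

Lemma norm_dot_le x y : `|dot x y| <= enorm x * enorm y.
Proof. by rewrite ler_norml dot_le_enorm andbT lerNl -dotNl -(enormN x) dot_le_enorm. Qed.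

Lemma ler_enormD x y : enorm (x + y) <= enorm x + enorm y.
Proof.
rewrite -ler_sqr ?nnegrE ?addr_ge0 ?enorm_ge0 // sqr_enorm !dotE (dotC y x) -!sqr_enorm.
by have := dot_le_enorm x y; nra.
Qed.

Lemma ler_enormB x y : enorm (x - y) <= enorm x + enorm y.
Proof. by rewrite -(enormN y) ler_enormD. Qed.

Lemma ler_enorm_dist x y : enorm x <= enorm y + enorm (x - y).
Proof. by rewrite -{1}(subrK y x) addrC ler_enormD. Qed.

Lemma ler_enorm_tri x y z : enorm (x - z) <= enorm (x - y) + enorm (y - z).
Proof. by rewrite -(subrKA y) ler_enormD. Qed.

Lemma le_enorm_sq x a : 0 <= a -> dot x x <= a ^+ 2 -> enorm x <= a.
Proof. by move=> a0; rewrite -sqr_enorm ler_sqr // nnegrE enorm_ge0. Qed.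

(** Coderivatives only give scalar information, one direction h at a time. *)
Lemma le_enorm_dot x a : 0 <= a -> (forall h, dot h x <= a * enorm h) -> enorm x <= a.
Proof.
move=> a0 ha; have [->|/enorm_gt0 x0] := eqVneq x 0; first by rewrite enorm0.
by rewrite -(ler_pM2r x0) -expr2 sqr_enorm ha.
Qed.

Lemma le_coord_enorm x i : `|x i 0| <= enorm x.
Proof.
rewrite -sqrtr_sqr ler_wsqrtr // /dot (bigD1 i) //= expr2 lerDl.
by apply: sumr_ge0 => j _; rewrite -expr2 sqr_ge0.
Qed.

Lemma normr_le_enorm x : `|x| <= enorm x.
Proof.
rewrite [leLHS]/Num.Def.normr /= mx_normrE bigmax_le ?enorm_ge0 // => -[i j] _ /=.
by rewrite ord1 le_coord_enorm.
Qed.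

Lemma le_coord_normr x i : `|x i 0| <= `|x|.
Proof. by rewrite [leRHS]/Num.Def.normr /= mx_normrE; apply/bigmax_geP; right; exists (i, 0). Qed.

Lemma enorm_le_coord x a : 0 <= a -> (forall i, `|x i 0| <= a) -> enorm x <= n.+1%:R * a.
Proof.
move=> a0 xa; apply: le_enorm_sq; first by rewrite mulr_ge0.
apply: (@le_trans _ _ (\sum_(i < n) a ^+ 2)).
  apply: ler_sum => i _; rewrite -expr2 -real_normK ?num_real //.
  by rewrite ler_sqr ?nnegrE.
rewrite sumr_const card_ord exprMn -[leLHS]mulr_natl ler_wpM2r ?sqr_ge0 //.
by rewrite -natrX ler_nat expnS expn1 (leq_trans (leqnSn n)) // leq_pmulr.
Qed.

Lemma enorm_le_normr x : enorm x <= n.+1%:R * `|x|.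
Proof. by apply: enorm_le_coord => // i; exact: le_coord_normr. Qed.

Lemma enorm_nbhsP x (U : set 'cV[R]_n) :
  nbhs x U <-> exists2 d, 0 < d & forall y, enorm (y - x) < d -> U y.
Proof.
split=> [/nbhs_normP[d /= d0 dU]|[d d0 dU]].
  exists d => // y yx; apply: dU => /=.
  by rewrite distrC (le_lt_trans _ yx) // normr_le_enorm.
apply/(nbhs_normP x U); exists (d / n.+1%:R) => /=; first by rewrite divr_gt0.
move=> y /=; rewrite distrC => yx; apply: dU.
by rewrite (le_lt_trans (enorm_le_normr _)) // mulrC -ltr_pdivlMr.
Qed.

Lemma ecvgP (s : nat -> 'cV[R]_n) x :
  s @ \oo --> x <->
  forall e, 0 < e -> exists N, forall k, (N <= k)%N -> enorm (s k - x) < e.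
Proof.
split=> [sx e e0|sx U /enorm_nbhsP[d d0 dU]].
  have : nbhs x [set y | enorm (y - x) < e] by apply/enorm_nbhsP; exists e.
  by move/sx => [N _ NP]; exists N => k Nk; exact: NP.
by have [N NP] := sx d d0; exists N => // k /= Nk; apply: dU; exact: NP.
Qed.

Lemma ecluster_seqP (s : nat -> 'cV[R]_n) x :
  cluster (s @ \oo) x <->
  forall e N, 0 < e -> exists2 k, (N <= k)%N & enorm (s k - x) < e.
Proof.
split=> [cx e N e0|cx P U [N _ NP] /enorm_nbhsP[d d0 dU]].
  have ux : nbhs x [set y | enorm (y - x) < e] by apply/enorm_nbhsP; exists e.
  have sN : (s @ \oo) (s @` [set k | (N <= k)%N]).
    by exists N => // k /= Nk; exists k.
  by have [_ [[k Nk <-] ke]] := cx _ _ sN ux; exists k.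
have [k Nk kd] := cx d N d0.
by exists (s k); split; [exact: NP | exact: dU].
Qed.

Lemma bounded_seq_cluster (s : nat -> 'cV[R]_n) C : (forall k, enorm (s k) <= C) ->
  exists x, forall e N, 0 < e -> exists2 k, (N <= k)%N & enorm (s k - x) < e.
Proof.
move=> sC.
have : compact [set y : 'rV[R]_n | forall i, `[- C, C]%classic (y ord0 i)].
  by apply: (@rV_compact _ _ (fun=> `[- C, C]%classic)) => _; exact: segment_compact.
move=> /(_ ((fun k => (s k)^T) @ \oo)).
have Fs : ((fun k => (s k)^T) @ \oo) [set y | forall i, `[- C, C]%classic (y ord0 i)].
  exists 0%N => // k _ i /=; rewrite mxE in_itv /= -ler_norml.
  by rewrite (le_trans (le_coord_enorm _ _)).
move=> /(_ _ Fs) [y [_ ys]]; exists y^T => e N e0.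
have sN : ((fun k => (s k)^T) @ \oo) ((fun k => (s k)^T) @` [set k | (N <= k)%N]).
  by exists N => // k /= Nk; exists k.
have d0 : 0 < e / n.+1%:R / 2 by rewrite !divr_gt0.
have [_ [[k /= Nk <-] kd]] := ys _ _ sN (nbhsx_ballx y _ d0).
exists k => //; rewrite (@le_lt_trans _ _ (n.+1%:R * (e / n.+1%:R / 2))) //.
  apply: enorm_le_coord => [|i]; first exact: ltW.
  case: kd => _ /(_ 0 i); rewrite /ball /= !mxE => /ltW.
  by rewrite distrC.
by rewrite mulrA (mulrC n.+1%:R) divfK ?pnatr_eq0 // ltr_pdivrMr // ltr_pMr // ltr1n.
Qed.

End Euclid.

Section Minimization.
Variables (R : realType) (n : nat).

Lemma ereal_between (a c : \bar R) : (a < c)%E -> exists r : R, (a < r%:E < c)%E.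
Proof.
case: a c => [a| |] [c| |] //= ac.
- exists ((a + c) / 2); rewrite !lte_fin in ac *; lra.
- by exists (a + 1); rewrite lte_fin ltry; lra.
- by exists (c - 1); rewrite lte_fin ltNyr; lra.
- by exists 0; rewrite ltNyr ltry.
Qed.

(** Closedness of S and lower semicontinuity are stated relative to S and to
    the Euclidean norm, the form in which they hold for balls and cylinders. *)
Lemma lsc_attains_min (S : set 'cV[R]_n) (f : 'cV[R]_n -> \bar R) (C : R) z0 :
  S z0 -> (forall z, S z -> enorm z <= C) ->
  (forall z, (forall e, 0 < e -> exists2 y, S y & enorm (y - z) < e) -> S z) ->
  (forall z (a : R), S z -> (a%:E < f z)%E ->
     exists2 d, 0 < d & forall y, S y -> enorm (y - z) < d -> (a%:E < f y)%E) ->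
  exists2 z, S z & forall y, S y -> (f z <= f y)%E.
Proof.
move=> Sz0 SC Scl flsc.
have [|u uS ucvg] := @ereal_inf_seq _ (f @` S).
  by apply/set0P; exists (f z0), z0.
have /choice[s sP] : forall k, exists y, S y /\ f y = u k.
  by move=> k; have [y] := uS k; exists y.
have [z zs] : exists z, forall e N, 0 < e -> exists2 k, (N <= k)%N & enorm (s k - z) < e.
  by apply: (@bounded_seq_cluster _ _ _ C) => k; apply: SC; exact: (sP k).1.
have Sz : S z.
  apply: Scl => e e0; have [k _ ke] := zs e 0%N e0.
  by exists (s k) => //; exact: (sP k).1.
exists z => // y Sy; rewrite leNgt; apply/negP => /ereal_between[a /andP[ya az]].
have [d d0 dP] := flsc z a Sz az.
have : nbhs (ereal_inf (f @` S)) [set r | (r < a%:E)%E].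
  apply: open_nbhs_nbhs; split; first exact: open_ereal_lt_ereal.
  by apply: (le_lt_trans _ ya); apply: ereal_inf_lbound; exists y.
move=> /ucvg[N _ NP]; have [k Nk kd] := zs d N d0.
have := dP _ (sP k).1 kd; rewrite (sP k).2; have := NP k Nk => /= ua au.
by have := lt_trans ua au; rewrite ltxx.
Qed.

Lemma calm_attains_min (S : set 'cV[R]_n) (f : 'cV[R]_n -> R) (C : R) z0 :
  S z0 -> (forall z, S z -> enorm z <= C) ->
  (forall z, (forall e, 0 < e -> exists2 y, S y & enorm (y - z) < e) -> S z) ->
  (forall z, S z -> exists2 c, 0 <= c & forall y, S y -> f z <= f y + c * enorm (y - z)) ->
  exists2 z, S z & forall y, S y -> f z <= f y.
Proof.
move=> Sz0 SC Scl fcalm.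
have [z a Sz|z Sz zmin] := @lsc_attains_min S (EFin \o f) C z0 Sz0 SC Scl.
  rewrite /= lte_fin -subr_gt0 => az; have [c c0 cP] := fcalm z Sz.
  have c1 : 0 < c + 1 by rewrite ltr_wpDl.
  exists ((f z - a) / (c + 1)) => [|y Sy yz]; first by rewrite divr_gt0.
  rewrite /= lte_fin; have := cP y Sy; move: yz; rewrite ltr_pdivlMr //.
  by have := enorm_ge0 (y - z); nra.
by exists z => // y Sy; have := zmin y Sy; rewrite lee_fin.
Qed.

End Minimization.

Section Stacking.
Variables (R : realType) (n m : nat).

Lemma dot_col_mx (x u : 'cV[R]_n) (y v : 'cV[R]_m) :
  dot (col_mx x y) (col_mx u v) = dot x u + dot y v.
Proof.
rewrite /dot big_split_ord /=; congr (_ + _); apply: eq_bigr => i _.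
  by rewrite !col_mxEu.
by rewrite !col_mxEd.
Qed.

Lemma sqr_enorm_col_mx (x : 'cV[R]_n) (y : 'cV[R]_m) :
  enorm (col_mx x y) ^+ 2 = enorm x ^+ 2 + enorm y ^+ 2.
Proof. by rewrite !sqr_enorm dot_col_mx. Qed.

Lemma enorm_le_col_mxu (x : 'cV[R]_n) (y : 'cV[R]_m) : enorm x <= enorm (col_mx x y).
Proof.
by apply: le_enorm_sq; rewrite ?enorm_ge0 // sqr_enorm_col_mx sqr_enorm lerDl sqr_ge0.
Qed.

Lemma enorm_le_col_mxd (x : 'cV[R]_n) (y : 'cV[R]_m) : enorm y <= enorm (col_mx x y).
Proof.
by apply: le_enorm_sq; rewrite ?enorm_ge0 // sqr_enorm_col_mx [enorm y ^+ _]sqr_enorm lerDr sqr_ge0.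
Qed.

Lemma enorm_col_mx_le (x : 'cV[R]_n) (y : 'cV[R]_m) :
  enorm (col_mx x y) <= enorm x + enorm y.
Proof.
apply: le_enorm_sq; first by rewrite addr_ge0 ?enorm_ge0.
rewrite dot_col_mx -!sqr_enorm.
by have := enorm_ge0 x; have := enorm_ge0 y; nra.
Qed.

Lemma col_mxB (x u : 'cV[R]_n) (y v : 'cV[R]_m) :
  col_mx x y - col_mx u v = col_mx (x - u) (y - v).
Proof. by rewrite opp_col_mx add_col_mx. Qed.

End Stacking.

Section MatrixBound.
Variables (R : realType) (n : nat).

Lemma dot_mulmx_tr (M : 'M[R]_n) (x y : 'cV[R]_n) : dot (M *m x) y = dot x (M^T *m y).
Proof.
rewrite /dot; under eq_bigr => i _ do rewrite mxE mulr_suml.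
rewrite exchange_big /=; apply: eq_bigr => j _.
by rewrite mxE mulr_sumr; apply: eq_bigr => i _; rewrite mxE; ring.
Qed.

Lemma mulmx_bounded (M : 'M[R]_n) :
  exists2 c, 0 <= c & forall x : 'cV[R]_n, enorm (M *m x) <= c * enorm x.
Proof.
pose a := \sum_i enorm (row i M)^T.
have a0 : 0 <= a by apply: sumr_ge0 => i _; exact: enorm_ge0.
exists (n.+1%:R * a) => [|x]; first by rewrite mulr_ge0.
rewrite -mulrA; apply: enorm_le_coord => [|i].
  by rewrite mulr_ge0 // enorm_ge0.
have -> : (M *m x) i 0 = dot (row i M)^T x.
  by rewrite mxE; apply: eq_bigr => j _; rewrite !mxE.
apply: (le_trans (norm_dot_le _ _)); rewrite ler_wpM2r ?enorm_ge0 //.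
rewrite /a (bigD1 i) //= lerDl; apply: sumr_ge0 => j _; exact: enorm_ge0.
Qed.

End MatrixBound.

Section Reals.
Variable R : realType.

Lemma le_of_le_eps (a c C : R) : (forall e, 0 < e -> e < 1 -> a <= c + C * e) -> a <= c.
Proof.
move=> h; rewrite leNgt; apply/negP => ca.
have e0 : 0 < (a - c) / (`|C| + (a - c) + 1).
  by rewrite divr_gt0 ?subr_gt0 //; have := normr_ge0 C; lra.
have e1 : (a - c) / (`|C| + (a - c) + 1) < 1.
  by rewrite ltr_pdivrMr; have := normr_ge0 C; lra.
have := h _ e0 e1; set e := _ / _ in e0 e1 *.
have eE : e * (`|C| + (a - c) + 1) = a - c.
  by rewrite /e divfK //; apply: lt0r_neq0; have := normr_ge0 C; lra.
by have := ler_norm C; nra.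
Qed.

Lemma exists_small_inv (c e : R) : 0 <= c -> 0 < e -> exists N : nat, forall k, (N <= k)%N -> c / k.+1%:R < e.
Proof.
move=> c0 e0; exists (Num.truncn (c / e)) => k Nk.
rewrite ltr_pdivrMr // mulrC -ltr_pdivrMr //.
by rewrite (lt_le_trans (truncnS_gt _)) // ler_nat ltnS.
Qed.

End Reals.

(** * Gradients of smooth convex functions *)

(** The inequalities are what convexity and the Lipschitz continuity of the
    gradient are used for; they also say that G is the gradient of psi. *)
Definition smooth_convex (R : realType) n (psi : 'cV[R]_n -> R) (G : 'cV[R]_n -> 'cV[R]_n)
    (l : R) : Prop :=
  [/\ 0 < l, forall x y, psi x + dot (G x) (y - x) <= psi y &
      forall x y, psi y <= psi x + dot (G x) (y - x) + l / 2 * enorm (y - x) ^+ 2].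

(** u is a regular subgradient at x of the scalarization <h, G>; for Lipschitz
    G this is the same as (u, - h) being a regular normal to its graph. *)
Definition regular_coderiv (R : realType) n (G : 'cV[R]_n -> 'cV[R]_n) (x h u : 'cV[R]_n) :=
  forall e, 0 < e -> exists2 d, 0 < d & forall y, enorm (y - x) < d ->
    dot u (y - x) <= dot h (G y - G x) + e * enorm (y - x).

(** The closure of the graph of the regular coderivative, i.e. the limiting
    coderivative of the continuous map G. *)
Definition limiting_coderiv (R : realType) n (G : 'cV[R]_n -> 'cV[R]_n) (x h u : 'cV[R]_n) :=
  forall e, 0 < e -> exists x' h' u', [/\ enorm (x' - x) < e, enorm (h' - h) < e,
    enorm (u' - u) < e & regular_coderiv G x' h' u'].

Section SmoothConvex.
Variables (R : realType) (n : nat) (psi : 'cV[R]_n -> R) (G : 'cV[R]_n -> 'cV[R]_n) (l : R).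
Hypothesis psiG : smooth_convex psi G l.
Implicit Types (x y z h u d : 'cV[R]_n).

Let l_gt0 : 0 < l. Proof. by case: psiG. Qed.

Lemma gradient_le x y : psi x + dot (G x) (y - x) <= psi y.
Proof. by case: psiG. Qed.

Lemma descent_le x y : psi y <= psi x + dot (G x) (y - x) + l / 2 * enorm (y - x) ^+ 2.
Proof. by case: psiG. Qed.

(** Compare both inequalities at the gradient step from y for the function
    psi - <G x, .>, which is minimal at x. *)
Lemma gradient_gap x y :
  psi x + dot (G x) (y - x) + enorm (G y - G x) ^+ 2 / (2 * l) <= psi y.
Proof.
pose z := y - l^-1 *: (G y - G x).
have := le_trans (gradient_le x z) (descent_le y z).
have -> : z - x = (y - x) - l^-1 *: (G y - G x) by rewrite /z addrAC.
have -> : z - y = - (l^-1 *: (G y - G x)) by rewrite /z addrAC subrr add0r.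
set D := G y - G x.
rewrite !sqr_enorm !(dotDr _ _ (G x)) !(dotNr, dotNl) !dotZr !dotZl.
have -> : dot D D = dot (G y) D - dot (G x) D by rewrite {1}/D !dotE.
have -> : l / 2 * - - (l^-1 * (l^-1 * (dot (G y) D - dot (G x) D))) =
          l^-1 / 2 * (dot (G y) D - dot (G x) D) by field; rewrite gt_eqF.
have -> : (dot (G y) D - dot (G x) D) / (2 * l) =
          l^-1 / 2 * (dot (G y) D - dot (G x) D) by field; rewrite gt_eqF.
lra.
Qed.

Lemma gradient_cocoercive x y : enorm (G y - G x) ^+ 2 <= l * dot (G y - G x) (y - x).
Proof.
have := gradient_gap x y; have := gradient_gap y x.
rewrite (enormBC (G x)) -(opprB y x) dotNr dotDl dotNl.
set q := enorm _ ^+ 2 => h1 h2.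
have : q / (2 * l) * 2 <= dot (G y) (y - x) - dot (G x) (y - x) by lra.
have -> : q / (2 * l) * 2 = q / l by field; rewrite gt_eqF.
by rewrite ler_pdivrMr // mulrC.
Qed.

Lemma gradient_lipschitz x y : enorm (G y - G x) <= l * enorm (y - x).
Proof.
have := gradient_cocoercive x y; have := dot_le_enorm (G y - G x) (y - x).
have := enorm_ge0 (G y - G x); have := enorm_ge0 (y - x).
set a := enorm (G y - G x); set c := enorm (y - x); set s := dot _ _ => c0 a0 sa h.
have [->|ap] := eqVneq a 0; first by rewrite mulr_ge0 // ltW.
have {}ap : 0 < a by rewrite lt_neqAle eq_sym ap.
by rewrite -(ler_pM2l ap); have := ler_wpM2l (ltW l_gt0) sa; lra.
Qed.

(** Testing the regular coderivative along 2 u / l - h is the choice that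
    turns cocoercivity of G into cocoercivity of its coderivative. *)
Lemma regular_coderiv_cocoercive x h u :
  regular_coderiv G x h u -> enorm u ^+ 2 <= l * dot u h.
Proof.
move=> xhu; pose w := (2 / l) *: u - h.
apply: (@le_of_le_eps _ _ _ (l * enorm w)) => e e0 _.
have [d d0 dP] := xhu e e0.
pose t := d / (enorm w + 1).
have w1 : 0 < enorm w + 1 by rewrite ltr_wpDl // enorm_ge0.
have t0 : 0 < t by rewrite divr_gt0.
have yx : x + t *: w - x = t *: w by rewrite addrC addKr.
have tw : enorm (x + t *: w - x) < d.
  by rewrite yx enormZ gtr0_norm // /t mulrAC ltr_pdivrMr // ltr_pM2l // ltrDl.
have := dP _ tw; have := gradient_cocoercive x (x + t *: w).
rewrite yx enormZ gtr0_norm //.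
move: (G _ - G x) => D coc; rewrite !dotZr => h1.
have huD : h = (2 / l) *: u - w by rewrite /w opprB addrC subrK.
have hD : dot h D = 2 / l * dot u D - dot w D by rewrite {1}huD dotDl dotNl dotZl.
have uw : dot u w = 2 / l * enorm u ^+ 2 - dot u h by rewrite sqr_enorm /w !dotE.
have sq : 0 <= enorm (D - t *: u) ^+ 2 by rewrite sqr_ge0.
have : enorm (D - t *: u) ^+ 2 = enorm D ^+ 2 - 2 * t * dot u D + t ^+ 2 * enorm u ^+ 2.
  by rewrite !sqr_enorm !dotE (dotC D u); ring.
move: sq coc; rewrite dotZr (dotC D w) => + + sqE; rewrite sqE => sq coc.
rewrite hD uw in h1.
have h2 : l * (t * (2 / l * enorm u ^+ 2 - dot u h)) <=
          l * (2 / l * dot u D - dot w D + e * (t * enorm w)) by rewrite ler_pM2l.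
have l1 : l * (2 / l) = 2 by rewrite mulrC divfK // gt_eqF.
have h3 : t * (2 * enorm u ^+ 2 - l * dot u h) <=
          2 * dot u D - l * dot w D + l * (e * (t * enorm w)).
  have -> : t * (2 * enorm u ^+ 2 - l * dot u h) = l * (t * (2 / l * enorm u ^+ 2 - dot u h)).
    by field; rewrite gt_eqF.
  apply: (le_trans h2); rewrite le_eqVlt; apply/orP; left; apply/eqP.
  by field; rewrite gt_eqF.
rewrite -(ler_pM2l t0) -(ler_pM2l t0); nra.
Qed.

Lemma regular_coderiv_norm x h u : regular_coderiv G x h u -> enorm u <= l * enorm h.
Proof.
move=> /regular_coderiv_cocoercive; have := dot_le_enorm u h.
have [->|u0] := eqVneq u 0; first by rewrite enorm0 mulr_ge0 ?enorm_ge0 // ltW.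
have up := enorm_gt0 u0; set s := dot _ _ => su h1.
by rewrite -(ler_pM2l up); have := ler_wpM2l (ltW l_gt0) su; lra.
Qed.

End SmoothConvex.

Section LimitingCoderivative.
Variables (R : realType) (n : nat) (psi : 'cV[R]_n -> R) (G : 'cV[R]_n -> 'cV[R]_n) (l : R).
Hypothesis psiG : smooth_convex psi G l.
Implicit Types (x y z h u d c : 'cV[R]_n).

Let l_gt0 : 0 < l. Proof. by case: psiG. Qed.

Lemma limiting_coderiv_cocoercive x h u :
  limiting_coderiv G x h u -> enorm u ^+ 2 <= l * dot u h.
Proof.
move=> xhu.
apply: (@le_of_le_eps _ _ _ (2 * enorm u + l * enorm h + l * enorm u + l)) => e e0 e1.
have [x' [h' [u' [_ he ue /(regular_coderiv_cocoercive psiG)]]]] := xhu e e0.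
have -> : u' = u + (u' - u) by rewrite addrC subrK.
have -> : h' = h + (h' - h) by rewrite addrC subrK.
move: (u' - u) (h' - h) ue he => p q pe qe.
rewrite sqr_enorm !dotE -!sqr_enorm (dotC p u).
have := norm_dot_le u p; have := norm_dot_le u q; have := norm_dot_le p h.
have := norm_dot_le p q; rewrite !ler_norml.
have := sqr_ge0 (enorm p); have := enorm_ge0 u; have := enorm_ge0 h.
have := enorm_ge0 p; have := enorm_ge0 q.
set P := enorm p in pe *; set Q := enorm q in qe *; set U := enorm u; set H := enorm h.
move=> Q0 P0 H0 U0 P2 /andP[_ pq] /andP[_ ph] /andP[_ uq] /andP[up _] h1.
have PQ : P * Q <= e by nra.
have PH : P * H <= e * H by nra.
have UQ : U * Q <= e * U by nra.
have UP : U * P <= e * U by nra.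
have := ler_wpM2l (ltW l_gt0) (le_trans pq PQ).
have := ler_wpM2l (ltW l_gt0) (le_trans ph PH).
have := ler_wpM2l (ltW l_gt0) (le_trans uq UQ).
lra.
Qed.

Lemma limiting_coderiv_norm x h u : limiting_coderiv G x h u -> enorm u <= l * enorm h.
Proof.
move=> /limiting_coderiv_cocoercive; have := dot_le_enorm u h.
have [->|u0] := eqVneq u 0; first by rewrite enorm0 mulr_ge0 ?enorm_ge0 // ltW.
have up := enorm_gt0 u0; set s := dot _ _ => su h1.
by rewrite -(ler_pM2l up); have := ler_wpM2l (ltW l_gt0) su; lra.
Qed.

Lemma limiting_coderiv_bound x (K : R) : 0 <= K ->
  (exists2 r, 0 < r & forall y, enorm (y - x) < r ->
     forall h u, regular_coderiv G y h u -> enorm h <= K * enorm u) ->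
  forall h u, limiting_coderiv G x h u -> enorm h <= K * enorm u.
Proof.
move=> K0 [r r0 rP] h u xhu.
apply: (@le_of_le_eps _ _ _ (1 + K)) => e e0 _.
have er0 : 0 < Num.min e r by rewrite lt_min e0.
have [x' [h' [u' [+ + + /rP]]]] := xhu _ er0; rewrite !lt_min.
move=> /andP[_ xr] /andP[he _] /andP[ue _] /(_ xr) h1.
have := ler_enorm_dist h h'; rewrite enormBC => h2.
have := ler_enorm_dist u' u => h3.
have : K * enorm u' <= K * (enorm u + e) by rewrite ler_wpM2l //; lra.
lra.
Qed.

(** Let F = G + mu id. At a minimizer z of - <c, z> + N |F z - F x| ^ 2 the vector
    c - mu h is in the regular coderivative of G at z, for h = 2 N (F z - F x).
    As F is strongly monotone, h stays bounded and z tends to x as N grows, so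
    the cluster points of h are solutions. *)
Lemma limiting_coderiv_exists x c (mu : R) : 0 < mu ->
  exists d, limiting_coderiv G x d (c - mu *: d).
Proof.
move=> mu0; pose F y := G y + mu *: y.
have FB y z : F y - F z = (G y - G z) + mu *: (y - z).
  by rewrite /F scalerBr opprD addrACA.
have Fmono y z : mu * enorm (y - z) <= enorm (F y - F z).
  have [->|yz] := eqVneq (y - z) 0; first by rewrite enorm0 mulr0 enorm_ge0.
  have yz0 := enorm_gt0 yz; rewrite -(ler_pM2r yz0).
  apply: le_trans (dot_le_enorm _ _); rewrite FB dotDl dotZl -sqr_enorm -mulrA -expr2 lerDr.
  by rewrite -(pmulr_rge0 _ l_gt0) (le_trans _ (gradient_cocoercive psiG _ _)) ?sqr_ge0.
have Flip y z : enorm (F y - F z) <= (l + mu) * enorm (y - z).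
  rewrite FB (le_trans (ler_enormD _ _)) // enormZ gtr0_norm // mulrDl lerD2r.
  exact: (gradient_lipschitz psiG).
have c0 := enorm_ge0 c.
have key (N : nat) : exists z, [/\ enorm (z - x) <= enorm c / mu ^+ 2 / N.+1%:R,
    enorm ((2 * N.+1%:R) *: (F z - F x)) <= 2 * enorm c / mu &
    regular_coderiv G z ((2 * N.+1%:R) *: (F z - F x))
      (c - mu *: ((2 * N.+1%:R) *: (F z - F x)))].
  have [M MN] : exists M : R, M = N.+1%:R by eexists.
  have M0 : 0 < M by rewrite MN ltr0n.
  have M1 : 1 <= M by rewrite MN ler1n.
  rewrite -MN.
  pose J z := - dot c (z - x) + M * enorm (F z - F x) ^+ 2.
  (* J <= 0 = J x confines the minimizer to radius |c| / mu ^ 2, so the ball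
     constraint is inactive *)
  pose r := enorm c / mu ^+ 2 + 1.
  have r0 : 0 < r by rewrite ltr_wpDl // divr_ge0 // sqr_ge0.
  have JE z y : J y = J z - dot c (y - z) + M * (2 * dot (F z - F x) (F y - F z)
        + enorm (F y - F z) ^+ 2).
    rewrite /J; have -> : y - x = (y - z) + (z - x) by rewrite subrKA.
    rewrite dotDr.
    have -> : F y - F x = (F z - F x) + (F y - F z) by rewrite [RHS]addrC subrKA.
    by rewrite !sqr_enorm !(dotDl (F z - F x)) !(dotDr (F z - F x)) (dotC (F y - F z) (F z - F x)); ring.
  have [z zr zmin] : exists2 z, enorm (z - x) <= r & forall y, enorm (y - x) <= r -> J z <= J y.
    apply: (@calm_attains_min _ _ [set z | enorm (z - x) <= r] J (enorm x + r) x) => /=.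
    - by rewrite subrr enorm0 ltW.
    - by move=> z zr; have := ler_enorm_dist z x; lra.
    - move=> z zP; apply: (@le_of_le_eps _ _ _ 1) => e e0 _.
      by have [y /= yr yz] := zP e e0; have := ler_enorm_tri z y x; rewrite (enormBC z y); lra.
    - move=> z zr; exists (enorm c + M * (2 * enorm (F z - F x) * (l + mu))).
        by rewrite addr_ge0 // !mulr_ge0 ?enorm_ge0 // ltW // addr_gt0.
      move=> y _; rewrite (JE z y).
      have := dot_le_enorm c (y - z).
      have := norm_dot_le (F z - F x) (F y - F z); rewrite ler_norml => /andP[h1 _] h2.
      have h3 : enorm (F z - F x) * enorm (F y - F z) <=
                enorm (F z - F x) * ((l + mu) * enorm (y - z)).
        by rewrite ler_wpM2l ?enorm_ge0.
      have h4 : M * (- (2 * (enorm (F z - F x) * ((l + mu) * enorm (y - z))))) <=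
           M * (2 * dot (F z - F x) (F y - F z) + enorm (F y - F z) ^+ 2).
        by rewrite ler_pM2l //; have := sqr_ge0 (enorm (F y - F z)); lra.
      lra.
  exists z.
  have Jx : J x = 0 by rewrite /J !subrr dot0r enorm0 expr0n /= mulr0 oppr0 addr0.
  have := zmin x; rewrite subrr enorm0 Jx => /(_ (ltW r0)); rewrite /J => Jz.
  have cz : M * enorm (F z - F x) ^+ 2 <= enorm c * enorm (z - x).
    by have := dot_le_enorm c (z - x); lra.
  have Fz : M * enorm (F z - F x) <= enorm c / mu.
    have [->|Fz0] := eqVneq (F z - F x) 0; first by rewrite enorm0 mulr0 divr_ge0 // ltW.
    have Fp := enorm_gt0 Fz0; rewrite ler_pdivlMr // -(ler_pM2r Fp).
    have := ler_wpM2l c0 (Fmono z x).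
    have := ler_wpM2l (ltW mu0) cz; lra.
  have zx : enorm (z - x) <= enorm c / mu ^+ 2 / M.
    rewrite ler_pdivlMr // expr2 invfM mulrA ler_pdivlMr //.
    by apply: le_trans Fz; have := ler_wpM2l (ltW M0) (Fmono z x); lra.
  split=> //.
    by rewrite enormZ gtr0_norm ?mulr_gt0 //; lra.
  move=> e e0; set d := ((2 * M) *: _).
  have q0 : 0 < M * (l + mu) ^+ 2 by rewrite mulr_gt0 // exprn_gt0 // addr_gt0.
  exists (Num.min 1 (e / (M * (l + mu) ^+ 2))) => [|y].
    by rewrite lt_min ltr01 divr_gt0.
  rewrite lt_min ltr_pdivlMr // => /andP[y1 ye].
  have yr : enorm (y - x) <= r.
    have cM : enorm c / mu ^+ 2 / M <= enorm c / mu ^+ 2.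
      by rewrite ler_pdivrMr // ler_peMr // divr_ge0 // sqr_ge0.
    rewrite (le_trans (ler_enorm_tri y z x)) // addrC lerD // ?(ltW y1) //.
    exact: le_trans zx cM.
  have := zmin y yr; rewrite (JE z y) => h1.
  have dE : dot d (F y - F z) = M * (2 * dot (F z - F x) (F y - F z)).
    by rewrite /d dotZl; ring.
  have : dot c (y - z) <= dot d (F y - F z) + M * enorm (F y - F z) ^+ 2 by lra.
  rewrite FB dotDr dotZr -FB dotDl dotNl dotZl => h2.
  have : M * enorm (F y - F z) ^+ 2 <= e * enorm (y - z).
    have : enorm (F y - F z) ^+ 2 <= ((l + mu) * enorm (y - z)) ^+ 2.
      by rewrite ler_sqr ?nnegrE ?enorm_ge0 // mulr_ge0 ?enorm_ge0 // ltW // addr_gt0.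
    move=> /(ler_wpM2l (ltW M0)) /le_trans; apply.
    by have := ler_wpM2r (enorm_ge0 (y - z)) (ltW ye); lra.
  lra.
have [z zP] := choice key.
have [d dP] := @bounded_seq_cluster _ _
  (fun N => (2 * N.+1%:R) *: (F (z N) - F x)) _ (fun N => let: And3 _ h _ := zP N in h).
exists d => e e0.
have q0 : 0 <= enorm c / mu ^+ 2 by rewrite divr_ge0 // sqr_ge0.
have [N NP] := exists_small_inv q0 e0.
have e'0 : 0 < Num.min e (e / mu) by rewrite lt_min e0 divr_gt0.
have [k Nk] := dP _ N e'0; rewrite lt_min ltr_pdivlMr // => /andP[de dmu].
have [zx _ zr] := zP k.
exists (z k); eexists; eexists; split; last exact: zr.
- exact: le_lt_trans zx (NP _ Nk).
- exact: de.
- rewrite opprB addrC subrKA -scalerBr enormZ gtr0_norm //.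
  by rewrite enormBC mulrC.
Qed.

End LimitingCoderivative.

(** * The regularized Newton method for smooth convex functions *)

Definition sufficient_decrease (R : realType) n (psi : 'cV[R]_n -> R) (G : 'cV[R]_n -> 'cV[R]_n)
    (sigma : R) (x d : 'cV[R]_n) (tau : R) :=
  psi (x + tau *: d) <= psi x + sigma * tau * dot (G x) d.

Definition backtracking (R : realType) n (psi : 'cV[R]_n -> R) (G : 'cV[R]_n -> 'cV[R]_n)
    (sigma beta : R) (x d : 'cV[R]_n) (tau : R) :=
  exists m : nat, [/\ tau = beta ^+ m, sufficient_decrease psi G sigma x d (beta ^+ m) &
    forall j, (j < m)%N -> ~ sufficient_decrease psi G sigma x d (beta ^+ j)].

(** The regularized Newton equation - G x = H d + mu d, with the generalized
    Hessian of psi at x in the role of H. *)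
Definition newton_direction (R : realType) n (G : 'cV[R]_n -> 'cV[R]_n)
    (mu : R) (x d : 'cV[R]_n) :=
  limiting_coderiv G x d (- G x - mu *: d).

Definition newton_iteration (R : realType) n (psi : 'cV[R]_n -> R) (G : 'cV[R]_n -> 'cV[R]_n)
    (lambda sigma beta : R) (x x' : 'cV[R]_n) :=
  exists d tau, [/\ newton_direction G (lambda * enorm (G x)) x d,
    backtracking psi G sigma beta x d tau & x' = x + tau *: d].

Section NewtonStep.
Variables (R : realType) (n : nat) (psi : 'cV[R]_n -> R) (G : 'cV[R]_n -> 'cV[R]_n) (l : R).
Hypothesis psiG : smooth_convex psi G l.
Variables (sigma beta : R).
Hypotheses (sigmaP : 0 < sigma < 2^-1) (betaP : 0 < beta < 1).
Implicit Types (x y d : 'cV[R]_n) (mu c tau : R).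

Let l_gt0 : 0 < l. Proof. by case: psiG. Qed.

Lemma newton_direction_descent mu x d : newton_direction G mu x d ->
  mu * enorm d ^+ 2 + enorm (- G x - mu *: d) ^+ 2 / l <= - dot (G x) d.
Proof.
move=> /(limiting_coderiv_cocoercive psiG).
rewrite dotDl !dotNl dotZl -sqr_enorm.
set q := enorm _ ^+ 2; rewrite mulrC -ler_pdivrMr //; lra.
Qed.

Lemma newton_direction_descent_mu mu x d : newton_direction G mu x d ->
  mu * enorm d ^+ 2 <= - dot (G x) d.
Proof.
move=> /newton_direction_descent; apply: le_trans.
by rewrite lerDl divr_ge0 ?sqr_ge0 // ltW.
Qed.

Lemma gradient_le_newton_direction mu x d : 0 <= mu -> newton_direction G mu x d ->
  enorm (G x) <= (l + mu) * enorm d.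
Proof.
move=> mu0 /(limiting_coderiv_norm psiG) h.
have -> : G x = - ((- G x - mu *: d) + mu *: d) by rewrite subrK opprK.
rewrite enormN (le_trans (ler_enormD _ _)) // enormZ ger0_norm // mulrDl lerD2r //.
Qed.

Lemma le_gradient_of_descent c x d : c * enorm d ^+ 2 <= - dot (G x) d ->
  c * enorm d <= enorm (G x).
Proof.
move=> h; have [->|d0] := eqVneq d 0; first by rewrite enorm0 mulr0 enorm_ge0.
have dp := enorm_gt0 d0; rewrite -(ler_pM2r dp) -mulrA -expr2 (le_trans h) //.
by rewrite -dotNl -(enormN (G x)) dot_le_enorm.
Qed.

Lemma sufficient_decrease_small c x d tau : c * enorm d ^+ 2 <= - dot (G x) d ->
  0 <= tau -> l * tau <= 2 * (1 - sigma) * c -> sufficient_decrease psi G sigma x d tau.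
Proof.
move=> hc tau0 htau; rewrite /sufficient_decrease.
have := descent_le psiG x (x + tau *: d).
have -> : x + tau *: d - x = tau *: d by rewrite addrC addKr.
rewrite dotZr enormZ ger0_norm // exprMn => /le_trans; apply.
have /andP[s0 s1] := sigmaP.
have h1 : l * tau * enorm d ^+ 2 <= 2 * (1 - sigma) * c * enorm d ^+ 2.
  by rewrite ler_wpM2r ?sqr_ge0.
have h2 : 2 * (1 - sigma) * (c * enorm d ^+ 2) <= 2 * (1 - sigma) * - dot (G x) d.
  by rewrite ler_wpM2l //; lra.
have h3 : tau * (l * tau * enorm d ^+ 2) <= tau * (2 * (1 - sigma) * - dot (G x) d).
  by rewrite ler_wpM2l //; lra.
lra.
Qed.

Lemma backtracking_exists mu x d : 0 < mu -> newton_direction G mu x d ->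
  exists tau, backtracking psi G sigma beta x d tau.
Proof.
move=> mu0 xd; have /andP[s0 s1] := sigmaP; have /andP[b0 b1] := betaP.
have e0 : 0 < 2 * (1 - sigma) * mu / l.
  by rewrite divr_gt0 // !mulr_gt0 //; lra.
have ex : exists m, `[< sufficient_decrease psi G sigma x d (beta ^+ m) >].
  have : (fun m => beta ^+ m) @ \oo --> (0 : R).
    by apply: cvg_expr; rewrite gtr0_norm.
  move=> /cvgrPdist_lt/(_ _ e0)[m _ /(_ m (leqnn m))] /=.
  rewrite sub0r normrN ger0_norm; last by rewrite exprn_ge0 // ltW.
  rewrite ltr_pdivlMr // mulrC => h; exists m; apply/asboolP.
  apply: sufficient_decrease_small (newton_direction_descent_mu xd) _ (ltW h).
  by rewrite exprn_ge0 // ltW.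
case: (ex_minnP ex) => m /asboolP mP mmin; exists (beta ^+ m), m; split=> // j jm /asboolP.
by move=> /mmin; rewrite leqNgt jm.
Qed.

Lemma backtracking_le1 x d tau : backtracking psi G sigma beta x d tau -> 0 < tau <= 1.
Proof.
have /andP[b0 b1] := betaP.
by move=> [m [-> _ _]]; rewrite exprn_gt0 //= exprn_ile1 // ltW.
Qed.

(** The trial step before the accepted one failed the test, which every step
    below 2 (1 - sigma) c / l passes. *)
Lemma backtracking_ge c x d tau : c * enorm d ^+ 2 <= - dot (G x) d ->
  backtracking psi G sigma beta x d tau ->
  Num.min 1 (beta * (2 * (1 - sigma) * c / l)) <= tau.
Proof.
have /andP[b0 b1] := betaP; move=> hc [[|m] [-> _ mP]].
  by rewrite expr0 ge_min lexx.
rewrite ge_min exprS ler_pM2l //; apply/orP; right.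
rewrite leNgt; apply/negP => /ltW h; apply: (mP m (ltnSn m)).
apply: sufficient_decrease_small hc _ _; first by rewrite exprn_ge0 // ltW.
by rewrite mulrC -ler_pdivlMr.
Qed.

(** The curvature constant c is mu for global convergence, and independent of
    the iterate for the local rates. *)
Lemma backtracking_decrease c x d tau : 0 <= c ->
  c * enorm d ^+ 2 <= - dot (G x) d -> backtracking psi G sigma beta x d tau ->
  psi (x + tau *: d) <=
    psi x - sigma * Num.min 1 (beta * (2 * (1 - sigma) * c / l)) * (c * enorm d ^+ 2).
Proof.
move=> c0 hc tauP; have /andP[s0 s1] := sigmaP.
have htau := backtracking_ge hc tauP; have [m [tE dec _]] := tauP.
move: dec; rewrite -tE => /le_trans; apply.
set t := Num.min _ _ in htau *.
have /andP[tau0 _] := backtracking_le1 tauP.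
have cd0 : 0 <= c * enorm d ^+ 2 by rewrite mulr_ge0 ?sqr_ge0.
have h1 : t * (c * enorm d ^+ 2) <= tau * - dot (G x) d.
  by apply: le_trans (_ : tau * (c * enorm d ^+ 2) <= _);
    [rewrite ler_wpM2r | rewrite ler_wpM2l // ltW].
by have := ler_wpM2l (ltW s0) h1; lra.
Qed.

End NewtonStep.

Section NewtonSequence.
Variables (R : realType) (n : nat) (psi : 'cV[R]_n -> R) (G : 'cV[R]_n -> 'cV[R]_n) (l : R).
Hypothesis psiG : smooth_convex psi G l.
Variables (lambda sigma beta : R).
Hypotheses (lambda_gt0 : 0 < lambda) (sigmaP : 0 < sigma < 2^-1) (betaP : 0 < beta < 1).
Variable x : nat -> 'cV[R]_n.
Hypothesis x_step : forall k, newton_iteration psi G lambda sigma beta (x k) (x k.+1).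
Variable xb : 'cV[R]_n.
Hypothesis xb_cluster :
  forall e N, 0 < e -> exists2 k, (N <= k)%N & enorm (x k - xb) < e.

Let l_gt0 : 0 < l. Proof. by case: psiG. Qed.
Let mu0 k : 0 <= lambda * enorm (G (x k)).
Proof. by rewrite mulr_ge0 ?enorm_ge0 // ltW. Qed.

Lemma newton_nonincreasing k m : (k <= m)%N -> psi (x m) <= psi (x k).
Proof.
move=> /subnK <-; elim: (m - k)%N => // j ih; rewrite addSn; apply: le_trans ih.
have [d [tau [dP tauP ->]]] := x_step (j + k).
have := backtracking_decrease psiG sigmaP betaP (mu0 _) (newton_direction_descent_mu psiG dP) tauP.
move=> /le_trans; apply; rewrite gerBl !mulr_ge0 ?sqr_ge0 ?enorm_ge0 //; first by case/andP: sigmaP => /ltW.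
- rewrite le_min ler01 /= !mulr_ge0 ?invr_ge0 ?enorm_ge0 ?(ltW l_gt0) ?(ltW lambda_gt0) //;
  case/andP: betaP; case/andP: sigmaP; lra.
- exact: ltW.
Qed.

Lemma newton_ge_cluster k : psi xb <= psi (x k).
Proof.
apply: (@le_of_le_eps _ _ _ (enorm (G xb))) => e e0 _.
have [j kj je] := xb_cluster k e0.
have := gradient_le psiG xb (x j); have := newton_nonincreasing kj.
have := norm_dot_le (G xb) (x j - xb); rewrite ler_norml => /andP[h _].
have : enorm (G xb) * enorm (x j - xb) <= enorm (G xb) * e by rewrite ler_wpM2l ?enorm_ge0 // ltW.
lra.
Qed.

(** Near a nonstationary point every iteration would decrease psi by a fixed
    amount, whereas psi stays above its value at the cluster point. *)
Lemma newton_cluster_stationary : G xb = 0.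
Proof.
apply/eqP; apply/negPn/negP => /enorm_gt0; set g := enorm (G xb) => g0.
have /andP[s0 s1] := sigmaP; have /andP[b0 b1] := betaP.
pose m0 := lambda * (g / 2); pose m1 := lambda * (2 * g).
have m00 : 0 < m0 by rewrite !mulr_gt0 // invr_gt0.
have m10 : 0 < m1 by rewrite !mulr_gt0.
pose t := Num.min 1 (beta * (2 * (1 - sigma) * m0 / l)).
have t0 : 0 < t by rewrite lt_min ltr01 !mulr_gt0 ?invr_gt0 //; lra.
(* m0 and m1 bound mu from below and above near xb, d0 bounds |d| from below; D
   is the guaranteed decrease, and r ensures psi (x k) < psi xb + D *)
pose d0 := g / 2 / (l + m1).
have d00 : 0 < d0 by rewrite !divr_gt0 // addr_gt0.
pose D := sigma * t * (m0 * d0 ^+ 2).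
have D0 : 0 < D by rewrite /D mulr_gt0 ?(mulr_gt0 s0 t0) // (mulr_gt0 m00) // exprn_gt0.
pose r := Num.min (g / (2 * l)) (Num.min 1 (D / (g + l))).
have gl : 0 < g + l by rewrite addr_gt0.
have r0 : 0 < r by rewrite !lt_min ltr01 !divr_gt0 // mulr_gt0.
have [k _] := xb_cluster 0%N r0; rewrite !lt_min => /and3P[].
rewrite ltr_pdivlMr ?mulr_gt0 // ltr_pdivlMr // => kg k1 kD.
have Glip := gradient_lipschitz psiG xb (x k).
have G1 : g <= 2 * enorm (G (x k)).
  by have := ler_enorm_dist (G xb) (G (x k)); rewrite enormBC -/g; lra.
have G2 : enorm (G (x k)) <= 2 * g.
  by have := ler_enorm_dist (G (x k)) (G xb); rewrite -/g; lra.
have [d [tau [dP tauP xE]]] := x_step k.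
have hm0 : m0 <= lambda * enorm (G (x k)) by rewrite ler_pM2l //; lra.
have hm1 : lambda * enorm (G (x k)) <= m1 by rewrite ler_pM2l.
have hc : m0 * enorm d ^+ 2 <= - dot (G (x k)) d.
  apply: le_trans (newton_direction_descent_mu psiG dP).
  by rewrite ler_wpM2r ?sqr_ge0.
have hd : d0 <= enorm d.
  have := gradient_le_newton_direction psiG (mu0 k) dP.
  have : (l + lambda * enorm (G (x k))) * enorm d <= (l + m1) * enorm d.
    by rewrite ler_wpM2r ?enorm_ge0 // lerD2l.
  rewrite ler_pdivrMr ?addr_gt0 //; lra.
have := backtracking_decrease psiG sigmaP betaP (ltW m00) hc tauP.
rewrite -xE -/t => h1.
have h2 : D <= sigma * t * (m0 * enorm d ^+ 2).
  by rewrite ler_pM2l ?mulr_gt0 // ler_pM2l // ler_sqr ?nnegrE ?enorm_ge0 // ltW.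
have := newton_ge_cluster k.+1.
have := descent_le psiG xb (x k).
have := dot_le_enorm (G xb) (x k - xb); rewrite -/g.
have := enorm_ge0 (x k - xb); set q := enorm (x k - xb) in kg k1 kD *.
move=> q0; have : l * (q * q) <= l * (1 * q) by rewrite ler_pM2l // ler_wpM2r // ltW.
have := mulr_ge0 (ltW l_gt0) q0; rewrite expr2; lra.
Qed.

End NewtonSequence.

(** * Linear convergence under regularity of the gradient *)

(** Metric regularity of the subdifferential of phi is used for G in this form. *)
Definition lipschitz_inverse (R : realType) n (G : 'cV[R]_n -> 'cV[R]_n) (K r : R) : Prop :=
  [/\ 0 < K, 0 < r,
      forall x y, enorm (G x) < r -> enorm (G y) < r -> enorm (x - y) <= K * enorm (G x - G y) &
      forall y, enorm y < r -> exists x, G x = y].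

Section RegularGradient.
Variables (R : realType) (n : nat) (psi : 'cV[R]_n -> R) (G : 'cV[R]_n -> 'cV[R]_n) (l : R).
Hypothesis psiG : smooth_convex psi G l.
Variables (K r : R).
Hypothesis Ginv : lipschitz_inverse G K r.
Implicit Types (x y h u d : 'cV[R]_n).

Let l_gt0 : 0 < l. Proof. by case: psiG. Qed.

(** A preimage of G x - t h is a test point at distance at most K t |h|. *)
Lemma regular_coderiv_lower x h u : enorm (G x) < r -> regular_coderiv G x h u ->
  enorm h <= K * enorm u.
Proof.
case: Ginv => K0 r0 Glip Gsurj Gxr xhu.
have [->|hn0] := eqVneq h 0; first by rewrite enorm0 mulr_ge0 ?enorm_ge0 // ltW.
have h0 := enorm_gt0 hn0.
apply: (@le_of_le_eps _ _ _ K) => e e0 _.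
have [d d0 dP] := xhu e e0.
pose t := Num.min ((r - enorm (G x)) / (2 * enorm h)) (d / (2 * K * enorm h)).
have t0 : 0 < t by rewrite lt_min !divr_gt0 ?subr_gt0 // !mulr_gt0.
have t1 : t * (2 * enorm h) <= r - enorm (G x).
  by rewrite -ler_pdivlMr ?mulr_gt0 // ge_min lexx.
have t2 : t * (2 * K * enorm h) <= d.
  by rewrite -ler_pdivlMr ?mulr_gt0 // ge_min lexx orbT.
have th0 := mulr_gt0 t0 h0.
have yr : enorm (G x - t *: h) < r.
  by rewrite (le_lt_trans (ler_enormB _ _)) // enormZ gtr0_norm //; lra.
have [y yE] := Gsurj _ yr.
have Gyx : G y - G x = - (t *: h) by rewrite yE addrAC subrr add0r.
have yx : enorm (y - x) <= K * (t * enorm h).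
  by rewrite (le_trans (Glip _ _ _ _)) ?yE // addrAC subrr add0r enormN enormZ gtr0_norm.
have yd : enorm (y - x) < d.
  rewrite (le_lt_trans yx) //; have := mulr_gt0 K0 th0; lra.
have := dP y yd; rewrite Gyx dotNr dotZr -sqr_enorm => h1.
have := norm_dot_le u (y - x); rewrite ler_norml => /andP[h2 _].
have h3 : (enorm u + e) * enorm (y - x) <= (enorm u + e) * (K * (t * enorm h)).
  by rewrite ler_wpM2l // addr_ge0 ?enorm_ge0 // ltW.
by rewrite -(ler_pM2l th0); lra.
Qed.

Lemma limiting_coderiv_lower x h u : enorm (G x) < r -> limiting_coderiv G x h u ->
  enorm h <= K * enorm u.
Proof.
case: (Ginv) => K0 r0 _ _ Gxr; apply: limiting_coderiv_bound; first exact: ltW.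
exists ((r - enorm (G x)) / l) => [|y]; first by rewrite divr_gt0 // subr_gt0.
rewrite ltr_pdivlMr // => yx h' u'; apply: regular_coderiv_lower.
have := ler_enorm_dist (G y) (G x); have := gradient_lipschitz psiG x y; lra.
Qed.

(** Cocoercivity of the coderivative upgrades the lower bound to curvature. *)
Lemma newton_direction_curvature (mu : R) x d : 0 <= mu -> enorm (G x) < r ->
  newton_direction G mu x d -> (l * K ^+ 2)^-1 * enorm d ^+ 2 <= - dot (G x) d.
Proof.
case: (Ginv) => K0 _ _ _ mu_ge0 Gxr xd.
have := newton_direction_descent psiG xd.
apply: le_trans; rewrite ler_wpDl ?(mulr_ge0 mu_ge0 (sqr_ge0 _)) //.
rewrite invfM mulrC mulrCA mulrC ler_pM2r ?invr_gt0 // ler_pdivrMr ?exprn_gt0 //.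
rewrite -exprMn ler_sqr ?nnegrE ?mulr_ge0 ?enorm_ge0 ?(ltW K0) // mulrC.
exact: limiting_coderiv_lower xd.
Qed.

Variable xb : 'cV[R]_n.
Hypothesis Gxb : G xb = 0.

Lemma psi_gap_ge x : enorm (G x) ^+ 2 / (2 * l) <= psi x - psi xb.
Proof. by have := gradient_gap psiG xb x; rewrite Gxb dot0l subr0; lra. Qed.

Lemma dist_le_gradient x : enorm (G x) < r -> enorm (x - xb) <= K * enorm (G x).
Proof.
case: Ginv => K0 r0 Glip _ Gxr; rewrite (le_trans (Glip _ _ Gxr _)) ?Gxb ?subr0 //.
by rewrite enorm0.
Qed.

Lemma psi_gap_le x : enorm (G x) < r -> psi x - psi xb <= K * enorm (G x) ^+ 2.
Proof.
move=> Gxr; have := gradient_le psiG x xb; rewrite -(opprB x) dotNr.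
have := dot_le_enorm (G x) (x - xb).
have := ler_wpM2l (enorm_ge0 (G x)) (dist_le_gradient Gxr); rewrite expr2; lra.
Qed.

Lemma gradient_le_dist x : enorm (G x) <= l * enorm (x - xb).
Proof. by have := gradient_lipschitz psiG xb x; rewrite Gxb subr0. Qed.

Variables (lambda sigma beta : R).
Hypotheses (lambda_gt0 : 0 < lambda) (sigmaP : 0 < sigma < 2^-1) (betaP : 0 < beta < 1).

(** The decrease is at least a multiple of |d| ^ 2, hence of |G x| ^ 2, and
    psi - psi xb is at most K |G x| ^ 2. *)
Lemma newton_iteration_linear : exists rho c : R, [/\ 0 < rho < 1, 0 <= c &
  forall x x', enorm (G x) < r -> newton_iteration psi G lambda sigma beta x x' ->
    psi x' - psi xb <= rho * (psi x - psi xb) /\ enorm (x' - xb) <= c * enorm (G x)].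
Proof.
case: (Ginv) => K0 r0 _ _.
have /andP[s0 s1] := sigmaP; have /andP[b0 b1] := betaP.
pose c := (l * K ^+ 2)^-1.
have c0 : 0 < c by rewrite invr_gt0 mulr_gt0 // exprn_gt0.
pose t := Num.min 1 (beta * (2 * (1 - sigma) * c / l)).
have t0 : 0 < t.
  by rewrite lt_min ltr01 /=; apply/mulr_gt0/divr_gt0/l_gt0/mulr_gt0/c0 => //; lra.
pose L := l + lambda * r.
have L0 : 0 < L by rewrite addr_gt0 // mulr_gt0.
have st0 := mulr_gt0 s0 t0.
pose theta := sigma * t * (c / L ^+ 2) / K.
have th0 : 0 < theta.
  by rewrite /theta divr_gt0 // mulr_gt0 // divr_gt0 // exprn_gt0.
have ci0 : 0 < c^-1 by rewrite invr_gt0.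
exists (Num.max 2^-1 (1 - theta)), (K + c^-1); split.
- by rewrite lt_max gt_max invr_gt0 ltr0n ltrBlDr ltrDl th0 andbT invf_lt1 ?ltr1n.
- exact: addr_ge0 (ltW K0) (ltW ci0).
move=> x x' Gxr [d [tau [dP tauP ->]]].
have mu0 : 0 <= lambda * enorm (G x) by rewrite mulr_ge0 ?enorm_ge0 // ltW.
have hc := newton_direction_curvature mu0 Gxr dP; rewrite -/c in hc.
split.
  have := backtracking_decrease psiG sigmaP betaP (ltW c0) hc tauP; rewrite -/t => h1.
  have Gd : enorm (G x) <= L * enorm d.
    apply: le_trans (gradient_le_newton_direction psiG mu0 dP) _.
    by rewrite ler_wpM2r ?enorm_ge0 // lerD2l ler_pM2l // ltW.
  have h2 : enorm (G x) ^+ 2 / L ^+ 2 <= enorm d ^+ 2.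
    rewrite ler_pdivrMr ?exprn_gt0 // -exprMn ler_sqr ?nnegrE ?mulr_ge0 ?enorm_ge0 ?(ltW L0) //.
    by rewrite mulrC.
  have h3 : (psi x - psi xb) / K <= enorm (G x) ^+ 2.
    by rewrite ler_pdivrMr // mulrC psi_gap_le.
  have h4 : theta * (psi x - psi xb) <= sigma * t * (c * enorm d ^+ 2).
    have -> : theta * (psi x - psi xb) = sigma * t * (c * ((psi x - psi xb) / K / L ^+ 2)).
      by rewrite /theta; ring.
    rewrite ler_pM2l // ler_pM2l // (le_trans _ h2) // ler_pM2r //.
    by rewrite invr_gt0 exprn_gt0.
  have h5 : (1 - theta) * (psi x - psi xb) <= Num.max 2^-1 (1 - theta) * (psi x - psi xb).
    rewrite ler_wpM2r ?le_max ?lexx ?orbT // (le_trans _ (psi_gap_ge x)) //.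
    by rewrite divr_ge0 ?sqr_ge0 // mulr_ge0 // ltW.
  lra.
have /andP[tau0 tau1] := backtracking_le1 betaP tauP.
rewrite addrAC (le_trans (ler_enormD _ _)) // mulrDl lerD ?dist_le_gradient //.
rewrite enormZ gtr0_norm // [leRHS]mulrC ler_pdivlMr // mulrC.
apply: le_trans (le_gradient_of_descent hc); rewrite ler_pM2l //.
by rewrite ler_piMl // enorm_ge0.
Qed.

Variable x : nat -> 'cV[R]_n.
Hypothesis x_step : forall k, newton_iteration psi G lambda sigma beta (x k) (x k.+1).
Hypothesis xb_cluster :
  forall e N, 0 < e -> exists2 k, (N <= k)%N & enorm (x k - xb) < e.

(** Once an iterate is close enough to xb, the function values bound the next
    step so tightly that the sequence can no longer leave the neighborhood. *)
Lemma newton_gap_linear : exists (rho : R) (k0 : nat), 0 < rho < 1 /\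
  forall k, (k0 <= k)%N -> enorm (G (x k)) < r /\
    psi (x k) - psi xb <= rho ^+ (k - k0) * (psi (x k0) - psi xb).
Proof.
case: (Ginv) => K0 r0 _ _.
have [rho [c [rhoP c0 stepP]]] := newton_iteration_linear; have /andP[rho0 rho1] := rhoP.
(* below the gap D the next iterate stays within r / l of xb, where |G| < r *)
pose D := (r / l) ^+ 2 / (c ^+ 2 + 1) / (2 * l).
have cp : 0 < c ^+ 2 + 1 by rewrite ltr_wpDl // sqr_ge0.
have D0 : 0 < D.
  by apply: divr_gt0; [apply: divr_gt0 => //; apply/exprn_gt0/divr_gt0 | exact: mulr_gt0].
pose s := Num.min (r / l) (Num.min 1 (D / (K * l ^+ 2))).
have Kl : 0 < K * l ^+ 2 by rewrite mulr_gt0 // exprn_gt0.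
have s0 : 0 < s by rewrite !lt_min ltr01 (divr_gt0 r0 l_gt0) (divr_gt0 D0 Kl).
have Gr y : enorm (y - xb) < r / l -> enorm (G y) < r.
  by rewrite ltr_pdivlMr // mulrC; apply: le_lt_trans (gradient_le_dist y).
have gap0 y : 0 <= psi y - psi xb.
  by rewrite (le_trans _ (psi_gap_ge y)) // divr_ge0 ?sqr_ge0 // mulr_ge0 // ltW.
have [k0 _] := xb_cluster 0%N s0; rewrite !lt_min => /and3P[k0r k01 k0D].
have gapD : psi (x k0) - psi xb < D.
  apply: le_lt_trans (psi_gap_le (Gr _ k0r)) _.
  have h : enorm (G (x k0)) ^+ 2 <= (l * enorm (x k0 - xb)) ^+ 2.
    by rewrite ler_sqr ?nnegrE ?mulr_ge0 ?enorm_ge0 ?(ltW l_gt0) // gradient_le_dist.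
  apply: le_lt_trans (_ : K * (l * enorm (x k0 - xb)) ^+ 2 < _).
    by rewrite ler_pM2l.
  move: k0D; rewrite ltr_pdivlMr //; apply: le_lt_trans.
  rewrite exprMn mulrA mulrC ler_pM2r // expr2 ler_piMl ?enorm_ge0 // ltW //.
exists rho, k0; split=> // k /subnK <-; rewrite addnK.
elim: (k - k0)%N => [|j [Gj ih]].
  by rewrite add0n expr0 mul1r; split=> //; exact: Gr.
have [gj xj] := stepP _ _ Gj (x_step (j + k0)); split; last first.
  by rewrite addSn exprS -mulrA (le_trans gj) // ler_pM2l.
apply: Gr; rewrite addSn.
have gjD : psi (x (j + k0)%N) - psi xb < D.
  apply: le_lt_trans gapD; apply: le_trans ih _.
  by rewrite ler_piMl ?gap0 // exprn_ile1 // ltW.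
have h := psi_gap_ge (x (j + k0)%N).
have {}h : enorm (G (x (j + k0)%N)) ^+ 2 < (r / l) ^+ 2 / (c ^+ 2 + 1).
  by rewrite -(ltr_pM2r (_ : 0 < (2 * l)^-1)) ?invr_gt0 ?mulr_gt0 // (le_lt_trans h).
rewrite -ltr_sqr ?nnegrE ?enorm_ge0 ?(ltW (divr_gt0 r0 l_gt0)) //.
have h2 : enorm (x (j + k0).+1 - xb) ^+ 2 <= (c * enorm (G (x (j + k0)%N))) ^+ 2.
  by rewrite ler_sqr ?nnegrE ?mulr_ge0 ?enorm_ge0.
apply: le_lt_trans h2 _; move: h; rewrite ltr_pdivlMr // exprMn.
by have := sqr_ge0 (enorm (G (x (j + k0)%N))); lra.
Qed.

Theorem newton_linear_cvg : R_linear_cvg x xb.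
Proof.
case: (Ginv) => K0 r0 _ _.
have [rho [k0 [/andP[rho0 rho1] gapP]]] := newton_gap_linear.
pose C := 2 * l * K ^+ 2 * (psi (x k0) - psi xb) / rho ^+ k0.
exists (Num.sqrt rho), (Num.sqrt C + 1), k0; split.
- by rewrite sqrtr_gt0 rho0 -sqrtr1 ltr_sqrt.
- by rewrite ltr_wpDl // sqrtr_ge0.
move=> k k0k; have [Gk gk] := gapP k k0k.
have gap0 : 0 <= psi (x k0) - psi xb.
  apply: le_trans (psi_gap_ge _).
  exact: divr_ge0 (sqr_ge0 _) (mulr_ge0 (ler0n _ 2) (ltW l_gt0)).
have C0 : 0 <= C.
  apply: divr_ge0 (exprn_ge0 _ (ltW rho0)); apply: mulr_ge0 gap0.
  exact: mulr_ge0 (mulr_ge0 (ler0n _ 2) (ltW l_gt0)) (sqr_ge0 K).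
apply: (@le_trans _ _ (Num.sqrt C * Num.sqrt rho ^+ k)); last first.
  by rewrite ler_wpM2r ?exprn_ge0 ?sqrtr_ge0 // lerDl.
rewrite -ler_sqr ?nnegrE ?mulr_ge0 ?exprn_ge0 ?enorm_ge0 ?sqrtr_ge0 //.
have -> : (Num.sqrt C * Num.sqrt rho ^+ k) ^+ 2 = C * rho ^+ k.
  by rewrite exprMn -exprM mulnC exprM !sqr_sqrtr // ltW.
have h1 : enorm (x k - xb) ^+ 2 <= (K * enorm (G (x k))) ^+ 2.
  by rewrite ler_sqr ?nnegrE ?mulr_ge0 ?enorm_ge0 ?(ltW K0) // dist_le_gradient.
have h2 := le_trans (psi_gap_ge (x k)) gk.
rewrite ler_pdivrMr ?mulr_gt0 // in h2.
apply: (le_trans h1); rewrite exprMn.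
have h3 : K ^+ 2 * enorm (G (x k)) ^+ 2 <=
    K ^+ 2 * (rho ^+ (k - k0) * (psi (x k0) - psi xb) * (2 * l)).
  by rewrite ler_pM2l // exprn_gt0.
apply: (le_trans h3); rewrite /C -{2}(subnK k0k) exprD.
have rk : rho ^+ k0 != 0 by rewrite expf_neq0 // gt_eqF.
rewrite le_eqVlt; apply/orP; left; apply/eqP; field.
exact: rk.
Qed.

Lemma newton_cvg : x @ \oo --> xb.
Proof.
have [mu [c [k0 [/andP[mu0 mu1] c0 xP]]]] := newton_linear_cvg.
apply/ecvgP => e e0.
have : (fun m => mu ^+ m) @ \oo --> (0 : R) by apply: cvg_expr; rewrite gtr0_norm.
move=> /cvgrPdist_lt/(_ (e / c) (divr_gt0 e0 c0))[N _ NP].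
exists (maxn N k0) => k; rewrite geq_max => /andP[Nk k0k].
apply: le_lt_trans (xP k k0k) _; have := NP k Nk => /=.
by rewrite sub0r normrN ger0_norm ?exprn_ge0 ?(ltW mu0) // ltr_pdivlMr // mulrC.
Qed.

End RegularGradient.

(** * Superlinear convergence under semismoothness *)

(** The semismooth* property of G at a zero xb, as a uniform estimate on
    regular coderivatives. *)
Definition semismooth_estimate (R : realType) n (G : 'cV[R]_n -> 'cV[R]_n) (xb : 'cV[R]_n)
    (e r : R) : Prop :=
  forall x h u, enorm (x - xb) < r -> regular_coderiv G x h u ->
    `|dot u (x - xb) - dot h (G x)| <= e * enorm (x - xb) * enorm h.

Section ProductMin.
Variables (R : realType) (n : nat).

(** The pair (p, t) is stacked into a vector of dimension n + 1. *)
Lemma calm_attains_min_cylinder (f : 'cV[R]_n -> R -> R) (s : R) : 0 <= s ->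
  (forall p t, enorm p <= 1 -> 0 <= t <= s -> exists2 c, 0 <= c &
     forall p' t', enorm p' <= 1 -> 0 <= t' <= s ->
       f p t <= f p' t' + c * (enorm (p' - p) + `|t' - t|)) ->
  exists p t, [/\ enorm p <= 1, 0 <= t <= s &
    forall p' t', enorm p' <= 1 -> 0 <= t' <= s -> f p t <= f p' t'].
Proof.
move=> s0 fcalm.
pose T (z : 'cV[R]_(n + 1)) : R := dsubmx z 0 0.
pose S := [set z : 'cV[R]_(n + 1) | enorm (usubmx z) <= 1 /\ 0 <= T z <= s].
have uB (z y : 'cV[R]_(n + 1)) : enorm (usubmx y - usubmx z) <= enorm (y - z).
  rewrite -[in leRHS](vsubmxK y) -[in leRHS](vsubmxK z) col_mxB.
  exact: enorm_le_col_mxu.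
have tB (z y : 'cV[R]_(n + 1)) : `|T y - T z| <= enorm (y - z).
  rewrite -[in leRHS](vsubmxK y) -[in leRHS](vsubmxK z) col_mxB.
  apply: le_trans (enorm_le_col_mxd _ _); apply: le_trans (le_coord_enorm _ 0).
  by rewrite /T !mxE.
have [||||z [z1 z2] zmin] := @calm_attains_min _ _ S (fun z => f (usubmx z) (T z)) (1 + s) 0.
- by split; rewrite ?linear0 ?enorm0 ?ler01 // /T linear0 mxE lexx.
- move=> z [z1 /andP[z2 z3]]; rewrite -(vsubmxK z).
  apply: le_trans (enorm_col_mx_le _ _) _; apply: lerD => //.
  apply: le_enorm_sq => //; rewrite /dot big_ord1 -expr2.
  by rewrite ler_sqr ?nnegrE //; exact: z3.
- move=> z zP; split.
    apply: (@le_of_le_eps _ _ _ 1) => e e0 _; have [y [y1 _] yz] := zP e e0.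
    by have := ler_enorm_dist (usubmx z) (usubmx y); have := uB y z; rewrite (enormBC z); lra.
  apply/andP; split; apply: (@le_of_le_eps _ _ _ 1) => e e0 _;
    have [y [_ /andP[y1 y2]] yz] := zP e e0;
    by have := tB y z; rewrite ler_norml (enormBC z) => /andP[]; lra.
- move=> z [z1 z2]; have [c c0 cP] := fcalm _ _ z1 z2.
  exists (2 * c) => [|y [y1 y2]]; first by rewrite mulr_ge0.
  apply: le_trans (cP _ _ y1 y2) _; rewrite lerD2l -mulrA mulrCA ler_wpM2l //.
  by have := uB z y; have := tB z y; lra.
exists (usubmx z), (T z); split=> // p t p1 t1.
have := zmin (col_mx p (t%:M : 'cV_1)).
rewrite /S /T /= col_mxKu col_mxKd mxE eqxx mulr1n; apply; split=> //.
Qed.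

End ProductMin.

Section Semismooth.
Variables (R : realType) (n : nat) (psi : 'cV[R]_n -> R) (G : 'cV[R]_n -> 'cV[R]_n) (l : R).
Hypothesis psiG : smooth_convex psi G l.
Variable xb : 'cV[R]_n.
Hypothesis Gxb : G xb = 0.
Implicit Types (x y z h u d w p : 'cV[R]_n) (e r s : R).

Let l_gt0 : 0 < l. Proof. by case: psiG. Qed.

Let dotG_lip h x y : `|dot h (G y - G x)| <= l * enorm h * enorm (y - x).
Proof.
rewrite (le_trans (norm_dot_le _ _)) // [leRHS]mulrAC [leRHS]mulrC.
by rewrite ler_wpM2l ?enorm_ge0 // (gradient_lipschitz psiG).
Qed.

(** A mean value argument: if the scalarization <h, G> grew too little along
    the ray from xb through y, then minimizing it, with the growth compensated
    by a linear term in the ray parameter t and a penalty N |p| ^ 2 on the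
    distance p to the ray, would give a regular subgradient - 2 N p that
    violates the semismoothness estimate. *)
Lemma radial_growth e r y s h : 0 < e -> semismooth_estimate G xb e r ->
  0 < s -> s * (2 * l + e) <= e -> (1 + s) * enorm (y - xb) < r ->
  - (2 * e * s * enorm (y - xb) * enorm h) <=
    dot h (G (y + s *: (y - xb)) - (1 + s) *: G y).
Proof.
move=> e0 Gss s0 se sr; rewrite leNgt; apply/negP.
have [w wE] : exists w, w = y - xb by eexists.
rewrite -wE in sr *; set W := enorm w in sr *; set H := enorm h.
have W0 : 0 <= W := enorm_ge0 _; have H0 : 0 <= H := enorm_ge0 _.
rewrite dotDr dotNr dotZr; set F := dot h (G (y + s *: w)); set f := dot h (G y) => hF.
pose a := 2 * e * W * H.
(* a slope strictly between the claimed bound a and the violation *)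
pose c := (a + ((1 + s) * f - F) / s) / 2.
have [ac Fc] : a < c /\ c * s < (1 + s) * f - F.
  have : a < ((1 + s) * f - F) / s by rewrite ltr_pdivlMr // /a; lra.
  rewrite /c; set q := _ / s => aq; split; first by lra.
  have -> : (1 + s) * f - F = q * s by rewrite /q divfK // gt_eqF.
  by rewrite ltr_pM2r //; lra.
have lH0 : 0 <= l * H by rewrite mulr_ge0 // ltW.
have fW : f <= l * H * W.
  have := dotG_lip h xb y; rewrite Gxb subr0; have := ler_norm (dot h (G y)).
  by rewrite -/f -wE -/W -/H; lra.
(* the penalty parameter must beat every fixed error term *)
have [N [N0 N1 N2 N3 N4]] : exists N, [/\ 0 < N, 2 * (l * H) < N,
    (l * H) ^+ 2 < ((1 + s) * f - F - c * s) * N, l * H < (r - (1 + s) * W) * N &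
    (l + e) * H * (l * H) < (c - a) * N].
  pose k1 := (l * H) ^+ 2 / ((1 + s) * f - F - c * s).
  pose k2 := l * H / (r - (1 + s) * W).
  pose k3 := (l + e) * H * (l * H) / (c - a).
  have k10 : 0 <= k1 by rewrite divr_ge0 ?sqr_ge0 // subr_ge0 ltW.
  have k20 : 0 <= k2 by rewrite divr_ge0 // subr_ge0 ltW.
  have k30 : 0 <= k3.
    have le0 : 0 <= l + e by rewrite ltW // addr_gt0.
    apply: divr_ge0 (mulr_ge0 (mulr_ge0 le0 H0) lH0) _.
    by rewrite subr_ge0 ltW.
  exists (2 * (l * H) + k1 + k2 + k3 + 1); split; try lra.
  - by rewrite [ltRHS]mulrC -ltr_pdivrMr ?subr_gt0 // -/k1; lra.
  - by rewrite [ltRHS]mulrC -ltr_pdivrMr ?subr_gt0 // -/k2; lra.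
  - by rewrite [ltRHS]mulrC -ltr_pdivrMr ?subr_gt0 // -/k3; lra.
pose J p t := dot h (G (y + t *: w + p)) - (1 + t) * f + c * t + N * enorm p ^+ 2.
have [|p t p1 t1|p [t [p1 /andP[t0 ts] pmin]]] := @calm_attains_min_cylinder _ n J s.
- exact: ltW.
- exists (l * H * (1 + W) + `|f| + `|c| + 2 * N).
    by rewrite !addr_ge0 ?mulr_ge0 ?normr_ge0 ?addr_ge0 // ltW.
  move=> p' t' p'1 t'1; rewrite /J.
  have hx : y + t' *: w + p' - (y + t *: w + p) = (p' - p) + (t' - t) *: w.
    by rewrite scalerBl; apply/matrixP => i j; rewrite !mxE; ring.
  have := dotG_lip h (y + t *: w + p) (y + t' *: w + p').
  rewrite hx dotDr dotNr ler_norml => /andP[h1 _].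
  have h2 : enorm (p' - p + (t' - t) *: w) <= enorm (p' - p) + `|t' - t| * W.
    by apply: le_trans (ler_enormD _ _) _; rewrite enormZ.
  have h3 := ler_wpM2l lH0 h2.
  have h4 : - (2 * enorm (p' - p)) <= enorm p' ^+ 2 - enorm p ^+ 2.
    have -> : p' = p + (p' - p) by rewrite addrC subrK.
    rewrite addrC addKr; move: (p' - p) => q.
    rewrite !sqr_enorm !dotE (dotC q p) -[dot q q]sqr_enorm.
    have := norm_dot_le p q; rewrite ler_norml => /andP[h5 _].
    have := ler_wpM2r (enorm_ge0 q) p1; have := sqr_ge0 (enorm q); lra.
  have h5 := ler_wpM2l (ltW N0) h4.
  have h6 : (t' - t) * (f - c) <= (`|f| + `|c|) * `|t' - t|.
    rewrite (le_trans (ler_norm _)) // normrM mulrC ler_wpM2r //.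
    exact: ler_normB.
  have h7 : 0 <= l * H * `|t' - t| by rewrite mulr_ge0.
  have h8 : 0 <= l * H * W * enorm (p' - p) by exact: mulr_ge0 (mulr_ge0 lH0 W0) (enorm_ge0 _).
  have h9 : 0 <= N * `|t' - t| by rewrite mulr_ge0 // ltW.
  have h10 : 0 <= (`|f| + `|c|) * enorm (p' - p) by rewrite mulr_ge0 ?enorm_ge0 ?addr_ge0.
  rewrite -/H in h1; lra.
have [x xE] : exists x, x = y + t *: w + p by eexists.
pose u := - (2 * N) *: p; pose P := enorm p.
have P0 : 0 <= P := enorm_ge0 _.
(* comparison with the point of the ray with the same parameter *)
have NP : N * P <= l * H.
  have := pmin 0 t; rewrite enorm0 ler01 t0 ts /J enorm0 expr0n /= mulr0 !addr0 => /(_ isT isT) h1.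
  have := dotG_lip h x (y + t *: w).
  have -> : y + t *: w - x = - p by rewrite xE opprD addrA subrr add0r.
  rewrite enormN -/P -/H -xE in h1 *.
  rewrite dotDr dotNr ler_norml => /andP[_ h2].
  have [->|p0] := eqVneq P 0; first by rewrite mulr0.
  have {}p0 : 0 < P by rewrite lt_neqAle eq_sym p0.
  by rewrite -(ler_pM2r p0) -mulrA -expr2; rewrite -/P in h1; lra.
have P2 : P < 2^-1.
  by rewrite -(ltr_pM2l N0) (le_lt_trans NP) //; lra.
have rcod : regular_coderiv G x h u.
  move=> e' e'0; exists (Num.min 2^-1 (e' / N)) => [|x'].
    by rewrite lt_min divr_gt0 // invr_gt0 ltr0n.
  rewrite lt_min ltr_pdivlMr // => /andP[x'1 x'2].
  have p'1 : enorm (p + (x' - x)) <= 1.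
    by rewrite (le_trans (ler_enormD _ _)) // -/P; lra.
  have := pmin _ t p'1; rewrite t0 ts => /(_ isT); rewrite /J.
  have -> : y + t *: w + (p + (x' - x)) = x' by rewrite addrA -xE addrC subrK.
  rewrite -xE dotDr dotNr.
  have := ler_wpM2r (enorm_ge0 (x' - x)) (ltW x'2); move: (x' - x) => D h1.
  rewrite !sqr_enorm !dotDl !dotDr (dotC D p) -[dot D D]sqr_enorm -[dot p p]sqr_enorm => h2.
  rewrite /u dotZl; rewrite expr2 in h2; lra.
(* at t = 0 the value exceeds the one at the far end of the ray *)
have tgt0 : 0 < t.
  rewrite lt_neqAle eq_sym t0 andbT; apply/eqP => tE.
  have := pmin 0 s; rewrite enorm0 ler01 (ltW s0) lexx => /(_ isT isT).
  rewrite /J tE enorm0 scale0r !addr0 expr0n /= mulr0 !mulr0 !addr0 mul1r -/F -/P => h1.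
  have := dotG_lip h y (y + p); have -> : y + p - y = p by rewrite addrC addKr.
  rewrite dotDr dotNr ler_norml -/f -/P -/H => /andP[h2 _].
  have h3 : N * ((1 + s) * f - F - c * s) <= N * (l * H * P).
    by rewrite ler_pM2l //; have := mulr_ge0 (ltW N0) (sqr_ge0 P); lra.
  have := ler_wpM2l lH0 NP; rewrite expr2 in N2; lra.
(* stationarity in t with y + t w + p held fixed, where only decreasing t is
   admissible at the upper end *)
have uw : dot u w <= f - c.
  have W1 : 0 < 2 * (W + 1) by rewrite mulr_gt0 // ltr_wpDl.
  (* lowering t by at most m keeps p + v w in the unit ball *)
  pose m := Num.min t (2 * (W + 1))^-1.
  have m0 : 0 < m by rewrite lt_min tgt0 invr_gt0.
  have mt : m <= t by rewrite ge_min lexx.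
  have mW : m * W <= 2^-1.
    have : m * (2 * (W + 1)) <= 1 by rewrite -ler_pdivlMr // div1r ge_min lexx orbT.
    lra.
  apply: (@le_of_le_eps _ _ _ (N * W ^+ 2 * m)) => q q0 q1.
  pose v := q * m; have v0 : 0 < v by rewrite mulr_gt0.
  have vm : v <= m by rewrite ler_piMl // ltW.
  have p'1 : enorm (p + v *: w) <= 1.
    rewrite (le_trans (ler_enormD _ _)) // enormZ gtr0_norm // -/P -/W.
    have := ler_wpM2r W0 vm; lra.
  have t'1 : 0 <= t - v <= s by apply/andP; split; lra.
  have := pmin _ _ p'1 t'1; rewrite /J.
  have -> : y + (t - v) *: w + (p + v *: w) = y + t *: w + p.
    by rewrite scalerBl; apply/matrixP => i j; rewrite !mxE; ring.
  rewrite !sqr_enorm !(dotDl, dotDr, dotZl, dotZr) (dotC w p) -[dot w w]sqr_enorm -/W => h1.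
  rewrite -(ler_pM2l v0) -/m /u ?dotZl.
  have -> : N * W ^+ 2 * m * q = N * W ^+ 2 * v by rewrite /v; ring.
  lra.
have xxb : x - xb = (1 + t) *: w + p.
  by rewrite xE wE; apply/matrixP => i j; rewrite !mxE; ring.
have xW : enorm (x - xb) <= (1 + t) * W + P.
  by rewrite xxb (le_trans (ler_enormD _ _)) // enormZ ger0_norm //; lra.
have tW : (1 + t) * W <= (1 + s) * W by rewrite ler_wpM2r // lerD2l.
have xr : enorm (x - xb) < r.
  apply: le_lt_trans xW _; rewrite -(ltr_pM2l N0); have := ler_wpM2l (ltW N0) tW; lra.
have := Gss x h u xr rcod; rewrite ler_norml => /andP[h1 _].
have h2 : dot u (x - xb) <= (1 + t) * (f - c).
  rewrite xxb dotDr dotZr -[leRHS]addr0 lerD //.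
    by rewrite ler_wpM2l //; lra.
  rewrite /u dotZl -sqr_enorm mulNr oppr_le0.
  exact: mulr_ge0 (mulr_ge0 (ler0n _ 2) (ltW N0)) (sqr_ge0 _).
have h3 : f - l * H * (t * W + P) <= dot h (G x).
  have := dotG_lip h y x; have -> : x - y = t *: w + p.
    by rewrite xE addrAC [y + _]addrC addrK.
  rewrite dotDr dotNr -/f -/H ler_norml => /andP[h3 _].
  have h4 : enorm (t *: w + p) <= t * W + P.
    by rewrite (le_trans (ler_enormD _ _)) // enormZ ger0_norm.
  have := ler_wpM2l lH0 h4; lra.
have h4 : e * enorm (x - xb) * H <= e * ((1 + t) * W + P) * H.
  by rewrite ler_wpM2r // ler_pM2l.
have h5 : t * f <= t * (l * H * W) by rewrite ler_wpM2l.
have h6 : (1 + t) * c <= 2 * t * (l * H * W) + e * (1 + t) * W * H + (l + e) * H * P.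
  rewrite -/H in h1; lra.
have WH0 : 0 <= W * H by rewrite mulr_ge0.
have a0 : 0 <= a by rewrite /a -mulrA mulr_ge0 // mulr_ge0 // ltW.
have h7 : c <= (1 + t) * c by rewrite ler_peMl ?lerDl // (le_trans a0) // ltW.
have h8 : (2 * t * l + e * (1 + t)) * (W * H) <= 2 * e * (W * H).
  rewrite ler_wpM2r // .
  have le0 : 0 <= 2 * l + e by rewrite addr_ge0 ?mulr_ge0 // ltW.
  have tse := ler_wpM2r le0 ts; lra.
have h9 : N * ((l + e) * H * P) <= (l + e) * H * (l * H).
  have le0 : 0 <= l + e by rewrite ltW // addr_gt0.
  by have := ler_wpM2l (mulr_ge0 le0 H0) NP; lra.
have : N * (c - a) <= N * ((l + e) * H * P) by rewrite ler_pM2l // /a; lra.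
lra.
Qed.

End Semismooth.

(** A midpoint subdivision argument: a function with a quadratic upper model
    whose slopes are bounded by M is M-Lipschitz on balls. *)
Lemma lipschitz_of_upper_model (R : realType) n (F : 'cV[R]_n -> R) (q : 'cV[R]_n -> 'cV[R]_n)
    (xb : 'cV[R]_n) (rho M C : R) : 0 <= C ->
  (forall z z', F z' <= F z + dot (q z) (z' - z) + C * enorm (z' - z) ^+ 2) ->
  (forall z, enorm (z - xb) <= rho -> enorm (q z) <= M) ->
  forall z z', enorm (z - xb) <= rho -> enorm (z' - xb) <= rho ->
    F z' - F z <= M * enorm (z' - z).
Proof.
move=> C0 Fq qM.
have key k z z' : enorm (z - xb) <= rho -> enorm (z' - xb) <= rho ->
    F z' - F z <= M * enorm (z' - z) + C * enorm (z' - z) ^+ 2 / 2 ^+ k.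
  elim: k z z' => [|k ih] z z' zr z'r.
    rewrite expr0 divr1; have := Fq z z'; have := dot_le_enorm (q z) (z' - z).
    by have := ler_wpM2r (enorm_ge0 (z' - z)) (qM z zr); lra.
  pose m := 2^-1 *: (z + z').
  have mz : m - z = 2^-1 *: (z' - z).
    by apply/matrixP => i j; rewrite !mxE; field.
  have z'm : z' - m = 2^-1 *: (z' - z).
    by apply/matrixP => i j; rewrite !mxE; field.
  have mr : enorm (m - xb) <= rho.
    have -> : m - xb = 2^-1 *: ((z - xb) + (z' - xb)).
      by apply/matrixP => i j; rewrite !mxE; field.
    rewrite enormZ gtr0_norm ?invr_gt0 //.
    by have := ler_enormD (z - xb) (z' - xb); lra.
  have := ih z m zr mr; have := ih m z' mr z'r.
  rewrite mz z'm enormZ gtr0_norm ?invr_gt0 // (exprS _ k) => h1 h2.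
  have k0 : (2 : R) ^+ k != 0 by rewrite expf_neq0 // pnatr_eq0.
  have -> : C * enorm (z' - z) ^+ 2 / (2 * 2 ^+ k) =
      2 * (C * (2^-1 * enorm (z' - z)) ^+ 2 / 2 ^+ k) by field.
  lra.
move=> z z' zr z'r; set D := enorm _.
apply: (@le_of_le_eps _ _ _ (C * D ^+ 2)) => e e0 _.
have [N NP] := @exists_small_inv R 1 e ler01 e0.
apply: le_trans (key N.+1 z z' zr z'r) _; rewrite lerD2l; apply: (ler_wpM2l (mulr_ge0 C0 (sqr_ge0 _))).
apply: ltW; apply: le_lt_trans _ (NP N (leqnn N)); rewrite div1r lef_pV2 ?posrE ?exprn_gt0 //.
by rewrite -natrX ler_nat ltnW // ltn_expl.
Qed.

Section Homogeneity.
Variables (R : realType) (n : nat) (psi : 'cV[R]_n -> R) (G : 'cV[R]_n -> 'cV[R]_n) (l : R).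
Hypothesis psiG : smooth_convex psi G l.
Variable xb : 'cV[R]_n.
Hypothesis Gxb : G xb = 0.
Implicit Types (x y z h u d : 'cV[R]_n) (e r s : R).

Let l_gt0 : 0 < l. Proof. by case: psiG. Qed.

Lemma radial_gradient_bound e r y s : 0 < e -> semismooth_estimate G xb e r ->
  0 < s -> s * (2 * l + e) <= e -> (1 + s) * enorm (y - xb) < r ->
  enorm (G (y + s *: (y - xb)) - (1 + s) *: G y) <= 2 * e * s * enorm (y - xb).
Proof.
move=> e0 Gss s0 se sr; apply: le_enorm_dot => [|h].
  by rewrite mulr_ge0 ?enorm_ge0 // ltW // !mulr_gt0.
have := radial_growth psiG Gxb (- h) e0 Gss s0 se sr.
by rewrite enormN dotNl; lra.
Qed.

(** The defect of psi from being homogeneous of degree two around xb. Its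
    gradient formally is H (x - xb) - G x, with H the symmetric derivative of G. *)
Definition euler_defect x := dot (G x) (x - xb) - 2 * (psi x - psi xb).

(** The scaling quotient s ^ -1 (psi (z + s (z - xb)) - (1 + s) ^ 2 psi z) is
    smooth, with slopes controlled by the radial estimate, and converges to
    euler_defect up to a constant. This is where G being a gradient enters. *)
Lemma euler_defect_lipschitz e r rho : 0 < e -> semismooth_estimate G xb e r ->
  2 * rho < r -> forall z z', enorm (z - xb) <= rho -> enorm (z' - xb) <= rho ->
  euler_defect z' - euler_defect z <= 4 * e * rho * enorm (z' - z).
Proof.
move=> e0 Gss rr z z' zr z'r.
have rho0 : 0 <= rho := le_trans (enorm_ge0 _) zr.
have le0 : 0 < 2 * l + e by rewrite addr_gt0 // mulr_gt0.
pose s0 := Num.min 1 (e / (2 * l + e)).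
have s00 : 0 < s0 by rewrite lt_min ltr01 divr_gt0.
have s01 : s0 <= 1 by rewrite ge_min lexx.
have s0e : s0 * (2 * l + e) <= e by rewrite -ler_pdivlMr // ge_min lexx orbT.
apply: (@le_of_le_eps _ _ _ (s0 * (l / 2 * rho ^+ 2 + `|psi z' - psi z|))) => q q0 q1.
pose s := q * s0; have s_gt0 : 0 < s by rewrite mulr_gt0.
have ss0 : s <= s0 by rewrite ler_piMl // ltW.
have s1 : s <= 1 := le_trans ss0 s01.
have se : s * (2 * l + e) <= e by apply: le_trans s0e; rewrite ler_pM2r.
pose F y := psi (y + s *: (y - xb)) - (1 + s) ^+ 2 * psi y.
pose p y := (1 + s) *: (G (y + s *: (y - xb)) - (1 + s) *: G y).
have Fp y y' : F y' <= F y + dot (p y) (y' - y) + l / 2 * (1 + s) ^+ 2 * enorm (y' - y) ^+ 2.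
  have := descent_le psiG (y + s *: (y - xb)) (y' + s *: (y' - xb)).
  have -> : y' + s *: (y' - xb) - (y + s *: (y - xb)) = (1 + s) *: (y' - y).
    by apply/matrixP => i j; rewrite !mxE; ring.
  rewrite enormZ exprMn real_normK ?num_real // dotZr /F /p dotZl dotDl dotNl dotZl.
  have := ler_wpM2l (sqr_ge0 (1 + s)) (gradient_le psiG y y').
  rewrite !expr2; lra.
have pM y : enorm (y - xb) <= rho -> enorm (p y) <= 4 * e * rho * s.
  move=> yr; rewrite enormZ gtr0_norm ?addr_gt0 //.
  have W0 := enorm_ge0 (y - xb).
  have sy : (1 + s) * enorm (y - xb) < r.
    have : (1 + s) * enorm (y - xb) <= 2 * enorm (y - xb) by rewrite ler_wpM2r //; lra.
    lra.
  have := radial_gradient_bound e0 Gss s_gt0 se sy; set v := enorm _ => h1.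
  have v0 : 0 <= v := enorm_ge0 _.
  have h2 : (1 + s) * v <= 2 * v by rewrite ler_wpM2r //; lra.
  have h3 : e * s * enorm (y - xb) <= e * s * rho by rewrite ler_wpM2l // ltW // mulr_gt0.
  lra.
have C0 : 0 <= l / 2 * (1 + s) ^+ 2 by rewrite mulr_ge0 ?sqr_ge0 // divr_ge0 // ltW.
have Fl := lipschitz_of_upper_model C0 Fp pM zr z'r.
have hF y : enorm (y - xb) <= rho -> exists2 k, 0 <= k <= l / 2 * rho ^+ 2 &
    F y = s * (euler_defect y - 2 * psi xb) + s ^+ 2 * k - s ^+ 2 * psi y.
  move=> yr; exists ((psi (y + s *: (y - xb)) - psi y - s * dot (G y) (y - xb)) / s ^+ 2); last first.
    by rewrite /F /euler_defect [s ^+ 2 * (_ / _)]mulrC divfK ?expf_neq0 ?gt_eqF // !expr2; ring.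
  have ys : y + s *: (y - xb) - y = s *: (y - xb) by rewrite addrC addKr.
  have := gradient_le psiG y (y + s *: (y - xb)).
  have := descent_le psiG y (y + s *: (y - xb)).
  rewrite ys dotZr enormZ gtr0_norm // exprMn => h1 h2.
  rewrite divr_ge0 ?sqr_ge0 ?subr_ge0 //=; last by lra.
  rewrite ler_pdivrMr ?exprn_gt0 //.
  have : enorm (y - xb) ^+ 2 <= rho ^+ 2 by rewrite ler_sqr ?nnegrE ?enorm_ge0.
  have ls : 0 <= l / 2 * s ^+ 2 by rewrite mulr_ge0 ?sqr_ge0 // divr_ge0 // ltW.
  move=> /(ler_wpM2l ls); lra.
have [k /andP[k0 k1] Fz] := hF z zr; have [k' /andP[k'0 k'1] Fz'] := hF z' z'r.
rewrite Fz Fz' in Fl; rewrite -(ler_pM2l s_gt0).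
have h1 : s ^+ 2 * (k - k' + (psi z' - psi z)) <= s ^+ 2 * (l / 2 * rho ^+ 2 + `|psi z' - psi z|).
  by rewrite ler_pM2l ?exprn_gt0 //; have := ler_norm (psi z' - psi z); lra.
have -> : s0 * (l / 2 * rho ^+ 2 + `|psi z' - psi z|) * q =
    s * (l / 2 * rho ^+ 2 + `|psi z' - psi z|) by rewrite /s; ring.
rewrite expr2 in h1 Fl; lra.
Qed.

Lemma euler_defect_le e r x : 0 < e -> semismooth_estimate G xb e r ->
  2 * enorm (x - xb) < r -> `|euler_defect x| <= 4 * e * enorm (x - xb) ^+ 2.
Proof.
move=> e0 Gss xr.
have b0 : enorm (xb - xb) <= enorm (x - xb) by rewrite subrr enorm0 enorm_ge0.
have := euler_defect_lipschitz e0 Gss xr b0 (lexx _).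
have := euler_defect_lipschitz e0 Gss xr (lexx _) b0.
have -> : euler_defect xb = 0 by rewrite /euler_defect !subrr dot0r mulr0 subr0.
by rewrite (enormBC xb) ler_norml expr2 => h1 h2; apply/andP; split; lra.
Qed.

Variables (K r0 : R).
Hypothesis Ginv : lipschitz_inverse G K r0.

(** If u in D* G(x)(h) then u + G x in D* G(x)(h + x - xb) up to a small error,
    since near x the function <x - xb, G> equals euler_defect plus a function
    with derivative G x at x; regularity of G then bounds h + x - xb. *)
Lemma regular_coderiv_newton_error e r x h u : 0 < e -> semismooth_estimate G xb e r ->
  2 * enorm (x - xb) < r -> enorm (G x) < r0 -> regular_coderiv G x h u ->
  enorm (x - xb + h) <= K * (enorm (u + G x) + 4 * e * enorm (x - xb)).
Proof.
move=> e0 Gss xr xr0 xhu; case: (Ginv) => K0 r00 Glip Gsurj.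
set W := enorm (x - xb) in xr *; have W0 : 0 <= W := enorm_ge0 _.
have [a aE] : exists a, a = x - xb + h by eexists.
rewrite -aE; have [->|an0] := eqVneq a 0.
  by rewrite enorm0 !mulr_ge0 ?addr_ge0 ?mulr_ge0 ?enorm_ge0 // ltW.
have a0 := enorm_gt0 an0.
apply: (@le_of_le_eps _ _ _ (2 * K)) => q q0 _.
have [d d0 dP] := xhu q q0.
have el0 : 0 < 4 * e + l by rewrite addr_gt0 // mulr_gt0.
pose b := Num.min d (Num.min ((r - 2 * W) / 2) (q / (4 * e + l))).
have b0 : 0 < b by rewrite !lt_min d0 !divr_gt0 // subr_gt0.
have m0 : 0 < Num.min ((r0 - enorm (G x)) / 2) (b / (2 * K)).
  by rewrite lt_min !divr_gt0 // ?subr_gt0 // mulr_gt0.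
set m := Num.min _ (b / (2 * K)) in m0.
have m1 : m <= (r0 - enorm (G x)) / 2 by rewrite ge_min lexx.
have m2 : m * (2 * K) <= b by rewrite -ler_pdivlMr ?mulr_gt0 // ge_min lexx orbT.
pose t := m / enorm a; have t0 : 0 < t by rewrite divr_gt0.
have ta : t * enorm a = m by rewrite divfK // gt_eqF.
have yr : enorm (G x - t *: a) < r0.
  by rewrite (le_lt_trans (ler_enormB _ _)) // enormZ gtr0_norm // ta; lra.
have [y yE] := Gsurj _ yr.
have Gyx : G y - G x = - (t *: a) by rewrite yE addrAC subrr add0r.
have yx : enorm (y - x) <= K * m.
  by rewrite (le_trans (Glip _ _ _ _)) ?yE // addrAC subrr add0r enormN enormZ gtr0_norm // ta.
have yb : enorm (y - x) < b by rewrite (le_lt_trans yx) //; have := mulr_gt0 K0 m0; lra.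
move: (yb); rewrite !lt_min => /and3P[yd yW yq].
rewrite ltr_pdivlMr // in yq.
set D := enorm (y - x) in yx yW yq yd *; have D0 : 0 <= D := enorm_ge0 _.
have xW : enorm (x - xb) <= W + D by rewrite lerDl.
have yWD : enorm (y - xb) <= W + D by rewrite [leRHS]addrC ler_enorm_tri.
have WDr : 2 * (W + D) < r by lra.
have h1 := euler_defect_lipschitz e0 Gss WDr yWD xW.
rewrite (enormBC x) -/D in h1.
have h2 := dP y yd; rewrite -/D in h2.
have h3 := gradient_le psiG x y.
have h4 : euler_defect y - euler_defect x =
    dot (x - xb) (G y - G x) + dot (G y - G x) (y - x) + dot (G x) (y - x)
    - 2 * (psi y - psi x).
  have yxb : y - xb = (x - xb) + (y - x) by rewrite [RHS]addrC subrKA.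
  rewrite /euler_defect yxb; move: (x - xb) (y - x) => v v'.
  by rewrite !(dotDl, dotDr, dotNl, dotNr) !(dotC v); ring.
have h5 : dot (G y - G x) (y - x) <= l * D ^+ 2.
  rewrite (le_trans (dot_le_enorm _ _)) // expr2 mulrA ler_wpM2r //.
  exact: (gradient_lipschitz psiG).
have h6 : dot a (G y - G x) = dot (x - xb) (G y - G x) + dot h (G y - G x).
  by rewrite aE dotDl.
have h7 : dot a (G y - G x) = - (m * enorm a).
  by rewrite Gyx dotNr dotZr -sqr_enorm -ta expr2 mulrA.
have := norm_dot_le (u + G x) (y - x); rewrite dotDl ler_norml -/D => /andP[h8 _].
have h9 : (4 * e + l) * D * D <= q * D by rewrite ler_wpM2r // mulrC ltW.
have h10 : m * enorm a <= D * (enorm (u + G x) + 4 * e * W + 2 * q).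
  rewrite expr2 in h5; lra.
have P0 : 0 <= enorm (u + G x) + 4 * e * W + 2 * q.
  by rewrite !addr_ge0 ?mulr_ge0 ?enorm_ge0 // ltW.
have h11 := ler_wpM2r P0 yx.
rewrite -(ler_pM2l m0); lra.
Qed.

Lemma limiting_coderiv_newton_error e r x h u : 0 < e -> semismooth_estimate G xb e r ->
  2 * enorm (x - xb) < r -> enorm (G x) < r0 -> limiting_coderiv G x h u ->
  enorm (x - xb + h) <= K * (enorm (u + G x) + 4 * e * enorm (x - xb)).
Proof.
move=> e0 Gss xr xr0 xhu; case: (Ginv) => K0 _ _ _.
apply: (@le_of_le_eps _ _ _ (2 + K * (1 + l + 4 * e))) => q q0 _.
pose b := Num.min q (Num.min ((r - 2 * enorm (x - xb)) / 2) ((r0 - enorm (G x)) / l)).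
have b0 : 0 < b by rewrite !lt_min q0 !divr_gt0 // subr_gt0.
have [x' [h' [u' [+ + + rc]]]] := xhu b b0; rewrite !lt_min.
move=> /and3P[x1 x2 x3] /and3P[h1 _ _] /and3P[u1 _ _].
rewrite ltr_pdivlMr // in x3.
have Gx' := gradient_lipschitz psiG x x'.
have xx' := ler_enorm_tri x' x xb.
have GG := ler_enorm_dist (G x') (G x).
have x'r : 2 * enorm (x' - xb) < r by lra.
have Gx'r : enorm (G x') < r0 by lra.
have h2 := regular_coderiv_newton_error e0 Gss x'r Gx'r rc.
have h3 : enorm (x - xb + h) <= enorm (x' - xb + h') + 2 * q.
  have -> : x - xb + h = (x' - xb + h') - ((x' - x) + (h' - h)).
    by apply/matrixP => i j; rewrite !mxE; ring.
  have := ler_enormB (x' - xb + h') ((x' - x) + (h' - h)).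
  by have := ler_enormD (x' - x) (h' - h); lra.
have h4 : enorm (u' + G x') <= enorm (u + G x) + (1 + l) * q.
  have -> : u' + G x' = (u + G x) + ((u' - u) + (G x' - G x)).
    by apply/matrixP => i j; rewrite !mxE; ring.
  have := ler_enormD (u + G x) ((u' - u) + (G x' - G x)).
  have := ler_enormD (u' - u) (G x' - G x).
  have : l * enorm (x' - x) <= l * q by rewrite ler_pM2l // ltW.
  lra.
have h5 : 4 * e * enorm (x' - xb) <= 4 * e * (enorm (x - xb) + q).
  by rewrite ler_pM2l ?mulr_gt0 //; lra.
have h6 : K * (enorm (u' + G x') + 4 * e * enorm (x' - xb)) <=
    K * (enorm (u + G x) + (1 + l) * q + 4 * e * (enorm (x - xb) + q)).
  by rewrite ler_pM2l // lerD.
lra.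
Qed.

Variables (lambda sigma beta : R).
Hypotheses (lambda_gt0 : 0 < lambda) (sigmaP : 0 < sigma < 2^-1) (betaP : 0 < beta < 1).
Hypothesis Gss : forall e, 0 < e -> exists2 r, 0 < r & semismooth_estimate G xb e r.

(** Since euler_defect is o(|x - xb| ^ 2), the Newton step reaches half of the
    linear prediction, which is more than the fraction sigma < 1 / 2 asked for. *)
Lemma newton_iteration_superlinear (eta : R) : 0 < eta ->
  exists2 r, 0 < r & forall x x', enorm (x - xb) < r ->
    newton_iteration psi G lambda sigma beta x x' -> enorm (x' - xb) <= eta * enorm (x - xb).
Proof.
move=> eta0; case: (Ginv) => K0 r00 Glip _; have /andP[sig0 sig1] := sigmaP.
pose c := (l * K ^+ 2)^-1.
have c0 : 0 < c by rewrite invr_gt0 mulr_gt0 // exprn_gt0.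
have lK0 : 0 < 2 * l + K^-1 by rewrite addr_gt0 ?mulr_gt0 // invr_gt0.
pose q := Num.min eta (Num.min 1 ((2^-1 - sigma) * c / (2 * l + K^-1))).
have q0 : 0 < q by rewrite !lt_min eta0 ltr01 divr_gt0 // mulr_gt0 // subr_gt0.
have q1 : q <= 1 by rewrite /q !ge_min lexx orbT.
have qeta : q <= eta by rewrite ge_min lexx.
have qc : q * (2 * l + K^-1) <= (2^-1 - sigma) * c.
  by rewrite -ler_pdivlMr // /q !ge_min lexx !orbT.
pose e := q / (8 * K).
have e0 : 0 < e by rewrite divr_gt0 // mulr_gt0.
have eK : 8 * (K * e) = q by rewrite /e; field; rewrite gt_eqF.
have [r r_gt0 rP] := Gss e0.
pose b := q * c / (2 * K * lambda * l ^+ 2).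
have kl : 0 < 2 * K * lambda * l ^+ 2.
  by apply: mulr_gt0; rewrite ?exprn_gt0 // mulr_gt0 // mulr_gt0.
have b0 : 0 < b by rewrite divr_gt0 // mulr_gt0.
exists (Num.min (r / 2) (Num.min (r0 / l) b)); first by rewrite !lt_min b0 !divr_gt0.
move=> x x'; rewrite !lt_min; set W := enorm (x - xb) => /and3P[xr xr0 xb0].
move=> [d [tau [dP [m [tE dec nodec]] x'E]]].
have W0 : 0 <= W := enorm_ge0 _.
have GW : enorm (G x) <= l * W.
  by have := gradient_lipschitz psiG xb x; rewrite Gxb subr0.
have Gx0 : enorm (G x) < r0 by move: xr0; rewrite ltr_pdivlMr //; lra.
have mu0 : 0 <= lambda * enorm (G x) by rewrite mulr_ge0 ?enorm_ge0 // ltW.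
have hc := newton_direction_curvature psiG Ginv mu0 Gx0 dP.
have dW := le_gradient_of_descent hc; rewrite -/c in dW hc.
have xr2 : 2 * enorm (x - xb) < r by rewrite -/W; lra.
have := limiting_coderiv_newton_error e0 rP xr2 Gx0 dP.
have -> : - G x - (lambda * enorm (G x)) *: d + G x = - ((lambda * enorm (G x)) *: d).
  by rewrite addrAC addNr add0r.
rewrite enormN enormZ ger0_norm // -/W => h1.
have h2 : enorm (x - xb + d) <= q * W.
  have h3 : c * (lambda * enorm (G x) * enorm d) <= lambda * (l * W) * (l * W).
    have -> : c * (lambda * enorm (G x) * enorm d) = lambda * enorm (G x) * (c * enorm d) by ring.
    apply: ler_pM; rewrite ?(mulr_ge0 (ltW c0) (enorm_ge0 _)) //.
      by rewrite ler_pM2l.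
    exact: le_trans dW GW.
  have h4 : W * (2 * K * lambda * l ^+ 2) * W <= q * c * W.
    by rewrite ler_wpM2r // ltW // -ltr_pdivlMr.
  have h5 : c * (K * (lambda * enorm (G x) * enorm d)) <= c * (q / 2 * W).
    rewrite mulrCA; have := ler_wpM2l (ltW K0) h3; rewrite expr2 in h4; lra.
  rewrite ler_pM2l // in h5.
  have h6 : q * W = 8 * (K * e) * W by rewrite eK.
  lra.
have h3 := descent_le psiG xb (x + d); rewrite Gxb dot0l addr0 addrAC in h3.
have := euler_defect_le e0 rP xr2; rewrite -/W ler_norml /euler_defect => /andP[_ h4].
have h5 : `|dot (G x) d + dot (G x) (x - xb)| <= l * q * W ^+ 2.
  rewrite addrC -(dotDr (x - xb)) (le_trans (norm_dot_le _ _)) // expr2.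
  have := ler_pM (enorm_ge0 _) (enorm_ge0 _) GW h2; lra.
move: h5; rewrite ler_norml => /andP[h5' h5].
have h6 : c * W ^+ 2 <= dot (G x) (x - xb).
  have := gradient_cocoercive psiG xb x; rewrite Gxb subr0 => h6.
  have h7 : enorm (x - xb) <= K * enorm (G x).
    by rewrite (le_trans (Glip _ _ Gx0 _)) ?Gxb ?enorm0 ?subr0.
  have h8 : W ^+ 2 <= (K * enorm (G x)) ^+ 2.
    by rewrite ler_sqr ?nnegrE ?mulr_ge0 ?enorm_ge0 ?(ltW K0).
  rewrite /c mulrC ler_pdivrMr ?mulr_gt0 ?exprn_gt0 // (le_trans h8) // exprMn.
  have := ler_wpM2l (sqr_ge0 K) h6; lra.
have h7 : l / 2 * enorm (x - xb + d) ^+ 2 <= l / 2 * (q * W ^+ 2).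
  rewrite ler_pM2l ?divr_gt0 //.
  have h8 : enorm (x - xb + d) ^+ 2 <= (q * W) ^+ 2.
    by rewrite ler_sqr ?nnegrE ?mulr_ge0 ?enorm_ge0 ?(ltW q0).
  apply: (le_trans h8); rewrite exprMn; apply: (ler_wpM2r (sqr_ge0 _)).
  by rewrite expr2 ler_piMl ?(ltW q0).
have unit_step : sufficient_decrease psi G sigma x d (beta ^+ 0).
  rewrite /sufficient_decrease expr0 scale1r mulr1.
  have h8 : (q * (2 * l + K^-1)) * W ^+ 2 <= (2^-1 - sigma) * (c * W ^+ 2).
    by rewrite mulrA ler_wpM2r ?sqr_ge0.
  have h9 : (2^-1 - sigma) * (c * W ^+ 2) <= (2^-1 - sigma) * dot (G x) (x - xb).
    by rewrite ler_wpM2l // subr_ge0 ltW.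
  have h10 : 4 * e * W ^+ 2 <= q * K^-1 * W ^+ 2.
    rewrite ler_wpM2r ?sqr_ge0 // -(ler_pM2l K0).
    have -> : K * (q * K^-1) = q by rewrite mulrCA divff ?mulr1 // gt_eqF.
    by have := ltW q0; lra.
  have h11 := ler_wpM2l (ltW sig0) h5'.
  have h12 : sigma * (l * q * W ^+ 2) <= l * q * W ^+ 2 / 2.
    have X0 : 0 <= l * q * W ^+ 2 by rewrite mulr_ge0 ?sqr_ge0 // mulr_ge0 // ltW.
    by have := ler_wpM2r X0 (ltW sig1); lra.
  have X0 : 0 <= l * q * W ^+ 2 by rewrite mulr_ge0 ?sqr_ge0 // mulr_ge0 // ltW.
  have Y0 : 0 <= q * K^-1 * W ^+ 2.
    by rewrite mulr_ge0 ?sqr_ge0 // mulr_ge0 ?invr_ge0 // ltW.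
  lra.
case: m tE dec nodec => [|m] tE _ nodec; last by case: (nodec 0%N).
rewrite x'E tE expr0 scale1r addrAC (le_trans h2) // ler_wpM2r //.
Qed.

End Homogeneity.

Section SuperlinearConvergence.
Variables (R : realType) (n : nat).

Lemma Q_superlinear_of_contraction (x : nat -> 'cV[R]_n) (xb : 'cV[R]_n) :
  x @ \oo --> xb ->
  (forall eta, 0 < eta -> exists2 r, 0 < r & forall k, enorm (x k - xb) < r ->
     enorm (x k.+1 - xb) <= eta * enorm (x k - xb)) ->
  Q_superlinear_cvg x xb.
Proof.
move=> xcvg xsup; split=> //; apply/cvgrPdist_lt => e e0.
have e2 : 0 < e / 2 by rewrite divr_gt0.
have [r r0 rP] := xsup _ e2.
have /ecvgP/(_ r r0)[N NP] := xcvg; exists N => // k /= Nk.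
rewrite sub0r normrN ger0_norm ?divr_ge0 ?enorm_ge0 //.
have [->|x0] := eqVneq (enorm (x k - xb)) 0; first by rewrite invr0 mulr0.
have xp : 0 < enorm (x k - xb) by rewrite lt_neqAle eq_sym x0 enorm_ge0.
rewrite ltr_pdivrMr // (le_lt_trans (rP k (NP k Nk))) // ltr_pM2r //; lra.
Qed.

End SuperlinearConvergence.

(** * Convex functions and their proximal mapping *)

Section ConvexFunction.
Variables (R : realType) (n : nat) (g : 'cV[R]_n -> \bar R).
Hypotheses (g_proper : eproper g) (g_lsc : lower_semicontinuous g) (g_convex : econvex g).
Implicit Types (x y v w s u : 'cV[R]_n).

Lemma convex_combination_le x y (a c t : R) : g x = a%:E -> g y = c%:E -> 0 < t < 1 ->
  (g (t *: x + (1 - t) *: y)%R <= (t * a + (1 - t) * c)%:E)%E.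
Proof. by move=> xa yc t01; have := g_convex x y t01; rewrite xa yc -!EFinM -EFinD. Qed.

Lemma proper_cases y : g y = +oo%E \/ exists a, g y = a%:E.
Proof.
case: g_proper => /(_ y) + _; case: (g y) => [a _| _ |//]; last by left.
by right; exists a.
Qed.

(** Scaling the increment by t makes the quadratic term of order t ^ 2, while
    convexity bounds the increase of g by a multiple of t. Both the optimality
    condition of the proximal problem and the sum rule are of this form. *)
Lemma subdiff_of_quadratic_minorant v s (C : R) : g v \is a fin_num ->
  (forall w, (g v + (dot s (w - v) - C * enorm (w - v) ^+ 2)%:E <= g w)%E) -> subdiff g v s.
Proof.
move=> gv hC; split=> // y; have [->|[c gy]] := proper_cases y; first by rewrite leey.
move: gv hC; rewrite fin_numE; case gv : (g v) => [a| |] // _ hC.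
rewrite gy -EFinD lee_fin; apply: (@le_of_le_eps _ _ _ (C * enorm (y - v) ^+ 2)) => t t0 t1.
have t01 : 0 < t < 1 by rewrite t0.
have := le_trans (hC _) (convex_combination_le gy gv t01).
have -> : t *: y + (1 - t) *: v - v = t *: (y - v).
  by apply/matrixP => i j; rewrite !mxE; ring.
rewrite -EFinD lee_fin dotZr enormZ gtr0_norm // => h.
by rewrite -(ler_pM2l t0); rewrite exprMn !expr2 in h *; lra.
Qed.

Lemma subdiff_fin v s : subdiff g v s -> exists a, g v = a%:E.
Proof. by case; case: (g v) => // a _ _; exists a. Qed.

Lemma subdiff_monotone v s w u : subdiff g v s -> subdiff g w u ->
  0 <= dot (s - u) (v - w).
Proof.
move=> vs wu; have [a va] := subdiff_fin vs; have [c wc] := subdiff_fin wu.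
have [_ /(_ w)] := vs; have [_ /(_ v)] := wu.
rewrite va wc -!EFinD !lee_fin -(opprB v w) dotNr dotDl dotNl; lra.
Qed.

(** Convexity extrapolates the minimum of g over the unit ball around a point
    of the domain. *)
Lemma convex_linear_minorant : exists2 C, 0 <= C & forall y, ((- (C * (1 + enorm y)))%:E <= g y)%E.
Proof.
have [_ [y0 gy0]] := g_proper.
have [a ya] : exists a, g y0 = a%:E by move: gy0; case: (g y0) => // a _; exists a.
have [||||z zr zmin] := @lsc_attains_min _ n [set z | enorm (z - y0) <= 1] g (enorm y0 + 1) y0.
- by rewrite /= subrr enorm0 ler01.
- by move=> z /= z1; have := ler_enorm_dist z y0; lra.
- move=> z zP /=; apply: (@le_of_le_eps _ _ _ 1) => e e0 _.
  by have [y /= yr yz] := zP e e0; have := ler_enorm_tri z y y0; rewrite (enormBC z y); lra.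
- move=> z c _ cz; have [V /enorm_nbhsP[d d0 dV] VP] := g_lsc cz.
  by exists d => // y _ yz; apply/VP/dV.
have [m zm] : exists m, g z = m%:E.
  have := zmin y0; rewrite /= subrr enorm0 ya => /(_ ler01).
  by have [->//|] := proper_cases z.
have m0 := normr_ge0 m; have a0 := normr_ge0 a.
have key y : ((- ((`|m| + `|a|) * (1 + enorm (y - y0))))%:E <= g y)%E.
  have [->|[c yc]] := proper_cases y; first by rewrite leey.
  rewrite yc lee_fin; have D0 := enorm_ge0 (y - y0).
  have := ler_norm (- m); have := ler_norm a; rewrite normrN => am mm.
  have [D1|D1] := leP (enorm (y - y0)) 1.
    have := zmin y D1; rewrite zm yc lee_fin => mc.
    have : 0 <= (`|m| + `|a|) * enorm (y - y0) by rewrite mulr_ge0 // addr_ge0.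
    lra.
  set D := enorm (y - y0) in D0 D1 *; have Dp : 0 < D := lt_trans ltr01 D1.
  have t01 : 0 < D^-1 < 1 by rewrite invr_gt0 Dp invf_lt1.
  have pr : enorm (D^-1 *: y + (1 - D^-1) *: y0 - y0) <= 1.
    have -> : D^-1 *: y + (1 - D^-1) *: y0 - y0 = D^-1 *: (y - y0).
      by apply/matrixP => i j; rewrite !mxE; ring.
    by rewrite enormZ gtr0_norm ?invr_gt0 // mulVf ?gt_eqF.
  have := zmin _ pr; rewrite zm => /le_trans /(_ (convex_combination_le yc ya t01)).
  rewrite lee_fin -(ler_pM2l Dp).
  have -> : D * (D^-1 * c + (1 - D^-1) * a) = c + (D - 1) * a by field; rewrite gt_eqF.
  have h1 : (D - 1) * a <= (D - 1) * `|a| by rewrite ler_wpM2l //; lra.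
  have h2 : D * - m <= D * `|m| by rewrite ler_wpM2l.
  lra.
exists ((`|m| + `|a|) * (1 + enorm y0)) => [|y].
  by rewrite mulr_ge0 ?addr_ge0 ?enorm_ge0.
apply: le_trans (key y); rewrite lee_fin lerN2 -mulrA ler_wpM2l ?addr_ge0 //.
have := ler_enormB y y0; have := mulr_ge0 (enorm_ge0 y0) (enorm_ge0 y); lra.
Qed.

Variable gamma : R.
Hypothesis gamma_gt0 : 0 < gamma.

Let q := (2 * gamma)^-1.
Let q_gt0 : 0 < q. Proof. by rewrite invr_gt0 mulr_gt0. Qed.

(** The linear minorant makes the proximal problem coercive; r is a radius
    outside of which its values exceed the one at y0. *)
Lemma prox_exists u : exists v, prox gamma g u v.
Proof.
have [_ [y0 gy0]] := g_proper.
have [a ya] : exists a, g y0 = a%:E by move: gy0; case: (g y0) => // a _; exists a.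
have [C C0 Cg] := convex_linear_minorant.
pose H := a + q * enorm (y0 - u) ^+ 2.
pose r := (C + 1) / q + `|H| + C * (1 + enorm u) + 1 + enorm (y0 - u).
have Cu : 0 <= C * (1 + enorm u) by rewrite mulr_ge0 // addr_ge0 ?enorm_ge0.
have rq : (C + 1) / q + `|H| + C * (1 + enorm u) + 1 <= r by rewrite lerDl enorm_ge0.
have Cq : 0 <= (C + 1) / q by rewrite divr_ge0 ?(ltW q_gt0) // addr_ge0.
have y0r : enorm (y0 - u) <= r by rewrite /r lerDr !addr_ge0.
pose h y := (g y + (q * enorm (y - u) ^+ 2)%:E)%E.
have [||||v vr vmin] := @lsc_attains_min _ n [set z | enorm (z - u) <= r] h (enorm u + r) y0.
- exact: y0r.
- by move=> z /= z1; have := ler_enorm_dist z u; lra.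
- move=> z zP /=; apply: (@le_of_le_eps _ _ _ 1) => e e0 _.
  by have [y /= yr yz] := zP e e0; have := ler_enorm_tri z y u; rewrite (enormBC z y); lra.
- move=> z c _ cz; pose t := q * enorm (z - u) ^+ 2.
  have : ((c - t)%:E < g z)%E.
    move: cz; rewrite /h -/t; case: g_proper => /(_ z) + _.
    by case: (g z) => [b _| _ |//]; rewrite ?ltry // -EFinD !lte_fin ltrBlDr.
  move=> /ereal_between[b /andP[]]; rewrite lte_fin => cb bz.
  have [V /enorm_nbhsP[d d0 dV] VP] := g_lsc bz.
  have W0 : 0 < 2 * q * (enorm (z - u) + 1).
    by rewrite mulr_gt0 ?mulr_gt0 // ltr_wpDl // enorm_ge0.
  exists (Num.min d ((b - (c - t)) / (2 * q * (enorm (z - u) + 1)))) => [|y _].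
    by rewrite lt_min d0 divr_gt0 // subr_gt0.
  rewrite lt_min => /andP[yd]; rewrite ltr_pdivlMr // => yq.
  have := VP y (dV y yd); rewrite /h.
  have [->|[gy yE]] := proper_cases y; first by rewrite addye // !ltry.
  rewrite yE -EFinD !lte_fin => bgy.
  have h1 := ler_enorm_dist (z - u) (y - u).
  have zy : z - u - (y - u) = z - y by rewrite opprB subrKA.
  rewrite zy (enormBC z y) in h1.
  have h2 : enorm (z - u) ^+ 2 <= enorm (y - u) ^+ 2 + 2 * enorm (y - z) * (enorm (z - u) + 1).
    move: h1 (enorm_ge0 (z - u)) (enorm_ge0 (y - u)) (enorm_ge0 (y - z)).
    set Z := enorm (z - u); set Y := enorm (y - u); set r' := enorm (y - z) => h1 Z0 Y0 r'0.
    have [rZ|Zr] := leP r' Z; last by rewrite !expr2; nra.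
    have : (Z - r') ^+ 2 <= Y ^+ 2 by rewrite ler_sqr ?nnegrE; lra.
    by rewrite !expr2; nra.
  have := ler_wpM2l (ltW q_gt0) h2; rewrite -/t; lra.
exists v; split=> // y _; have [yr|yr] := leP (enorm (y - u)) r; first exact: vmin.
apply: (le_trans (vmin y0 y0r)); rewrite /h ya -EFinD -/H.
have [->|[gy yE]] := proper_cases y; first by rewrite addye // leey.
have := Cg y; rewrite yE -EFinD !lee_fin => h1.
set D := enorm (y - u) in yr *; have D0 : 0 <= D := enorm_ge0 _.
have h2 : C * enorm y <= C * (enorm u + D).
  by rewrite ler_wpM2l //; exact: ler_enorm_dist.
have h3 : C + 1 <= q * D.
  rewrite mulrC -ler_pdivrMr //; apply: le_trans (ltW yr); apply: le_trans rq.
  by rewrite -!addrA lerDl !addr_ge0.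
have h4 := ler_wpM2r D0 h3.
have h5 : `|H| + C * (1 + enorm u) <= D.
  by apply: le_trans (ltW yr); move: Cq rq; set k := (C + 1) / q => Cq rq; lra.
have := ler_norm H; rewrite -/q expr2; lra.
Qed.

Lemma prox_subdiff u v : prox gamma g u v -> subdiff g v (gamma^-1 *: (u - v)).
Proof.
move=> [_ vmin]; have [_ [y0 gy0]] := g_proper.
have gv : g v \is a fin_num.
  have := vmin y0 I; move: gy0; case: (g y0) => // a _.
  by have [->//|[c ->]] := proper_cases v.
apply: (@subdiff_of_quadratic_minorant _ _ q) => // w.
move: gv (vmin w I); case gvE : (g v) => [c| |] // _.
have [->|[e ->]] := proper_cases w; first by move=> _; exact: leey.
rewrite -!EFinD !lee_fin -/q.
have -> : w - u = (w - v) - (u - v) by apply/matrixP => i j; rewrite !mxE; ring.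
rewrite (enormBC v) !sqr_enorm; move: (w - v) (u - v) => x y.
rewrite !dotE (dotC y x) => h.
have -> : gamma^-1 = 2 * q by rewrite /q; field; rewrite gt_eqF.
lra.
Qed.

Fact prox_map_key : unit. Proof. by []. Qed.

(** The choice is forced, since prox is a singleton (prox_set1). *)
Definition prox_map u := locked_with prox_map_key (xget 0 (prox gamma g u)).

Lemma prox_mapP u : prox gamma g u (prox_map u).
Proof. by rewrite /prox_map unlock; have [v vP] := prox_exists u; exact: (xgetI 0 vP). Qed.

Lemma prox_map_subdiff u : subdiff g (prox_map u) (gamma^-1 *: (u - prox_map u)).
Proof. exact/prox_subdiff/prox_mapP. Qed.

Lemma resolvent_unique u v w : subdiff g v (gamma^-1 *: (u - v)) ->
  subdiff g w (gamma^-1 *: (u - w)) -> v = w.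
Proof.
move=> vs ws; have := subdiff_monotone vs ws.
have -> : gamma^-1 *: (u - v) - gamma^-1 *: (u - w) = - (gamma^-1 *: (v - w)).
  by apply/matrixP => i j; rewrite !mxE; ring.
rewrite dotNl dotZl oppr_ge0 pmulr_rle0 ?invr_gt0 // => h.
apply/eqP; rewrite -subr_eq0; apply/eqP/dot_eq0/eqP.
by rewrite eq_le h dot_ge0.
Qed.

Lemma prox_set1 u : prox gamma g u = [set prox_map u].
Proof.
apply/seteqP; split=> [v /prox_subdiff vP|_ ->]; last exact: prox_mapP.
exact: resolvent_unique vP (prox_map_subdiff u).
Qed.

Lemma prox_map_of_subdiff v s : subdiff g v s -> prox_map (v + gamma *: s) = v.
Proof.
move=> vs; apply: resolvent_unique (prox_map_subdiff _) _.
by rewrite addrC addKr scalerA mulVf ?gt_eqF // scale1r.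
Qed.

Lemma prox_map_nonexpansive u w : enorm (prox_map u - prox_map w) <= enorm (u - w).
Proof.
have := subdiff_monotone (prox_map_subdiff u) (prox_map_subdiff w).
set p := prox_map u; set p' := prox_map w.
have -> : gamma^-1 *: (u - p) - gamma^-1 *: (w - p') = gamma^-1 *: ((u - w) - (p - p')).
  by apply/matrixP => i j; rewrite !mxE; ring.
rewrite dotZl pmulr_rge0 ?invr_gt0 // dotDl dotNl -sqr_enorm => h.
have h1 := dot_le_enorm (u - w) (p - p').
have [->|p0] := eqVneq (p - p') 0; first by rewrite enorm0 enorm_ge0.
by have pp := enorm_gt0 p0; rewrite -(ler_pM2r pp) -expr2; lra.
Qed.

End ConvexFunction.

(** * The forward-backward envelope *)

Lemma grad_of_quadratic_bound (R : realType) n (F : 'cV[R]_n -> R) (x q : 'cV[R]_n) (C : R) :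
  (forall y, `|F y - F x - dot q (y - x)| <= C * enorm (y - x) ^+ 2) -> grad F x = q.
Proof.
move=> FC; apply/matrixP => i j; rewrite ord1 mxE.
pose e : 'cV[R]_n := delta_mx i 0.
have qe : dot q e = q i 0.
  rewrite /dot (bigD1 i) //= big1 ?addr0 => [|k ki]; first by rewrite mxE !eqxx mulr1.
  by rewrite mxE (negbTE ki) mulr0.
have C0 : 0 <= C * enorm e ^+ 2.
  by have := FC (x + e); rewrite [x + e]addrC addrK; apply: le_trans.
rewrite /derive; apply: cvg_lim => //; apply/cvgrPdist_le => /= eps eps0.
near=> h; have h0 : h != 0 by near: h; exact: nbhs_dnbhs_neq.
have := FC (h *: e + x); rewrite addrK dotZr enormZ qe exprMn => hF.
rewrite -normrN opprB.
have -> : h^-1 *: (F (h *: e + x) - F x) - q i 0 = h^-1 * (F (h *: e + x) - F x - h * q i 0).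
  by rewrite mulrBr mulrA mulVf // mul1r.
rewrite normrM normfV ler_pdivrMl ?normr_gt0 //; apply: (le_trans hF).
have : `|h| <= eps / (C * enorm e ^+ 2 + 1).
  near: h; apply: dnbhs0_le; rewrite divr_gt0 //; lra.
rewrite ler_pdivlMr; last by lra.
move=> /(ler_wpM2l (normr_ge0 h)); have := sqr_ge0 `|h|.
by rewrite [`|h| ^+ 2]expr2; lra.
Unshelve. all: by end_near.
Qed.

Lemma pd_unitmx (R : realType) n (B : 'M[R]_n) : pd_mx B -> B \in unitmx.
Proof.
move=> [Bs Bp]; rewrite -row_free_unit; apply: inj_row_free => v vB.
have Bv : B *m v^T = 0 by rewrite -{1}Bs -trmx_mul vB trmx0.
apply: trmx_inj; rewrite trmx0; apply/eqP; rewrite -[_ == _]negbK; apply/negP => /Bp.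
by rewrite Bv dot0l ltxx.
Qed.

Section Envelope.
Variables (R : realType) (n : nat) (A : 'M[R]_n) (b : 'cV[R]_n) (alpha : R)
  (g : 'cV[R]_n -> \bar R) (gamma : R).
Hypotheses (hA : psd_mx A) (g_proper : eproper g) (g_lsc : lower_semicontinuous g)
  (g_convex : econvex g) (gamma_gt0 : 0 < gamma).
Let B := 1%:M - gamma *: A.
Hypothesis hB : pd_mx B.
Implicit Types (x y z v w s u p : 'cV[R]_n).

Lemma dot_psdC x y : dot (A *m x) y = dot (A *m y) x.
Proof. by rewrite dot_mulmx_tr hA.1 dotC. Qed.

Lemma mulBE x : B *m x = x - gamma *: (A *m x).
Proof. by rewrite mulmxBl mul1mx scalemxAl. Qed.

(** Writing y = B y + gamma A y splits <A B y, y> into two nonnegative terms. *)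
Lemma sqr_psd_le y : gamma * dot (A *m y) (A *m y) <= dot (A *m y) y.
Proof.
have B0 z : 0 <= dot (B *m z) z.
  by have [->|/hB.2/ltW//] := eqVneq z 0; rewrite mulmx0 dot0l.
have h1 := hA.2 (B *m y); have := mulr_ge0 (ltW gamma_gt0) (B0 (A *m y)).
move: h1; rewrite !mulBE !mulmxBr -!scalemxAr !dotE.
rewrite (dot_psdC (A *m y) y) (dotC (A *m (A *m y)) (A *m y)).
set a := dot (A *m y) y; set c := dot (A *m y) (A *m y); set d := dot (A *m y) (A *m (A *m y)).
lra.
Qed.

Lemma quad_expand x p :
  quad A b alpha (x + p) = quad A b alpha x + dot (A *m x + b) p + 2^-1 * dot (A *m p) p.
Proof. by rewrite /quad mulmxDr !dotE (dot_psdC p x); field. Qed.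

Lemma quad_lower x y : quad A b alpha x + dot (A *m x + b) (y - x) <= quad A b alpha y.
Proof.
have [p ->] : exists p, y = x + p by exists (y - x); rewrite addrC subrK.
by rewrite [x + p - x]addrC addKr quad_expand lerDl mulr_ge0 ?invr_ge0 // hA.2.
Qed.

Lemma quad_upper x y : quad A b alpha y <=
  quad A b alpha x + dot (A *m x + b) (y - x) + (2 * gamma)^-1 * enorm (y - x) ^+ 2.
Proof.
have [p ->] : exists p, y = x + p by exists (y - x); rewrite addrC subrK.
rewrite [x + p - x]addrC addKr quad_expand lerD2l invfM -mulrA ler_pM2l ?invr_gt0 //.
rewrite mulrC ler_pdivlMr // mulrC sqr_enorm.
have : 0 <= dot (B *m p) p.
  by have [->|/hB.2/ltW//] := eqVneq p 0; rewrite mulmx0 dot0l.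
by rewrite mulBE dotDl dotNl dotZl; lra.
Qed.

Lemma grad_quad x : grad (quad A b alpha) x = A *m x + b.
Proof.
apply: (@grad_of_quadratic_bound _ _ _ _ _ (2 * gamma)^-1) => y.
by have := quad_lower x y; have := quad_upper x y => h1 h2; rewrite ger0_norm; lra.
Qed.

Notation P := (prox_map g gamma).
Definition fbe_value x : R := fine (comp_fbe A b alpha g gamma x).
Notation psi := fbe_value.

(** The backward step from the forward step at x. *)
Definition fb_step x := P (x - gamma *: (A *m x + b)).

Definition fbe_grad x := gamma^-1 *: (B *m (x - fb_step x)).

(** The function of y minimized in the definition of the envelope, without g. *)
Definition fb_model x y : R :=
  quad A b alpha x + dot (A *m x + b) (y - x) + (2 * gamma)^-1 * enorm (y - x) ^+ 2.

(** The subgradient of g that the proximal step at x selects. *)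
Definition fb_subgrad x := gamma^-1 *: (x - fb_step x) - (A *m x + b).

Lemma fb_subgradP x : subdiff g (fb_step x) (fb_subgrad x).
Proof.
have := prox_map_subdiff g_proper g_lsc g_convex gamma_gt0 (x - gamma *: (A *m x + b)).
rewrite -/(fb_step x); congr (subdiff g _ _).
rewrite /fb_subgrad addrAC scalerBr scalerA mulVf ?gt_eqF // scale1r //.
Qed.

Lemma g_fb_step x : exists a, g (fb_step x) = a%:E.
Proof. exact: subdiff_fin (fb_subgradP x). Qed.

Lemma fb_mulB x : B *m x = fb_step x + gamma *: fb_subgrad x + gamma *: b.
Proof.
rewrite /fb_subgrad scalerBr scalerA mulfV ?gt_eqF // scale1r mulBE.
move: (fb_step x) (A *m x) => v w.
by apply/matrixP => i j; rewrite !mxE; ring.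
Qed.

Lemma fbe_grad_fb x : fbe_grad x = A *m fb_step x + fb_subgrad x + b.
Proof.
rewrite /fbe_grad mulmxBr fb_mulB mulBE.
move: (A *m fb_step x) (fb_step x) (fb_subgrad x) => w v s.
by apply/matrixP => i j; rewrite !mxE; field; rewrite gt_eqF.
Qed.

Lemma fb_forward x : x - gamma *: (A *m x + b) = B *m x - gamma *: b.
Proof. by rewrite mulBE scalerDr opprD addrA. Qed.

Lemma fb_nonexpansive x y : enorm (fb_step y - fb_step x) <= enorm (B *m (y - x)).
Proof.
apply: le_trans (prox_map_nonexpansive g_proper g_lsc g_convex gamma_gt0 _ _) _.
by rewrite !fb_forward mulmxBr opprB addrA subrK.
Qed.

(** The preimage of (v, s) is B^-1 (v + gamma s + gamma b), by uniqueness of the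
    proximal point. *)
Lemma fb_param v s : subdiff g v s -> exists2 x, fb_step x = v & fb_subgrad x = s.
Proof.
move=> vs; pose x := invmx B *m (v + gamma *: s + gamma *: b).
have Bx : B *m x = v + gamma *: s + gamma *: b.
  by rewrite mulmxA mulmxV ?mul1mx // pd_unitmx.
have xv : fb_step x = v.
  rewrite /fb_step fb_forward Bx addrK.
  exact: (prox_map_of_subdiff g_proper g_lsc g_convex gamma_gt0 vs).
exists x => //; have := fb_mulB x; rewrite Bx xv => /addIr /addrI /esym.
by move=> /(scalerI (lt0r_neq0 gamma_gt0)).
Qed.

Lemma fb_step_stationary x : fbe_grad x = 0 -> fb_step x = x.
Proof.
move=> Gx; apply/esym/eqP; rewrite -subr_eq0; apply/negPn/negP => /hB.2.
move/(congr1 (fun z => gamma *: z)): Gx.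
rewrite /fbe_grad scalerA mulfV ?gt_eqF // scale1r scaler0 => ->.
by rewrite dot0l ltxx.
Qed.

Lemma fb_model_expand x y p z : fb_model (x + p) (y + z) = fb_model x y
  + gamma^-1 * dot (B *m (x - y)) p - dot (gamma^-1 *: (x - y) - (A *m x + b)) z
  - 2^-1 * dot (A *m p) p + dot (A *m p) z + (2 * gamma)^-1 * enorm (z - p) ^+ 2.
Proof.
rewrite /fb_model /quad mulBE.
have -> : y + z - (x + p) = (y - x) + (z - p) by apply/matrixP => i j; rewrite !mxE; ring.
have -> : x - y = - (y - x) by rewrite opprB.
have [v vE] : exists v, v = y - x by eexists.
rewrite -vE !sqr_enorm !(mulmxDr, mulmxN) !dotE.
rewrite (dot_psdC p x) (dot_psdC p v) !(dotC p v) !(dotC z v) !(dotC z p).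
by field; rewrite gt_eqF.
Qed.

(** Both inequalities compare the minimization problems defining psi at two
    points: the upper one by keeping the minimizer of the first, the lower one
    by the subgradient inequality of g at it. *)
Lemma smooth_convex_of_fb_model (v : 'cV[R]_n -> 'cV[R]_n) (psi : 'cV[R]_n -> R) :
  (forall x, subdiff g (v x) (gamma^-1 *: (x - v x) - (A *m x + b))) ->
  (forall x a, g (v x) = a%:E -> psi x = fb_model x (v x) + a) ->
  (forall x y a, g y = a%:E -> psi x <= fb_model x y + a) ->
  smooth_convex psi (fun x => gamma^-1 *: (B *m (x - v x))) gamma^-1.
Proof.
move=> vsub psiE psi_le; split; first by rewrite invr_gt0.
- move=> x y.
  have [a ga] := subdiff_fin (vsub x); have [c gc] := subdiff_fin (vsub y).
  have [_ /(_ (v y))] := vsub x.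
  rewrite (psiE _ _ ga) (psiE _ _ gc) ga gc -EFinD lee_fin.
  have := fb_model_expand x (v x) (y - x) (v y - v x).
  have xyx z w : z + (w - z) = w :> 'cV[R]_n by rewrite addrC subrK.
  rewrite !xyx dotZl => ->.
  move: (y - x) (v y - v x) => p z h.
  have := dot_ge0 ((z - p) + gamma *: (A *m p)); have := sqr_psd_le p.
  rewrite -(subrK p z) addrK in h *; move: (z - p) h => w.
  rewrite sqr_enorm !(dotDl w) !(dotDr w) !dotZl !dotZr (dotC (A *m p) w).
  set X := dot (A *m p) (A *m p); set Y := dot (A *m p) p; set Z := dot w (A *m p).
  set W := dot w w => h h1 h2.
  have h3 : 0 <= (2 * gamma)^-1 * (gamma * Y + 2 * (gamma * Z) + W).
    rewrite mulr_ge0 ?invr_ge0 ?mulr_ge0 ?(ltW gamma_gt0) //.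
    by have := ler_wpM2l (ltW gamma_gt0) h1; lra.
  have h4 : (2 * gamma)^-1 * (gamma * Y + 2 * (gamma * Z) + W) = 2^-1 * Y + Z + (2 * gamma)^-1 * W.
    by field; rewrite gt_eqF.
  lra.
- move=> x y; have [a ga] := subdiff_fin (vsub x).
  have := psi_le y _ _ ga; rewrite (psiE _ _ ga) => /le_trans; apply.
  have := fb_model_expand x (v x) (y - x) 0.
  have xyx z w : z + (w - z) = w :> 'cV[R]_n by rewrite addrC subrK.
  rewrite addr0 xyx => ->.
  rewrite dotZl !dot0r sub0r enormN.
  have := hA.2 (y - x); rewrite invfM (mulrC (2^-1)); lra.
Qed.

Lemma comp_fbe_le x y : (comp_fbe A b alpha g gamma x <= (fb_model x y)%:E + g y)%E.
Proof.
apply: ge_ereal_inf; exists ((fb_model x y)%:E + g y)%E => //; exists y => //.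
by rewrite grad_quad addeAC -EFinD.
Qed.

Lemma comp_fbeE x : comp_fbe A b alpha g gamma x = ((fb_model x (fb_step x))%:E + g (fb_step x))%E.
Proof.
apply/eqP; rewrite eq_le comp_fbe_le andTb; apply: le_ereal_inf_tmp => _ [y _ <-].
rewrite grad_quad addeAC -EFinD -/(fb_model x y).
have [_ /(_ y)] := fb_subgradP x; have [a ->] := g_fb_step x.
have [->|[c ->]] := proper_cases g_proper y; first by move=> _; rewrite addeC addye // leey.
rewrite -!EFinD !lee_fin => h.
have := fb_model_expand x (fb_step x) 0 (y - fb_step x).
have xyx z w : z + (w - z) = w :> 'cV[R]_n by rewrite addrC subrK.
rewrite xyx !addr0 -/(fb_subgrad x) dot0r mulmx0 !dot0l subr0 => ->.
have q0 : 0 <= (2 * gamma)^-1 * enorm (y - fb_step x) ^+ 2.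
  by rewrite mulr_ge0 ?sqr_ge0 // invr_ge0 mulr_ge0 // ltW.
lra.
Qed.

Lemma comp_fbe_fin x : comp_fbe A b alpha g gamma x = (psi x)%:E.
Proof. by rewrite /fbe_value comp_fbeE; have [a ->] := g_fb_step x; rewrite -EFinD. Qed.

Lemma fbe_valueE x (a : R) : g (fb_step x) = a%:E -> psi x = fb_model x (fb_step x) + a.
Proof. by move=> ga; rewrite /fbe_value comp_fbeE ga. Qed.

Lemma fbe_value_le x y (a : R) : g y = a%:E -> psi x <= fb_model x y + a.
Proof. by move=> ga; have := comp_fbe_le x y; rewrite comp_fbe_fin ga -EFinD lee_fin. Qed.

Theorem fbe_smooth_convex : smooth_convex psi fbe_grad gamma^-1.
Proof.
exact: smooth_convex_of_fb_model fb_subgradP fbe_valueE fbe_value_le.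
Qed.

Lemma comp_fbe_gradE x : comp_fbe_grad A b alpha g gamma x = fbe_grad x.
Proof.
have psiG := fbe_smooth_convex.
apply: (@grad_of_quadratic_bound _ _ psi _ _ (gamma^-1 / 2)) => y.
have := gradient_le psiG x y; have := descent_le psiG x y => h1 h2.
rewrite ger0_norm; lra.
Qed.

End Envelope.

(** * Normal cones to the graph of the subdifferential *)

Section Normals.
Variables (R : realType) (m : nat) (Theta : set 'cV[R]_m).
Implicit Types (z v y : 'cV[R]_m).

Lemma regular_normalP z v : regular_normal Theta z v <->
  Theta z /\ forall e, 0 < e -> exists2 d, 0 < d & forall y, Theta y -> enorm (y - z) < d ->
    dot v (y - z) <= e * enorm (y - z).
Proof.
split=> -[Tz h]; split=> //.
  move=> e e0; have : (limf_esup (fun y => (dot v (y - z) / enorm (y - z))%:E)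
      (within Theta z^') < e%:E)%E by apply: le_lt_trans h _; rewrite lte_fin.
  rewrite limf_esupE => /ereal_inf_lt[_ [V VF <-] Ve].
  move: VF => /enorm_nbhsP[d d0 dV]; exists d => // y Ty yd.
  have [->|yz] := eqVneq y z; first by rewrite subrr dot0r enorm0 mulr0.
  have Vy : V y by apply: (dV y yd yz Ty).
  have yz0 : 0 < enorm (y - z) by rewrite enorm_gt0 // subr_eq0.
  have : ((dot v (y - z) / enorm (y - z))%:E < e%:E)%E.
    by apply: le_lt_trans Ve; apply: ereal_sup_ubound; exists y.
  by rewrite lte_fin ltr_pdivrMr // => /ltW.
rewrite leNgt; apply/negP => /ereal_between[e /andP[]]; rewrite lte_fin => e0.
rewrite limf_esupE; apply/negP; rewrite -leNgt.
have [d d0 dP] := h e e0.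
apply: ge_ereal_inf; exists (ereal_sup ((fun y => (dot v (y - z) / enorm (y - z))%:E) @`
   [set y | Theta y /\ y <> z /\ enorm (y - z) < d])).
  exists [set y | Theta y /\ y <> z /\ enorm (y - z) < d] => //.
  by apply/enorm_nbhsP; exists d => // y yd /eqP yz Ty; split.
apply: ge_ereal_sup => _ [y [Ty [/eqP yz yd]] <-]; rewrite lee_fin.
have yz0 : 0 < enorm (y - z) by rewrite enorm_gt0 // subr_eq0.
by rewrite ler_pdivrMr // dP.
Qed.

Lemma limiting_normalP z v : limiting_normal Theta z v <->
  Theta z /\ forall e, 0 < e -> exists z' v', [/\ enorm (z' - z) < e, enorm (v' - v) < e &
    regular_normal Theta z' v'].
Proof.
split=> -[Tz]; [move=> [z_ [v_ [/ecvgP zz /ecvgP vv zv]]]; split=> // e e0 | move=> h; split=> //].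
  have [N NP] := zz e e0; have [M MP] := vv e e0.
  exists (z_ (maxn N M)), (v_ (maxn N M)); split=> //.
    by apply: NP; rewrite leq_maxl.
  by apply: MP; rewrite leq_maxr.
have /choice[p pP] : forall k : nat, exists p : 'cV[R]_m * 'cV[R]_m,
   [/\ enorm (p.1 - z) < k.+1%:R^-1, enorm (p.2 - v) < k.+1%:R^-1 & regular_normal Theta p.1 p.2].
  move=> k; have [|z' [v' zv]] := h k.+1%:R^-1; first by rewrite invr_gt0.
  by exists (z', v').
exists (fun k => (p k).1), (fun k => (p k).2); split=> [||k]; last by case: (pP k).
- apply/ecvgP => e e0; have [N NP] := @exists_small_inv R 1 e ler01 e0.
  by exists N => k /NP; rewrite div1r; apply: lt_trans; case: (pP k).
- apply/ecvgP => e e0; have [N NP] := @exists_small_inv R 1 e ler01 e0.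
  by exists N => k /NP; rewrite div1r; apply: lt_trans; case: (pP k).
Qed.

End Normals.

Lemma regular_coderiv_scale (R : realType) n (G : 'cV[R]_n -> 'cV[R]_n) x h u (c : R) : 0 < c ->
  regular_coderiv G x h u -> regular_coderiv G x (c *: h) (c *: u).
Proof.
move=> c0 xhu e e0; have [d d0 dP] := xhu (e / c) (divr_gt0 e0 c0).
exists d => // y yd; rewrite !dotZl; have := ler_wpM2l (ltW c0) (dP y yd).
by rewrite mulrDr mulrA (mulrC c (e / c)) divfK // gt_eqF.
Qed.

(** The graph of a maximal monotone T is parametrized by x |-> (v, s) with
    B x = v + gamma s + gamma b; normals to it are compared with coderivatives of
    G x = gamma^-1 B (x - v) = A v + s + b. *)
Section Graph.
Variables (R : realType) (n : nat) (A B : 'M[R]_n) (b : 'cV[R]_n) (gamma : R)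
  (T : 'cV[R]_n -> set 'cV[R]_n) (step sub G : 'cV[R]_n -> 'cV[R]_n).
Hypotheses (A_sym : A^T = A) (BE : B = 1%:M - gamma *: A) (B_unit : B \in unitmx)
  (gamma_gt0 : 0 < gamma).
Hypotheses (T_graph : forall x, T (step x) (sub x))
  (T_param : forall v s, T v s -> exists2 x, step x = v & sub x = s)
  (mulB_fb : forall x, B *m x = step x + gamma *: sub x + gamma *: b)
  (G_fb : forall x, G x = A *m step x + sub x + b)
  (step_nonexpansive : forall x y, enorm (step y - step x) <= enorm (B *m (y - x))).
Implicit Types (x y z v w s u p h : 'cV[R]_n).

Let mulBE x : B *m x = x - gamma *: (A *m x).
Proof. by rewrite BE mulmxBl mul1mx scalemxAl. Qed.

Let B_sym : B^T = B.
Proof. by rewrite BE linearB linearZ /= trmx1 A_sym. Qed.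

Lemma mulBV x : B *m (invmx B *m x) = x.
Proof. by rewrite mulmxA mulmxV ?mul1mx. Qed.

Lemma mulVB x : invmx B *m (B *m x) = x.
Proof. by rewrite mulmxA mulVmx ?mul1mx. Qed.

Lemma gph_fb x : gph T (col_mx (step x) (sub x)).
Proof. by rewrite /gph /= col_mxKu col_mxKd. Qed.

Lemma fb_lipschitz : exists2 c, 0 <= c & forall x y,
  enorm (step y - step x) <= c * enorm (y - x) /\ enorm (sub y - sub x) <= c * enorm (y - x).
Proof.
have [k k0 kP] := mulmx_bounded B.
have h x y : enorm (step y - step x) <= k * enorm (y - x).
  exact: le_trans (step_nonexpansive x y) (kP _).
exists (k + 2 * k / gamma) => [|x y].
  by rewrite addr_ge0 // divr_ge0 ?mulr_ge0 // ltW.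
have D0 := enorm_ge0 (y - x).
have kD : 0 <= k * enorm (y - x) by rewrite mulr_ge0.
have k2 : 0 <= 2 * k / gamma * enorm (y - x).
  by rewrite mulr_ge0 // divr_ge0 ?mulr_ge0 // ltW.
split; first by apply: le_trans (h x y) _; rewrite mulrDl; lra.
have -> : sub y - sub x = gamma^-1 *: (B *m (y - x) - (step y - step x)).
  rewrite mulmxBr (mulB_fb y) (mulB_fb x); move: (step y) (sub y) (step x) (sub x) => v s v' s'.
  by apply/matrixP => i j; rewrite !mxE; field; rewrite gt_eqF.
rewrite enormZ gtr0_norm ?invr_gt0 //.
have h1 : gamma^-1 * enorm (B *m (y - x) - (step y - step x)) <=
    gamma^-1 * (2 * (k * enorm (y - x))).
  rewrite ler_pM2l ?invr_gt0 // (le_trans (ler_enormB _ _)) //.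
  have := kP (y - x); have := h x y; lra.
lra.
Qed.

(** Dual to the linear relations between (x, G x) and (v, s). *)
Lemma graph_pairing x y p w h u : u = B *m (p + A *m h) -> B *m h = gamma *: p - w ->
  dot u (y - x) - dot h (G y - G x) = dot p (step y - step x) + dot w (sub y - sub x).
Proof.
move=> uE hE; have -> : w = gamma *: p - B *m h by rewrite hE opprB addrC subrK.
rewrite uE dot_mulmx_tr B_sym !G_fb.
have -> : B *m (y - x) = (step y - step x) + gamma *: (sub y - sub x).
  rewrite mulmxBr (mulB_fb y) (mulB_fb x); move: (step y) (sub y) (step x) (sub x) => v s v' s'.
  by apply/matrixP => i j; rewrite !mxE; ring.
have -> : A *m step y + sub y + b - (A *m step x + sub x + b) =
    A *m (step y - step x) + (sub y - sub x).
  rewrite mulmxBr; move: (A *m step y) (A *m step x) (sub y) (sub x) => v v' s s'.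
  by apply/matrixP => i j; rewrite !mxE; ring.
move: (step y - step x) (sub y - sub x) => v s.
rewrite mulBE !dotE (dotC h (A *m v)) (_ : dot (A *m v) h = dot (A *m h) v); last by rewrite dot_mulmx_tr A_sym dotC.
lra.
Qed.

(** The parametrization is Lipschitz in both directions, so it carries regular
    normals to the graph into regular coderivatives of G and back. *)
Lemma regular_normal_coderiv x p w h u :
  u = B *m (p + A *m h) -> B *m h = gamma *: p - w ->
  regular_normal (gph T) (col_mx (step x) (sub x)) (col_mx p w) <->
  regular_coderiv G x h u.
Proof.
move=> uE hE; rewrite regular_normalP.
have pair y : dot (col_mx p w) (col_mx (step y) (sub y) - col_mx (step x) (sub x)) =
    dot u (y - x) - dot h (G y - G x).
  by rewrite col_mxB dot_col_mx (graph_pairing x y uE hE).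
split=> [[_ pw] e e0|xhu].
  have [c c0 cP] := fb_lipschitz; have c2 : 0 < 2 * c + 1 by rewrite ltr_wpDl // mulr_ge0.
  have [d d0 dP] := pw (e / (2 * c + 1)) (divr_gt0 e0 c2).
  exists (d / (2 * c + 1)) => [|y]; first by rewrite divr_gt0.
  rewrite ltr_pdivlMr // => yd.
  have [h1 h2] := cP x y; have D0 := enorm_ge0 (y - x).
  have h3 : enorm (col_mx (step y) (sub y) - col_mx (step x) (sub x)) <= (2 * c + 1) * enorm (y - x).
    by rewrite col_mxB (le_trans (enorm_col_mx_le _ _)) //; lra.
  have h3d : enorm (col_mx (step y) (sub y) - col_mx (step x) (sub x)) < d.
    by apply: le_lt_trans h3 _; rewrite mulrC.
  have := dP _ (gph_fb y) h3d; rewrite pair => h4.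
  have h5 : e / (2 * c + 1) * enorm (col_mx (step y) (sub y) - col_mx (step x) (sub x)) <=
      e / (2 * c + 1) * ((2 * c + 1) * enorm (y - x)).
    by rewrite ler_wpM2l // divr_ge0 // ltW.
  rewrite mulrA divfK ?gt_eqF // in h5; lra.
split=> [|e e0]; first exact: gph_fb.
have [k k0 kP] := mulmx_bounded (invmx B).
have xy y : enorm (y - x) <= k * (1 + gamma) *
    enorm (col_mx (step y) (sub y) - col_mx (step x) (sub x)).
  have -> : y - x = invmx B *m ((step y - step x) + gamma *: (sub y - sub x)).
    rewrite -[LHS]mulVB mulmxBr (mulB_fb y) (mulB_fb x); congr (_ *m _).
    move: (step y) (sub y) (step x) (sub x) => v s v' s'.
    by apply/matrixP => i j; rewrite !mxE; ring.
  rewrite (le_trans (kP _)) // -mulrA ler_wpM2l //.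
  rewrite (le_trans (ler_enormD _ _)) // enormZ gtr0_norm // col_mxB mulrDl mul1r.
  by rewrite lerD ?ler_pM2l ?enorm_le_col_mxu ?enorm_le_col_mxd.
have q0 : 0 < k * (1 + gamma) + 1 by rewrite ltr_wpDl // mulr_ge0 // addr_ge0 // ltW.
have [d d0 dP] := xhu (e / (k * (1 + gamma) + 1)) (divr_gt0 e0 q0).
exists (d / (k * (1 + gamma) + 1)) => [|z]; first by rewrite divr_gt0.
rewrite -(vsubmxK z) => zg; have := zg; rewrite /gph /= col_mxKu col_mxKd => /T_param[y <- <-].
rewrite ltr_pdivlMr // => zd.
set D := enorm (col_mx (step y) (sub y) - col_mx (step x) (sub x)) in zd *.
have D0 : 0 <= D := enorm_ge0 _.
have h1 := xy y; rewrite -/D in h1.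
have yd : enorm (y - x) < d by lra.
have := dP y yd; rewrite pair => h2.
have h3 : e / (k * (1 + gamma) + 1) * enorm (y - x) <=
    e / (k * (1 + gamma) + 1) * ((k * (1 + gamma) + 1) * D).
  by rewrite ler_wpM2l ?divr_ge0 ?(ltW e0) ?(ltW q0) // mulrDl mul1r; lra.
rewrite mulrA divfK ?gt_eqF // in h3; lra.
Qed.

Lemma limiting_normal_coderiv x p w h u :
  u = B *m (p + A *m h) -> B *m h = gamma *: p - w ->
  limiting_normal (gph T) (col_mx (step x) (sub x)) (col_mx p w) <->
  limiting_coderiv G x h u.
Proof.
move=> uE hE; rewrite limiting_normalP.
have [kI kI0 kIP] := mulmx_bounded (invmx B).
have [kB kB0 kBP] := mulmx_bounded B.
have [kA kA0 kAP] := mulmx_bounded A.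
split=> [[_ pw] e e0|xhu].
  pose c1 := kI * (1 + gamma); pose c2 := kB * (1 + kA * c1).
  have c10 : 0 <= c1 by rewrite mulr_ge0 // addr_ge0 // ltW.
  have c20 : 0 <= c2 by rewrite mulr_ge0 // addr_ge0 // mulr_ge0.
  have q0 : 0 < c1 + c2 + 1 by rewrite ltr_wpDl // addr_ge0.
  have [z' [n' [zz nn]]] := pw (e / (c1 + c2 + 1)) (divr_gt0 e0 q0).
  move: zz nn; rewrite -(vsubmxK z') -(vsubmxK n') !col_mxB.
  move: (usubmx z') (dsubmx z') (usubmx n') (dsubmx n') => v' s' p' w'.
  rewrite !ltr_pdivlMr // => zz nn vs.
  have [x' x'v x's] : exists2 x', step x' = v' & sub x' = s'.
    apply: T_param; case/regular_normalP: vs => + _.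
    by rewrite /gph /= col_mxKu col_mxKd.
  pose h' := invmx B *m (gamma *: p' - w').
  pose u' := B *m (p' + A *m h').
  have h'E : B *m h' = gamma *: p' - w' by exact: mulBV.
  have Dp : enorm (p' - p) <= enorm (col_mx (p' - p) (w' - w)) := enorm_le_col_mxu _ _.
  have Dw : enorm (w' - w) <= enorm (col_mx (p' - p) (w' - w)) := enorm_le_col_mxd _ _.
  have Dv : enorm (v' - step x) <= enorm (col_mx (v' - step x) (s' - sub x)) := enorm_le_col_mxu _ _.
  have Ds : enorm (s' - sub x) <= enorm (col_mx (v' - step x) (s' - sub x)) := enorm_le_col_mxd _ _.
  set D := enorm (col_mx (p' - p) _) in nn Dp Dw; set E := enorm (col_mx (v' - _) _) in zz Dv Ds.
  have D0 : 0 <= D := enorm_ge0 _; have E0 : 0 <= E := enorm_ge0 _.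
  have hh : enorm (h' - h) <= c1 * D.
    have -> : h' - h = invmx B *m (gamma *: (p' - p) - (w' - w)).
      rewrite -[LHS]mulVB mulmxBr h'E hE; congr (_ *m _).
      by apply/matrixP => i j; rewrite !mxE; ring.
    rewrite (le_trans (kIP _)) // /c1 -mulrA ler_wpM2l // (le_trans (ler_enormB _ _)) //.
    rewrite enormZ gtr0_norm //; have := ler_wpM2l (ltW gamma_gt0) Dp; lra.
  have uu : enorm (u' - u) <= c2 * D.
    have -> : u' - u = B *m ((p' - p) + A *m (h' - h)).
      rewrite uE /u' -mulmxBr (mulmxBr A); congr (_ *m _); move: (A *m h') (A *m h) => y z.
      by apply/matrixP => i j; rewrite !mxE; ring.
    rewrite (le_trans (kBP _)) // /c2 -mulrA ler_wpM2l // (le_trans (ler_enormD _ _)) //.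
    rewrite mulrDl mul1r lerD // (le_trans (kAP _)) // -mulrA ler_wpM2l //.
  have xx : enorm (x' - x) <= c1 * E.
    have -> : x' - x = invmx B *m ((v' - step x) + gamma *: (s' - sub x)).
      rewrite -[LHS]mulVB mulmxBr (mulB_fb x') (mulB_fb x) x'v x's; congr (_ *m _).
      move: (step x) (sub x) => v s.
      by apply/matrixP => i j; rewrite !mxE; ring.
    rewrite (le_trans (kIP _)) // /c1 -mulrA ler_wpM2l // (le_trans (ler_enormD _ _)) //.
    rewrite enormZ gtr0_norm //; have := ler_wpM2l (ltW gamma_gt0) Ds; lra.
  have c1D := mulr_ge0 c10 D0; have c2D := mulr_ge0 c20 D0.
  have c1E := mulr_ge0 c10 E0; have c2E := mulr_ge0 c20 E0.
  exists x', h', u'; split; [lra | lra | lra |].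
  by rewrite -(regular_normal_coderiv x' (erefl u') h'E) x'v x's.
split=> [|e e0]; first exact: gph_fb.
have [c c0 cP] := fb_lipschitz.
pose q := 2 * c + (1 + gamma) * kI + kA + 2.
have gkI : 0 <= (1 + gamma) * kI by rewrite mulr_ge0 // addr_ge0 // ltW.
have q0 : 0 < q by rewrite /q; lra.
have [x' [h' [u' [xx hh uu rc]]]] := xhu (e / q) (divr_gt0 e0 q0).
rewrite !ltr_pdivlMr // in xx hh uu.
pose p' := invmx B *m u' - A *m h'; pose w' := gamma *: p' - B *m h'.
have u'E : u' = B *m (p' + A *m h') by rewrite /p' subrK mulBV.
have h'E : B *m h' = gamma *: p' - w' by rewrite /w' opprB addrC subrK.
exists (col_mx (step x') (sub x')), (col_mx p' w'); split; last first.
- by rewrite (regular_normal_coderiv x' u'E h'E).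
- have pE : p = invmx B *m u - A *m h by rewrite uE mulVB addrK.
  have wE : w = gamma *: (invmx B *m u) - h.
    have -> : w = gamma *: p - B *m h by rewrite hE opprB addrC subrK.
    by rewrite pE mulBE; move: (invmx B *m u) (A *m h) => y z; apply/matrixP => i j; rewrite !mxE; ring.
  have w'E : w' = gamma *: (invmx B *m u') - h'.
    by rewrite /w' /p' mulBE; move: (invmx B *m u') (A *m h') => y z; apply/matrixP => i j; rewrite !mxE; ring.
  rewrite col_mxB (le_lt_trans (enorm_col_mx_le _ _)) //.
  have -> : p' - p = invmx B *m (u' - u) - A *m (h' - h).
    rewrite pE /p' !mulmxBr; move: (invmx B *m u') (A *m h') (invmx B *m u) (A *m h) => y z y' z'.
    by apply/matrixP => i j; rewrite !mxE; ring.
  have -> : w' - w = gamma *: (invmx B *m (u' - u)) - (h' - h).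
    rewrite wE w'E !mulmxBr; move: (invmx B *m u') (invmx B *m u) => y z.
    by apply/matrixP => i j; rewrite !mxE; ring.
  have := ler_enormB (invmx B *m (u' - u)) (A *m (h' - h)).
  have := ler_enormB (gamma *: (invmx B *m (u' - u))) (h' - h).
  rewrite enormZ gtr0_norm //; have h1 := kIP (u' - u); have h2 := kAP (h' - h).
  have h3 := ler_wpM2l (ltW gamma_gt0) h1.
  have := enorm_ge0 (u' - u); have := enorm_ge0 (h' - h).
  set U := enorm (u' - u) in uu h1 h3 *; set H := enorm (h' - h) in hh h2 *.
  move=> H0 U0 h4 h5.
  have h6 : ((1 + gamma) * kI) * (U * q) <= ((1 + gamma) * kI) * e by rewrite ler_wpM2l // ltW.
  have h7 : kA * (H * q) <= kA * e by rewrite ler_wpM2l // ltW.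
  have h8 : 2 * c * e >= 0 by rewrite mulr_ge0 ?mulr_ge0 // ltW.
  rewrite -(ltr_pM2r q0).
  have h9 : enorm (invmx B *m (u' - u) - A *m (h' - h)) + enorm (gamma *: (invmx B *m (u' - u)) - (h' - h))
      <= ((1 + gamma) * kI) * U + (kA + 1) * H by lra.
  have h10 : e * q = 2 * c * e + (1 + gamma) * kI * e + kA * e + 2 * e by rewrite /q; ring.
  have := ler_wpM2r (ltW q0) h9; rewrite h10; lra.
- rewrite col_mxB (le_lt_trans (enorm_col_mx_le _ _)) //.
  have [h1 h2] := cP x x'; have D0 := enorm_ge0 (x' - x).
  have h3 : 0 <= ((1 + gamma) * kI + kA + 2) * enorm (x' - x) by rewrite mulr_ge0 //; lra.
  by move: xx; rewrite /q; lra.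
Qed.

(** If the estimate failed along points tending to xb, then the normalized
    increments and normals would cluster at a direction and a directional
    limiting normal contradicting the semismooth* property. *)
Lemma semismooth_estimate_of_star (l : R) xb :
  (forall x h u, regular_coderiv G x h u -> enorm u <= l * enorm h) -> G xb = 0 ->
  semismooth_star T (step xb) (sub xb) ->
  forall e, 0 < e -> exists2 r, 0 < r & semismooth_estimate G xb e r.
Proof.
move=> Gl Gxb [_ Tss] e e0; apply: contrapT => noest.
pose bad x h u := [/\ 0 < enorm (x - xb), enorm h = 1, enorm u <= l, regular_coderiv G x h u &
  e * enorm (x - xb) < `|dot u (x - xb) - dot h (G x)|].
have badE (k : nat) : exists q : 'cV[R]_n * ('cV[R]_n * 'cV[R]_n),
    enorm (q.1 - xb) < k.+1%:R^-1 /\ bad q.1 q.2.1 q.2.2.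
  apply: contrapT => nobad; apply: noest; exists k.+1%:R^-1; first by rewrite invr_gt0.
  move=> x h u xk xhu; rewrite leNgt; apply/negP => lt.
  have [hz|hz] := eqVneq (enorm h) 0.
    have uz : u = 0.
      by apply: enorm_eq0; apply/eqP; rewrite eq_le enorm_ge0 andbT (le_trans (Gl _ _ _ xhu)) // hz mulr0.
    by move: lt; rewrite uz (enorm_eq0 hz) !dot0l subrr normr0 enorm0 mulr0 ltxx.
  have h0 : 0 < enorm h by rewrite lt_neqAle eq_sym hz enorm_ge0.
  have i0 : 0 < (enorm h)^-1 by rewrite invr_gt0.
  apply: nobad; exists (x, ((enorm h)^-1 *: h, (enorm h)^-1 *: u)); split=> //; split=> /=.
  - rewrite enorm_gt0 // subr_eq0; apply/eqP => xE.
    by move: lt; rewrite xE Gxb subrr !dot0r subrr normr0 enorm0 mulr0 mul0r ltxx.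
  - by rewrite enormZ gtr0_norm // mulVf.
  - by rewrite enormZ gtr0_norm // mulrC ler_pdivrMr // (Gl _ _ _ xhu).
  - exact: regular_coderiv_scale.
  - by rewrite !dotZl -mulrBr normrM (gtr0_norm i0) [ltRHS]mulrC ltr_pdivlMr.
have {noest badE} /choice[q qP] := badE.
pose x k := (q k).1; pose h k := (q k).2.1; pose u k := (q k).2.2.
pose t k := enorm (x k - xb).
pose p k := invmx B *m u k - A *m h k; pose w k := gamma *: p k - B *m h k.
pose d k := col_mx ((t k)^-1 *: (step (x k) - step xb)) ((t k)^-1 *: (sub (x k) - sub xb)).
have t0 k : 0 < t k by case: (qP k) => _ [].
have normal k : regular_normal (gph T) (col_mx (step xb) (sub xb) + t k *: d k) (col_mx (p k) (w k)).
  have -> : col_mx (step xb) (sub xb) + t k *: d k = col_mx (step (x k)) (sub (x k)).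
    rewrite /d scale_col_mx !scalerA mulfV ?gt_eqF // !scale1r add_col_mx.
    by rewrite (addrC (step xb)) (addrC (sub xb)) !subrK.
  rewrite (@regular_normal_coderiv _ _ _ (h k) (u k)); first by case: (qP k) => _ [].
    by rewrite /p subrK mulBV.
  by rewrite /w opprB addrC subrK.
have pair k : e < `|dot (col_mx (p k) (w k)) (d k)|.
  have uE : u k = B *m (p k + A *m h k) by rewrite /p subrK mulBV.
  have hE : B *m h k = gamma *: p k - w k by rewrite /w opprB addrC subrK.
  rewrite dot_col_mx !dotZr -mulrDr -(graph_pairing xb (x k) uE hE) Gxb subr0.
  rewrite normrM (gtr0_norm (_ : 0 < (t k)^-1)) ?invr_gt0 // mulrC ltr_pdivlMr //.
  by case: (qP k) => _ [].
have [c c0 cP] := fb_lipschitz.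
have [kI kI0 kIP] := mulmx_bounded (invmx B).
have [kB kB0 kBP] := mulmx_bounded B.
have [kA kA0 kAP] := mulmx_bounded A.
pose C := kI * l + kA.
have pC k : enorm (p k) <= C.
  case: (qP k) => _ [_ h1 ul _ _]; rewrite (le_trans (ler_enormB _ _)) // lerD //.
    by rewrite (le_trans (kIP _)) // ler_wpM2l.
  by have := kAP (h k); rewrite h1 mulr1.
have wC k : enorm (w k) <= gamma * C + kB.
  case: (qP k) => _ [_ h1 _ _ _]; rewrite (le_trans (ler_enormB _ _)) // lerD //.
    by rewrite enormZ gtr0_norm // ler_pM2l.
  by have := kBP (h k); rewrite h1 mulr1.
have dC k : enorm (d k) <= c + c.
  have [h1 h2] := cP xb (x k); have ti : 0 < (t k)^-1 by rewrite invr_gt0.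
  rewrite (le_trans (enorm_col_mx_le _ _)) // !enormZ (gtr0_norm ti) lerD //;
  by rewrite mulrC ler_pdivrMr.
have zC k : enorm (col_mx (d k) (col_mx (p k) (w k))) <= c + c + (C + (gamma * C + kB)).
  rewrite (le_trans (enorm_col_mx_le _ _)) // lerD // (le_trans (enorm_col_mx_le _ _)) //.
  exact: lerD.
have [Z ZP] := bounded_seq_cluster zC.
pose d0 := usubmx Z; pose n0 := dsubmx Z.
have {ZP} /choice[kk kkP] : forall N : nat, exists k, [/\ (N <= k)%N,
    enorm (d k - d0) < N.+1%:R^-1 & enorm (col_mx (p k) (w k) - n0) < N.+1%:R^-1].
  move=> N; have [|k Nk] := ZP N.+1%:R^-1 N; first by rewrite invr_gt0.
  rewrite -(vsubmxK Z) col_mxB => kZ; exists k; split=> //; apply: le_lt_trans kZ.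
    exact: enorm_le_col_mxu.
  exact: enorm_le_col_mxd.
have small (eps : R) : 0 < eps -> exists N, forall k, (N <= k)%N -> k.+1%:R^-1 < eps.
  move=> eps0; have [N NP] := @exists_small_inv R 1 eps ler01 eps0.
  by exists N => k /NP; rewrite div1r.
have : dot n0 d0 = 0.
  have := Tss (usubmx d0) (dsubmx d0) (- dsubmx n0) (usubmx n0).
  rewrite /dir_coderivative /= opprK !vsubmxK => Tss'.
  rewrite -(vsubmxK n0) -(vsubmxK d0) dot_col_mx Tss' ?dotNl ?addNr //.
  split; first exact: gph_fb.
  exists (t \o kk), (d \o kk), (fun N => col_mx (p (kk N)) (w (kk N))); split.
  - by move=> N; exact: t0.
  - apply/cvgrPdist_lt => eps eps0; have [N NP] := small _ eps0; exists N => // k /= Nk.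
    rewrite sub0r normrN (gtr0_norm (t0 _)); have [kkk _ _] := kkP k.
    by case: (qP (kk k)) => xk _; apply: lt_trans xk (NP _ (leq_trans Nk kkk)).
  - apply/ecvgP => eps eps0; have [N NP] := small _ eps0; exists N => k Nk.
    by have [_ h1 _] := kkP k; apply: lt_trans h1 (NP _ Nk).
  - apply/ecvgP => eps eps0; have [N NP] := small _ eps0; exists N => k Nk.
    by have [_ _ h1] := kkP k; apply: lt_trans h1 (NP _ Nk).
  - by move=> N; exact: normal.
move=> nd0; suff : e <= 0 by rewrite leNgt e0.
apply: (@le_of_le_eps _ _ _ (enorm d0 + 1 + enorm n0)) => eps eps0 eps1.
have [N NP] := small _ eps0; have [_ hd hn] := kkP N; have Ne := NP N (leqnn N).
have := pair (kk N); move: (col_mx (p _) _) (d _) hd hn => nu v hd hn.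
have -> : dot nu v = dot (nu - n0) v + dot n0 (v - d0).
  by rewrite !(dotDl, dotDr, dotNl, dotNr) nd0; ring.
have := ler_normD (dot (nu - n0) v) (dot n0 (v - d0)).
have := norm_dot_le (nu - n0) v; have := norm_dot_le n0 (v - d0).
have := ler_enorm_dist v d0.
have := enorm_ge0 v; have := enorm_ge0 n0; have := enorm_ge0 d0.
have := enorm_ge0 (nu - n0); have := enorm_ge0 (v - d0).
set a := enorm (nu - n0) in hn *; set a' := enorm (v - d0) in hd *.
move=> a'0 a0 D0 N0 V0 h1 h2 h3 h4 h5.
have h6 : enorm n0 * a' <= enorm n0 * eps by rewrite ler_wpM2l // ltW // (lt_trans hd).
have h7 : a * enorm v <= eps * (enorm d0 + 1).
  apply: ler_pM => //; first by rewrite ltW // (lt_trans hn).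
  by rewrite (le_trans h1) // lerD2l ltW // (lt_trans hd) // (lt_trans Ne).
lra.
Qed.

End Graph.

(** * Metric regularity of monotone maps and tilt stability *)

Section MetricRegularity.
Variables (R : realType) (n : nat) (T : 'cV[R]_n -> set 'cV[R]_n) (x0 : 'cV[R]_n) (kappa : R).
Hypotheses (kappa_gt0 : 0 < kappa)
  (T_monotone : forall v s w u, T v s -> T w u -> 0 <= dot (s - u) (v - w))
  (T_regular : metrically_regular T x0 0 kappa).
Implicit Types (x y : 'cV[R]_n).

Lemma metrically_regular_lift : exists2 d, 0 < d & forall x y y0 e,
  enorm (x - x0) < d -> enorm y < d -> T x y0 -> 0 < e ->
  exists2 x', T x' y & enorm (x - x') <= kappa * enorm (y - y0) + e.
Proof.
have [_ [U [V [/enorm_nbhsP[dU dU0 dUP] /enorm_nbhsP[dV dV0 dVP] UV]]]] := T_regular.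
exists (Num.min dU dV) => [|x y y0 e]; first by rewrite lt_min dU0.
rewrite !lt_min => /andP[xU _] /andP[_ yV] xy0 e0.
have := UV x y (dUP _ xU) (dVP y ltac:(by rewrite subr0)).
have : (edist_set y (T x) <= (enorm (y - y0))%:E)%E by apply: ge_ereal_inf; exists (enorm (y - y0))%:E => //; exists y0.
have k0 : (0 <= kappa%:E)%E by rewrite lee_fin ltW.
move=> /(lee_wpmul2l k0) h1 /le_trans /(_ h1).
rewrite -EFinM => h2.
have : (edist_set x [set x' | T x' y] < (kappa * enorm (y - y0) + e)%:E)%E.
  by apply: le_lt_trans h2 _; rewrite lte_fin ltrDl.
by move=> /ereal_inf_lt[_ [x' xy <-]]; rewrite lte_fin => /ltW; exists x'.
Qed.

(** If x1 and x2 were two preimages of y, tilting y slightly towards x2 - x1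
    would by monotonicity move the preimages near x1 by at least |x2 - x1|. *)
Lemma metrically_regular_inverse : exists (r : R) (m : 'cV[R]_n -> 'cV[R]_n) (d : R),
  [/\ 0 < r, 0 < d, m 0 = x0,
      forall y, enorm y < r -> enorm (m y - x0) < d /\ (forall x, T x y <-> x = m y) &
      forall y y', enorm y < r -> enorm y' < r -> enorm (m y - m y') <= kappa * enorm (y - y')].
Proof.
have [d d0 lift] := metrically_regular_lift.
have Tx0 : T x0 0 by case: T_regular.
have uniq x1 x2 y : enorm y < d -> enorm (x1 - x0) < d -> T x1 y -> T x2 y -> x1 = x2.
  move=> yd x1d x1y x2y; apply/eqP; rewrite eq_sym -subr_eq0; apply/negPn/negP => /enorm_gt0.
  set D := enorm (x2 - x1) => D0.
  pose t := Num.min (4 * kappa)^-1 ((d - enorm y) / (2 * D)).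
  have t0 : 0 < t by rewrite lt_min invr_gt0 mulr_gt0 // divr_gt0 ?subr_gt0 // mulr_gt0.
  have t1 : t * (4 * kappa) <= 1.
    by rewrite -ler_pdivlMr ?mulr_gt0 // div1r ge_min lexx.
  have t2 : t * (2 * D) <= d - enorm y by rewrite -ler_pdivlMr ?mulr_gt0 // ge_min lexx orbT.
  have tD := mulr_gt0 t0 D0.
  have y'd : enorm (y + t *: (x2 - x1)) < d.
    by rewrite (le_lt_trans (ler_enormD _ _)) // enormZ gtr0_norm // -/D; lra.
  have D4 : 0 < D / 4 by rewrite divr_gt0.
  have [x' x'y'] := lift x1 _ y (D / 4) x1d y'd x1y D4.
  have -> : y + t *: (x2 - x1) - y = t *: (x2 - x1) by rewrite addrC addKr.
  rewrite enormZ gtr0_norm // -/D => h1.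
  have := T_monotone x'y' x2y; have -> : y + t *: (x2 - x1) - y = t *: (x2 - x1) by rewrite addrC addKr.
  rewrite dotZl pmulr_rge0 // => h2.
  have : dot (x2 - x1) (x' - x1) = dot (x2 - x1) (x' - x2) + dot (x2 - x1) (x2 - x1).
    by rewrite -dotDr subrKA.
  rewrite -sqr_enorm -/D => h3.
  have := dot_le_enorm (x2 - x1) (x' - x1); rewrite -/D (enormBC x') => h4.
  have h5 : kappa * (t * D) <= D / 4.
    by have := ler_wpM2r (ltW D0) t1; lra.
  have h6 : D * enorm (x1 - x') <= D * (D / 2) by rewrite ler_pM2l //; lra.
  have := mulr_gt0 D0 D0; rewrite expr2 in h3; lra.
pose r := Num.min d (d / (2 * kappa)).
have r0 : 0 < r by rewrite lt_min d0 divr_gt0 // mulr_gt0.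
have rd : r <= d by rewrite ge_min lexx.
have rk : r * (2 * kappa) <= d by rewrite -ler_pdivlMr ?mulr_gt0 // ge_min lexx orbT.
have /choice[m mP] : forall y, exists x, enorm y < r -> enorm (x - x0) < d /\ T x y.
  move=> y; have [yr|yr] := ltP (enorm y) r; last by exists x0.
  have yd : enorm y < d := lt_le_trans yr rd.
  have x0d : enorm (x0 - x0) < d by rewrite subrr enorm0.
  have e0 : 0 < d / 2 by rewrite divr_gt0.
  have [x xy] := lift x0 y 0 _ x0d yd Tx0 e0; rewrite subr0 => h1.
  exists x => _; split=> //; rewrite enormBC (le_lt_trans h1) //.
  have : enorm y * (2 * kappa) < r * (2 * kappa) by rewrite ltr_pM2r ?mulr_gt0.
  lra.
have mU y : enorm y < r -> enorm (m y - x0) < d /\ (forall x, T x y <-> x = m y).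
  move=> yr; have [my Ty] := mP y yr; split=> // x; split=> [xy|->//].
  by apply/esym; exact: uniq (lt_le_trans yr rd) my Ty xy.
exists r, m, d; split=> //.
- have [|_ h] := mU 0; first by rewrite enorm0.
  exact/esym/h.
- move=> y y' yr y'r; have [my Ty] := mP y yr; have [_ h] := mU y' y'r.
  apply: (@le_of_le_eps _ _ _ 1) => e e0 _; rewrite mul1r.
  have [x' /h -> ] := lift _ _ _ _ my (lt_le_trans y'r rd) Ty e0.
  by rewrite (enormBC y').
Qed.

End MetricRegularity.

(** By convexity the minimizers of the tilt phi - <v, .> are the preimages of v
    under the subdifferential. *)
Lemma tilt_stable_of_metric_regularity (R : realType) n (phi : 'cV[R]_n -> \bar R) x0 (kappa : R) :
  (forall x, phi x != -oo%E) -> 0 < kappa ->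
  metrically_regular (subdiff phi) x0 0 kappa -> tilt_stable phi x0 kappa.
Proof.
move=> phiN k0 reg; have Tx0 : subdiff phi x0 0 by case: reg.
have [r [m [d [r0 d0 m0 mP mlip]]]] :=
  metrically_regular_inverse k0 (fun v s w u => @subdiff_monotone _ _ phi v s w u) reg.
split; first by case: Tx0.
exists d, m, [set y | enorm y < r]; split=> //.
- by apply/enorm_nbhsP; exists r => // y; rewrite subr0.
- move=> v vr; have [mv vP] := mP v vr; have mvT : subdiff phi (m v) v by apply/vP.
  have [a ma] := subdiff_fin mvT; have [_ mvmin] := mvT; rewrite ma in mvmin.
  have mmin y : (phi (m v) - (dot v (m v))%:E <= phi y - (dot v y)%:E)%E.
    have := mvmin y; rewrite ma; have := phiN y; case: (phi y) => [c| |] // _.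
      by rewrite -!EFinD !lee_fin dotDr dotNr; lra.
    by move=> _; rewrite addye // leey.
  apply/seteqP; split=> [y [_ ymin]|_ ->]; last by split=> [|y _]; [exact: ltW | exact: mmin].
  apply/vP; have /= := ymin (m v) (ltW mv); rewrite ma.
  have := phiN y; case yE : (phi y) => [c| |] // _.
  rewrite -!EFinD lee_fin => h1; split; first by rewrite yE.
  move=> w; rewrite yE; apply: le_trans (mvmin w); rewrite -!EFinD lee_fin !dotDr !dotNr; lra.
Qed.

(** * The composite problem *)

Section CompositeProblem.
Variables (R : realType) (n : nat) (A : 'M[R]_n) (b : 'cV[R]_n) (alpha : R)
  (g : 'cV[R]_n -> \bar R) (gamma : R).
Hypotheses (hA : psd_mx A) (g_proper : eproper g) (g_lsc : lower_semicontinuous g)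
  (g_convex : econvex g) (gamma_gt0 : 0 < gamma).
Let B := 1%:M - gamma *: A.
Hypothesis hB : pd_mx B.
Implicit Types (x y z v w s u p h : 'cV[R]_n).

Notation phi := (comp_obj A b alpha g).
Notation psi := (fbe_value A b alpha g gamma).
Notation step := (fb_step A b g gamma).
Notation sub := (fb_subgrad A b g gamma).
Notation G := (fbe_grad A b g gamma).

Lemma comp_obj_neqNy x : phi x != -oo%E.
Proof. by rewrite /comp_obj; case: (proper_cases g_proper x) => [->|[c ->]]. Qed.

Lemma subdiff_comp_obj v y : subdiff phi v y <-> subdiff g v (y - (A *m v + b)).
Proof.
split=> -[].
  have [gv|[a gv]] := proper_cases g_proper v; first by rewrite /comp_obj gv.
  move=> _ vmin; apply: (subdiff_of_quadratic_minorant g_proper g_convex (C := (2 * gamma)^-1)).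
    by rewrite gv.
  move=> w; have := vmin w; rewrite /comp_obj gv.
  have [->|[c ->]] := proper_cases g_proper w; first by move=> _; exact: leey.
  rewrite -!EFinD !lee_fin dotDl dotNl.
  have := quad_upper b alpha hA gamma_gt0 hB v w; lra.
move=> gv vmin; split; first by move: gv; rewrite /comp_obj; case: (g v).
move=> w; have := vmin w; rewrite /comp_obj; move: gv; case: (g v) => // a _.
have [->|[c ->]] := proper_cases g_proper w; first by move=> _; rewrite addey // leey.
rewrite -!EFinD !lee_fin dotDl dotNl.
have := quad_lower b alpha hA v w; lra.
Qed.

Lemma fbe_grad_subdiff x : subdiff phi (step x) (G x).
Proof.
apply/subdiff_comp_obj; rewrite (fbe_grad_fb A b g gamma_gt0).
have -> : A *m step x + sub x + b - (A *m step x + b) = sub x.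
  by move: (A *m step x) (sub x) => v s; apply/matrixP => i j; rewrite !mxE; ring.
exact: fb_subgradP.
Qed.

Lemma fb_decompose x : x = step x + gamma *: (invmx B *m G x).
Proof.
rewrite /fbe_grad -scalemxAr scalerA mulfV ?gt_eqF // scale1r.
by rewrite mulmxA mulVmx ?pd_unitmx // mul1mx addrC subrK.
Qed.

(** The gradient of the envelope at x is a subgradient of phi at the
    forward-backward step of x, so local inverses of the subdifferential of phi
    and of G determine each other through y |-> m y + gamma B ^ -1 y. *)
Lemma fbe_lipschitz_inverse (xb : 'cV[R]_n) (kappa : R) : 0 < kappa ->
  metrically_regular (subdiff phi) xb 0 kappa -> exists K r : R, lipschitz_inverse G K r.
Proof.
move=> k0 reg.
have [r [m [d [r0 d0 m0 mP mlip]]]] :=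
  metrically_regular_inverse k0 (fun v s w u => @subdiff_monotone _ _ phi v s w u) reg.
have [c c0 cP] := mulmx_bounded (invmx B).
have stepE x : enorm (G x) < r -> step x = m (G x).
  by move=> xr; have [_ h] := mP _ xr; apply/h/fbe_grad_subdiff.
exists (kappa + gamma * c), r; split; [|exact: r0| |].
- by rewrite ltr_wpDr // mulr_ge0 // ltW.
- move=> x y xr yr; rewrite {1}(fb_decompose x) {1}(fb_decompose y) (stepE x xr) (stepE y yr).
  move: (G x) (G y) xr yr => p q pr qr.
  have -> : m p + gamma *: (invmx B *m p) - (m q + gamma *: (invmx B *m q)) =
     (m p - m q) + gamma *: (invmx B *m (p - q)).
    by rewrite mulmxBr scalerBr opprD addrACA.
  rewrite (le_trans (ler_enormD _ _)) // mulrDl lerD ?mlip //.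
  by rewrite enormZ gtr0_norm // -mulrA ler_pM2l.
- move=> y yr; have [_ h] := mP _ yr.
  have /subdiff_comp_obj ms : subdiff phi (m y) y by apply/h.
  have [x xs xu] := fb_param b g_proper g_lsc g_convex gamma_gt0 hB ms.
  exists x; rewrite (fbe_grad_fb A b g gamma_gt0) xs xu.
  by move: (A *m m y) => v; apply/matrixP => i j; rewrite !mxE; ring.
Qed.

Lemma stationary_subgrad x : G x = 0 -> step x = x /\ sub x = - (A *m x) - b.
Proof.
move=> Gx; have sx : step x = x by exact: (fb_step_stationary gamma_gt0 hB).
by split=> //; rewrite /fb_subgrad sx subrr scaler0 sub0r opprD.
Qed.

Lemma stationary_argmin x : G x = 0 -> argmin setT phi x.
Proof.
move=> Gx; have [sx _] := stationary_subgrad Gx.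
have [_ xmin] := fbe_grad_subdiff x; split=> // y _.
by have := xmin y; rewrite sx Gx dot0l adde0.
Qed.

Lemma armijoE sigma x d tau :
  armijo A b alpha g gamma sigma x d tau <-> sufficient_decrease psi G sigma x d tau.
Proof.
by rewrite /armijo /sufficient_decrease !(comp_fbe_fin b alpha hA) // (comp_fbe_gradE b alpha hA).
Qed.

Lemma line_searchE sigma beta x d tau :
  line_search A b alpha g gamma sigma beta x d tau <-> backtracking psi G sigma beta x d tau.
Proof.
by split=> -[k [tE /armijoE dec nodec]]; exists k; split=> // j /nodec h /armijoE.
Qed.

(** Normals (p, - w) to the graph of the subdifferential of g and elements u of
    the coderivative of G at h correspond by B h = gamma p + w and
    u = B (p + A h); the Newton system is this correspondence for h = B z. *)
Lemma newton_systemE lambda x z :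
  newton_system A b alpha g gamma lambda x z <->
  newton_direction G (lambda * enorm (G x)) x (B *m z).
Proof.
set mu := lambda * enorm (G x).
pose w := x - step x + (B + (gamma * mu)%:M) *m z.
pose p := - (gamma^-1 *: (x - step x)) - (mu%:M + A *m B) *m z.
have e1 : (mu%:M + A *m B) *m z = mu *: z + A *m (B *m z).
  by rewrite mulmxDl mul_scalar_mx mulmxA.
have e2 : (B + (gamma * mu)%:M) *m z = B *m z + (gamma * mu) *: z.
  by rewrite (mulmxDl B) mul_scalar_mx.
have uE : - G x - mu *: (B *m z) = B *m (p + A *m (B *m z)).
  have -> : p + A *m (B *m z) = - (gamma^-1 *: (x - step x)) - mu *: z.
    by rewrite /p e1 opprD addrA subrK.
  by rewrite (mulmxBr B) mulmxN -!scalemxAr.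
have hE : B *m (B *m z) = gamma *: p - - w.
  rewrite opprK /w /p e1 e2 [LHS](mulBE A gamma) scalerBr scalerN scalerA mulfV ?gt_eqF // scale1r.
  move: (x - step x) (B *m z) => y y'; move: (A *m y') => y''.
  by apply/matrixP => i j; rewrite !mxE; ring.
have lim : limiting_normal (gph (subdiff g)) (col_mx (step x) (sub x)) (col_mx p (- w)) <->
    newton_direction G mu x (B *m z).
  exact: (limiting_normal_coderiv hA.1 (erefl B) (pd_unitmx hB) gamma_gt0
    (fb_subgradP A b g_proper g_lsc g_convex gamma_gt0)
    (fun v s => @fb_param _ _ A b g gamma g_proper g_lsc g_convex gamma_gt0 hB v s)
    (fb_mulB A b g gamma_gt0) (fbe_grad_fb A b g gamma_gt0)
    (fb_nonexpansive A b g_proper g_lsc g_convex gamma_gt0) x uE hE).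
have subE : gamma^-1 *: (x - gamma *: (A *m x + b) - step x) = sub x.
  rewrite /fb_subgrad addrAC scalerBr scalerA mulVf ?gt_eqF // scale1r //.
rewrite -lim /newton_system (comp_fbe_gradE b alpha hA) // -/mu -/B.
have px : prox gamma g (x - gamma *: (A *m x + b)) = [set step x].
  exact: prox_set1.
split=> [[v]|h]; last by exists (step x) => //; rewrite subE.
rewrite px => /esym vE; have {}vE : v = step x by have : [set v] v by []; rewrite vE.
by rewrite vE subE.
Qed.

Lemma grn_step_iteration lambda sigma beta x x' :
  grn_step A b alpha g gamma lambda sigma beta x x' ->
  newton_iteration psi G lambda sigma beta x x'.
Proof.
move=> [z [tau [/newton_systemE zP /line_searchE ls ->]]].
by exists (B *m z), tau.
Qed.

Lemma newton_system_solvable lambda x : 0 < lambda -> G x <> 0 ->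
  exists z, newton_system A b alpha g gamma lambda x z.
Proof.
move=> l0 /eqP /enorm_gt0 Gx0.
have psiG := fbe_smooth_convex b alpha hA g_proper g_lsc g_convex gamma_gt0 hB.
have [d dP] := limiting_coderiv_exists psiG x (- G x) (mulr_gt0 l0 Gx0).
exists (invmx B *m d); apply/newton_systemE.
by rewrite mulmxA mulmxV ?pd_unitmx // mul1mx.
Qed.

Lemma fbe_semismooth (xb : 'cV[R]_n) : G xb = 0 ->
  semismooth_star (subdiff g) xb (- (A *m xb) - b) ->
  forall e, 0 < e -> exists2 r, 0 < r & semismooth_estimate G xb e r.
Proof.
move=> Gxb; have [sx ux] := stationary_subgrad Gxb; rewrite -{1}sx -ux => ss e e0.
have psiG := fbe_smooth_convex b alpha hA g_proper g_lsc g_convex gamma_gt0 hB.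
exact: (semismooth_estimate_of_star hA.1 (erefl B) (pd_unitmx hB) gamma_gt0
    (fb_subgradP A b g_proper g_lsc g_convex gamma_gt0)
    (fun v s => @fb_param _ _ A b g gamma g_proper g_lsc g_convex gamma_gt0 hB v s)
    (fb_mulB A b g gamma_gt0) (fbe_grad_fb A b g gamma_gt0)
    (fb_nonexpansive A b g_proper g_lsc g_convex gamma_gt0)
    (fun x h u => @regular_coderiv_norm _ _ _ _ _ psiG x h u) Gxb ss e0).
Qed.

End CompositeProblem.

Theorem theorem5p7 (R : realType) (n : nat) (A : 'M[R]_n) (b : 'cV[R]_n)
    (alpha : R) (g : 'cV[R]_n -> \bar R) (x0 : 'cV[R]_n)
    (gamma lambda sigma beta : R)
    (hA : psd_mx A)
    (g_proper : eproper g) (g_lsc : lower_semicontinuous g)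
    (g_convex : econvex g)
    (gamma_gt0 : 0 < gamma) (hB : pd_mx (1%:M - gamma *: A))
    (lambda_gt0 : 0 < lambda) (hsigma : 0 < sigma < 2^-1)
    (hbeta : 0 < beta < 1) :
  let phi := comp_obj A b alpha g in
  let grad_phi_gamma := comp_fbe_grad A b alpha g gamma in
  let B := 1%:M - gamma *: A in
  (* (i), first part: unless it stops, the algorithm always produces a further
     iterate, whatever choices have been made *)
  (forall (x : nat -> 'cV[R]_n) (N : nat),
     grn_run A b alpha g gamma lambda sigma beta x0 x N ->
     grad_phi_gamma (x N) <> 0 ->
     (exists z, newton_system A b alpha g gamma lambda (x N) z) /\
     (forall z, newton_system A b alpha g gamma lambda (x N) z ->
        exists tau,
          line_search A b alpha g gamma sigma beta (x N) (B *m z) tau)) /\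
  (forall x : nat -> 'cV[R]_n,
     grn_sequence A b alpha g gamma lambda sigma beta x0 x ->
     (* (i), second part *)
     ((exists N, grad_phi_gamma (x N) = 0) \/
      ((forall k, grad_phi_gamma (x k) <> 0) /\
       forall xbar, cluster (x @ \oo) xbar -> argmin setT phi xbar)) /\
     (forall (xbar : 'cV[R]_n) (kappa : R),
        (forall k, grad_phi_gamma (x k) <> 0) ->
        cluster (x @ \oo) xbar ->
        0 < kappa ->
        metrically_regular (subdiff phi) xbar 0 kappa ->
        (* (ii) *)
        (R_linear_cvg x xbar /\ tilt_stable phi xbar kappa) /\
        (* (iii) *)
        (let vbar := - (A *m xbar) - b in
         let L := 2 * (1 - gamma * lambda_min A) / gamma in
         let K := kappa + gamma * opnorm (invmx B) in
         semismooth_star (subdiff g) xbar vbar ->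
         0 < sigma < (2 * L * K)^-1 \/ twice_epi_differentiable g xbar vbar ->
         Q_superlinear_cvg x xbar))).
Proof.
move=> phi grad_phi_gamma B.
pose psi := fbe_value A b alpha g gamma; pose G := fbe_grad A b g gamma.
have psiG : smooth_convex psi G gamma^-1 by exact: fbe_smooth_convex.
have GE x : grad_phi_gamma x = G x by exact: comp_fbe_gradE.
split=> [x N _|x run].
  rewrite GE => Gx0; split; first exact: newton_system_solvable.
  move=> z /newton_systemE zP.
  have mu0 : 0 < lambda * enorm (G (x N)).
    by rewrite mulr_gt0 // enorm_gt0 //; apply/eqP.
  have [tau tauP] := backtracking_exists psiG hsigma hbeta mu0 (zP hA g_proper g_lsc g_convex gamma_gt0 hB).
  by exists tau; apply/line_searchE.
have steps : (forall k, grad_phi_gamma (x k) <> 0) ->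
    forall k, newton_iteration psi G lambda sigma beta (x k) (x k.+1).
  move=> nstop k; have [_ /(_ k (ltnSn k)) [_]] := run k.+1 (fun j _ => nstop j).
  exact: grn_step_iteration.
split.
  have [[N GN]|nstop] := pselect (exists N, grad_phi_gamma (x N) = 0); first by left; exists N.
  have {}nstop k : grad_phi_gamma (x k) <> 0 by move=> Gk; apply: nstop; exists k.
  right; split=> // xb /ecluster_seqP xbP; apply: (stationary_argmin alpha hA g_proper g_lsc g_convex gamma_gt0 hB).
  exact: (newton_cluster_stationary psiG lambda_gt0 hsigma hbeta (steps nstop) xbP).
move=> xb kappa nstop /ecluster_seqP xbP kappa0 reg.
have xsteps := steps nstop.
have Gxb : G xb = 0 := newton_cluster_stationary psiG lambda_gt0 hsigma hbeta xsteps xbP.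
have [K [r Ginv]] : exists K r : R, lipschitz_inverse G K r.
  exact: fbe_lipschitz_inverse kappa0 reg.
split.
  split; first exact: (newton_linear_cvg psiG Ginv Gxb lambda_gt0 hsigma hbeta xsteps xbP).
  apply: tilt_stable_of_metric_regularity => // y; exact: comp_obj_neqNy.
move=> vbar L KK ss _.
apply: Q_superlinear_of_contraction.
  exact: (newton_cvg psiG Ginv Gxb lambda_gt0 hsigma hbeta xsteps xbP).
have Gss : forall e, 0 < e -> exists2 r, 0 < r & semismooth_estimate G xb e r.
  exact: fbe_semismooth.
move=> eta eta0.
have [q q0 qP] := newton_iteration_superlinear psiG Gxb Ginv beta lambda_gt0 hsigma Gss eta0.
by exists q => // k kq; exact: qP kq (xsteps k).
Qed.
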